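(* Let $\mu,\chi>0$, $\gamma,\kappa\ge0$, let $(u_0,w_0)\in L^2_\sigma(\mathbb{R}^3)\times L^2(\mathbb{R}^3)$ and let $\Gamma\ge0$. If the solution $(u_L,w_L)$ of the linear micropolar system with initial data $(u_0,w_0)$ satisfies $\|u_L(t)\|_{L^2}^2=O(t^{-\Gamma})$ as $t\to+\infty$, then $$\|w_L(t)\|_{L^2}^2+\|\nabla u_L(t)\|_{L^2}^2=O(t^{-\Gamma-1})\qquad\text{as }t\to+\infty.$$
   Context: $L^2_\sigma(\mathbb{R}^3)$: $\mathbb{R}^3$-valued $L^2$ fields that are divergence free in the sense of distributions. Linear micropolar system on $\mathbb{R}^3$, $t>0$: $$\partial_t u_L=(\mu+\chi)\Delta u_L+2\chi\operatorname{curl} w_L,\quad \partial_t w_L=\gamma\Delta w_L+\kappa\nabla(\operatorname{div} w_L)+2\chi\operatorname{curl}u_L-4\chi w_L,\quad \operatorname{div}u_L=0,$$ with $(u_L,w_L)|_{t=0}=(u_0,w_0)$; its solution is the unique $L^2$ solution obtained by solving the corresponding linear ODE system in Fourier variables. *)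

(* Defs.v *)
From mathcomp Require Import all_boot all_order all_algebra.
From mathcomp Require Import all_classical all_reals all_analysis.
From mathcomp Require Import complex.
Set Implicit Arguments.
Unset Strict Implicit.
Unset Printing Implicit Defensive.
Import Order.TTheory GRing.Theory Num.Theory.
Import numFieldNormedType.Exports.
Import ComplexField.Normc.
Local Open Scope classical_set_scope.
Local Open Scope ring_scope.
Local Open Scope complex_scope.

(* Points of R^3 live in R * R * R, where the library provides the topology,
   the Borel sigma-algebra and the product Lebesgue measure; vectors (values of
   fields, wave numbers) are row vectors. *)
Notation R3 R := (R * R * R)%type (only parsing).

Definition leb3 (R : realType) :=
  ((@lebesgue_measure R \x @lebesgue_measure R) \x @lebesgue_measure R)%E.

Definition coords (R : realType) (x : R3 R) : 'rV[R]_3 :=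
  \row_i nth 0 [:: x.1.1; x.1.2; x.2] i.

(* f(t) = O(g(t)) as t -> +oo; the Landau notation of the library needs a
   bundled filter, which +oo does not have. *)
Definition bigO_pinfty (R : realType) (f g : R -> R) : Prop :=
  exists C : R, \forall t \near +oo, `|f t| <= C * `|g t|.

Definition dot (K : pzRingType) (a b : 'rV[K]_3) : K :=
  \sum_i a 0 i * b 0 i.

(* Index arithmetic in 'I_3 is modulo 3. *)
Definition cross (K : pzRingType) (a b : 'rV[K]_3) : 'rV[K]_3 :=
  \row_(i < 3) (a 0 (i + 1) * b 0 (i + 2) - a 0 (i + 2) * b 0 (i + 1)).

Section PhysicalSpace.
Variable R : realType.
Local Notation R3 := (R3 R).
Local Notation leb3 := (@leb3 R).

(* A matrix-valued field covers both vector fields (m = 1, n = 3) and their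
   gradients (m = n = 3). *)
Definition L2field m n (f : R3 -> 'M[R]_(m, n)) : Prop :=
  forall i j, (fun x => f x i j) \in Lfun leb3 2%:E.

Definition L2normsq m n (f : R3 -> 'M[R]_(m, n)) : R :=
  \int[leb3]_x (\sum_i \sum_j f x i j ^+ 2).

Definition basis3 (i : 'I_3) : R3 :=
  ((i == 0)%:R, (i == 1)%:R, (i == 2)%:R).

Definition partial (i : 'I_3) (phi : R3 -> R) : R3 -> R :=
  fun x => 'D_(basis3 i) phi x.

(* C^infinity: all iterated partial derivatives are differentiable. *)
Definition smooth (phi : R3 -> R) : Prop :=
  forall (s : seq 'I_3) (x : R3), differentiable (foldr partial phi s) x.

Definition test_function (phi : R3 -> R) : Prop :=
  smooth phi /\ compact (closure [set x | phi x != 0]).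

Definition weak_div_free (u : R3 -> 'rV[R]_3) : Prop :=
  forall phi, test_function phi ->
    \int[leb3]_x (\sum_j u x 0 j * partial j phi x) = 0.

Definition L2sigma (u : R3 -> 'rV[R]_3) : Prop :=
  L2field u /\ weak_div_free u.

(* g x i j is the distributional derivative of the i-th component of u in the
   j-th direction. *)
Definition weak_gradient (u : R3 -> 'rV[R]_3) (g : R3 -> 'M[R]_3) : Prop :=
  forall (i j : 'I_3) phi, test_function phi ->
    \int[leb3]_x (u x 0 i * partial j phi x) =
    - \int[leb3]_x (g x i j * phi x).

End PhysicalSpace.

Section Fourier.
Variable R : realType.
Local Notation R3 := (R3 R).
Local Notation leb3 := (@leb3 R).

(* Fourier integral of f over the ball of radius n, for the convention
   fhat(xi) = \int e^{- i x . xi} f(x) dx. *)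
Definition fourier_ball (f : R3 -> R) (n : nat) (xi : R3) : R[i] :=
  let B := [set x : R3 | dot (coords x) (coords x) <= n%:R ^+ 2] in
  (\int[leb3]_(x in B) (f x * cos (dot (coords x) (coords xi))))
  -i* (\int[leb3]_(x in B) (f x * sin (dot (coords x) (coords xi)))).

Definition L2complex (F : R3 -> R[i]) : Prop :=
  (fun xi => complex.Re (F xi)) \in Lfun leb3 2%:E /\
  (fun xi => complex.Im (F xi)) \in Lfun leb3 2%:E.

(* Plancherel's transform on L^2: the L^2 limit of the Fourier integrals of the
   truncations of f, which are in L^1. *)
Definition fourierL2 (f : R3 -> R) (F : R3 -> R[i]) : Prop :=
  [/\ f \in Lfun leb3 2%:E, L2complex F &
      ('N[leb3]_2%:E[(fun xi => (normc (fourier_ball f n xi - F xi))%:E)]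
         @[n --> \oo] --> 0)%E].

Definition fourierL2_field (u : R3 -> 'rV[R]_3) (U : R3 -> 'rV[R[i]]_3) : Prop :=
  forall i, fourierL2 (fun x => u x 0 i) (fun xi => U xi 0 i).

(* Fourier symbols of the differential operators: d/dx_j becomes i xi_j. *)
Definition symb (xi : R3) : 'rV[R[i]]_3 :=
  'i *: map_mx (real_complex R) (coords xi).

Definition fgrad (xi : R3) (p : R[i]) : 'rV[R[i]]_3 := p *: symb xi.
Definition fdiv (xi : R3) (V : 'rV[R[i]]_3) : R[i] := dot (symb xi) V.
Definition fcurl (xi : R3) (V : 'rV[R[i]]_3) : 'rV[R[i]]_3 :=
  cross (symb xi) V.
Definition flaplacian (xi : R3) (V : 'rV[R[i]]_3) : 'rV[R[i]]_3 :=
  dot (symb xi) (symb xi) *: V.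

Definition has_derivative (f : R -> 'rV[R[i]]_3) (t : R) (v : 'rV[R[i]]_3) :
    Prop :=
  forall i,
    is_derive t 1 (fun s => complex.Re (f s 0 i)) (complex.Re (v 0 i)) /\
    is_derive t 1 (fun s => complex.Im (f s 0 i)) (complex.Im (v 0 i)).

Definition right_continuous0 (f : R -> 'rV[R[i]]_3) : Prop :=
  forall i,
    complex.Re (f s 0 i) @[s --> 0^'+] --> complex.Re (f 0 0 i) /\
    complex.Im (f s 0 i) @[s --> 0^'+] --> complex.Im (f 0 0 i).

(* The linear micropolar system at the frequency xi, on t > 0, with initial
   values U 0 and W 0. *)
Definition micropolar_ode (mu chi gamma kappa : R) (xi : R3)
    (U W : R -> 'rV[R[i]]_3) : Prop :=
  [/\ right_continuous0 U, right_continuous0 W &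
      forall t : R, 0 < t ->
      [/\ has_derivative U t
            ((mu + chi)%:C *: flaplacian xi (U t)
             + (2 * chi)%:C *: fcurl xi (W t)),
          has_derivative W t
            (gamma%:C *: flaplacian xi (W t)
             + kappa%:C *: fgrad xi (fdiv xi (W t))
             + (2 * chi)%:C *: fcurl xi (U t)
             - (4 * chi)%:C *: W t)
        & fdiv xi (U t) = 0]].

(* The Fourier transforms of u t and w t have representatives U t and W t such
   that, for almost every frequency, U and W solve the ODE system for all
   times, with the Fourier transforms of u0 and w0 as initial values. *)
Definition micropolar_solution (mu chi gamma kappa : R)
    (u0 w0 : R3 -> 'rV[R]_3) (u w : R -> R3 -> 'rV[R]_3) : Prop :=
  exists U W : R -> R3 -> 'rV[R[i]]_3,
    [/\ fourierL2_field u0 (U 0) /\ fourierL2_field w0 (W 0),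
        forall t, 0 <= t ->
          fourierL2_field (u t) (U t) /\ fourierL2_field (w t) (W t) &
        {ae leb3, forall xi,
          micropolar_ode mu chi gamma kappa xi
            (fun t => U t xi) (fun t => W t xi)}].

End Fourier.

(* Main.v *)
(** At a frequency xi the system is, for (Re U, Im W) and for (Im U, - Re W), a
    real linear system X' = - A X with A symmetric and, since
    4 chi (mu + chi) > (2 chi)^2, <A X, X> >= c (|xi|^2 |U|^2 + |W|^2) with
    c > 0 independent of xi. Hence both |X|^2 and <A X, X> are nonincreasing,
    and
      c t (|xi|^2 |U(t)|^2 + |W(t)|^2) <= |U(t/2)|^2 + |W(t/2)|^2.
    Integrating in xi, Plancherel gives
      c t (|grad u(t)|^2 + |w(t)|^2) <= |u(t/2)|^2 + |w(t/2)|^2,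
    so each use of this inequality improves the decay of w by a factor t^{-1},
    up to the rate of u; a last use gives t^{- Gamma - 1}.

    Plancherel's identity is only needed up to a constant factor. It is checked
    on indicators of boxes, where the one-dimensional identity follows from the
    scaling of the integral of (1 - cos x) / x^2, and extended by density. The
    weak gradient is the L^2 limit of the difference quotients, which Plancherel
    turns into multipliers converging to i xi_j. *)

(* The obstacle is that [fourierL2] gives a transform only as an L^2 limit of integrals over
   centered balls, a family that translations do not preserve, whereas the difference quotients need
   the transforms of translated functions. Hence the detour through step functions on boxes, which
   have explicit transforms and are stable under sums and translations. The constant of Plancherel's
   identity, (2 pi)^3 for this convention, stays the unevaluated [planch]: it multiplies both sides
   of each energy inequality and cancels.

   The system is real in (Re U, Im W) because the symbol i xi x of the curl exchanges real and
   imaginary parts; the two coupling terms then have opposite signs, and since xi x is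
   antisymmetric, A is symmetric.

   The gradient has to be constructed, not only estimated: the integrability of |xi|^2 |U(t)|^2 is
   itself a consequence of the inequality at almost every frequency.

   The induction on decay starts from exponent 0, the boundedness of the energy, and caps the
   exponents at Gamma, which covers non-integer Gamma. *)
From HB Require Import structures.
Require Import Defs.
From mathcomp Require Import all_boot all_order all_algebra.
From mathcomp Require Import all_classical all_reals all_analysis.
From mathcomp Require Import measurable_realfun complex ring lra.
Set Implicit Arguments.
Unset Strict Implicit.
Unset Printing Implicit Defensive.
Import Order.TTheory GRing.Theory Num.Theory.
Import numFieldNormedType.Exports.
Import ComplexField.Normc.
Local Open Scope classical_set_scope.
Local Open Scope ring_scope.
Local Open Scope complex_scope.

(** * Integrals and square-integrable functions *)

Section HasIntegral.
Context d (T : measurableType d) (R : realType) (mu : {measure set T -> \bar R}).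
Implicit Types (f g : T -> R) (r s : R).

(** Integrability and value travel together: [Rintegral] is a total function, so an equation on
    values alone would say little about a function that is not integrable. *)
Definition has_int f r :=
  mu.-integrable setT (EFin \o f) /\ \int[mu]_x f x = r.

Lemma eq_has_int f g r : f =1 g -> has_int f r -> has_int g r.
Proof. by move=> /funext ->. Qed.

Lemma has_int_meas f r : has_int f r -> measurable_fun setT f.
Proof. by case=> /integrableP[/measurable_EFinP]. Qed.

Lemma has_int_Rintegral f :
  mu.-integrable setT (EFin \o f) -> has_int f (\int[mu]_x f x).
Proof. by []. Qed.

Lemma has_intE f r : has_int f r -> (\int[mu]_x (f x)%:E = r%:E)%E.
Proof.
by case=> fi <-; rewrite /Rintegral fineK//; exact: integrable_fin_num.
Qed.

Lemma has_int0 : has_int (fun=> 0) 0.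
Proof.
split; first exact: integrable0.
by rewrite /Rintegral integral0.
Qed.

Lemma has_intD f g r s :
  has_int f r -> has_int g s -> has_int (fun x => f x + g x) (r + s).
Proof.
move=> [fi fr] [gi gs]; split.
  exact: (integrableD measurableT fi gi).
by rewrite RintegralD// fr gs.
Qed.

Lemma has_intZ c f r : has_int f r -> has_int (fun x => c * f x) (c * r).
Proof.
move=> [fi fr]; split.
  exact: (integrableZl measurableT c fi).
by rewrite RintegralZl// fr.
Qed.

Lemma has_intB f g r s :
  has_int f r -> has_int g s -> has_int (fun x => f x - g x) (r - s).
Proof.
move=> fr gs; have := has_intD fr (has_intZ (- 1) gs).
by rewrite mulN1r; apply: eq_has_int => x; rewrite mulN1r.
Qed.

Lemma has_int_sum (I : Type) (l : seq I) (F : I -> T -> R) (v : I -> R) :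
  (forall i, has_int (F i) (v i)) ->
  has_int (fun x => \sum_(i <- l) F i x) (\sum_(i <- l) v i).
Proof.
move=> Fv; elim: l => [|i l ih].
  by rewrite big_nil; apply: eq_has_int has_int0 => x; rewrite big_nil.
rewrite big_cons; apply: eq_has_int (has_intD (Fv i) ih) => x.
by rewrite big_cons.
Qed.

(** Measurability of [g] is a hypothesis because equality almost everywhere does not transfer it
    when the measure is not complete. *)
Lemma has_int_ae f g r : measurable_fun setT g ->
  {ae mu, forall x, f x = g x} -> has_int f r -> has_int g r.
Proof.
move=> mg fg [fi fr].
have mf : measurable_fun setT (EFin \o f) by case/integrableP: fi.
have mg' : measurable_fun setT (EFin \o g) by exact/measurable_EFinP.
split.
  apply/integrableP; split => //.
  rewrite (@ae_eq_integral _ _ _ mu setT (abse \o (EFin \o f)))//.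
  - by case/integrableP: fi.
  - exact: measurableT_comp.
  - exact: measurableT_comp.
  - by apply: filterS fg => x /= -> _.
rewrite -fr /Rintegral; congr fine; apply: ae_eq_integral => //.
by apply: filterS fg => x /= -> _.
Qed.

Lemma has_int_unique f r s : has_int f r -> has_int f s -> r = s.
Proof. by move=> [_ <-] [_ <-]. Qed.

Lemma has_int_le f g r s : (forall x, f x <= g x) ->
  has_int f r -> has_int g s -> r <= s.
Proof. by move=> fg [fi <-] [gi <-]; exact: le_Rintegral. Qed.

Lemma integrable_dom f g : measurable_fun setT f ->
  (forall x, `|f x| <= g x) -> mu.-integrable setT (EFin \o g) ->
  mu.-integrable setT (EFin \o f).
Proof.
move=> mf fg; apply: le_integrable => //; first exact/measurable_EFinP.
by move=> x _ /=; rewrite lee_fin (le_trans (fg x))// ler_norm.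
Qed.

Definition has_cint (F : T -> R[i]) (z : R[i]) :=
  has_int (fun x => complex.Re (F x)) (complex.Re z) /\
  has_int (fun x => complex.Im (F x)) (complex.Im z).

Lemma eq_has_cint F G z : F =1 G -> has_cint F z -> has_cint G z.
Proof. by move=> /funext ->. Qed.

End HasIntegral.

Section Tensor.
Context d1 d2 (T1 : measurableType d1) (T2 : measurableType d2) (R : realType).
Variable m1 : {sigma_finite_measure set T1 -> \bar R}.
Variable m2 : {sigma_finite_measure set T2 -> \bar R}.

(** Tonelli on the absolute values factors the double integral and yields integrability; Fubini then
    factors the value. *)
Lemma has_int_tensor (f : T1 -> R) (g : T2 -> R) r s :
  has_int m1 f r -> has_int m2 g s ->
  has_int (m1 \x m2)%E (fun z => f z.1 * g z.2) (r * s).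
Proof.
move=> fr gs; have [fi _] := fr; have [gi _] := gs.
have mf := has_int_meas fr; have mg := has_int_meas gs.
have mh : measurable_fun setT (fun z : T1 * T2 => f z.1 * g z.2).
  apply: measurable_funM.
    exact: (measurableT_comp mf measurable_fst).
  exact: (measurableT_comp mg measurable_snd).
have mh' := (measurable_EFinP _ _).2 mh.
have hi : (m1 \x m2)%E.-integrable setT
    (EFin \o (fun z : T1 * T2 => f z.1 * g z.2)).
  apply/integrable12ltyP => //=.
  have -> : (\int[m1]_x \int[m2]_y (`|f x * g y|%:E))%E =
      (\int[m1]_x (`|f x|%:E * \int[m2]_y (`|g y|%:E)))%E.
    apply: eq_integral => x _; rewrite -ge0_integralZl_EFin//.
      by apply: eq_integral => y _; rewrite normrM EFinM.
    by apply/measurable_EFinP; exact: measurableT_comp.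
  have /integrableP[_ fy] := fi; have /integrableP[_ gy] := gi.
  rewrite ge0_integralZr//.
  - by rewrite lte_mul_pinfty//; [exact: integral_ge0 | rewrite ge0_fin_numE//; exact: integral_ge0].
  - by apply/measurable_EFinP; exact: measurableT_comp.
  - exact: integral_ge0.
split=> //.
rewrite /Rintegral -integral12_prod_meas1//= /fubini_F/=.
have -> : (\int[m1]_x \int[m2]_y (f x * g y)%:E)%E =
    (\int[m1]_x (s%:E * (f x)%:E))%E.
  apply: eq_integral => x _; rewrite -(has_intE gs) muleC -integralZl//.
rewrite integralZl// (has_intE fr) -EFinM /= mulrC//.
Qed.

Lemma has_cint_tensor (F : T1 -> R[i]) (G : T2 -> R[i]) z w :
  has_cint m1 F z -> has_cint m2 G w ->
  has_cint (m1 \x m2)%E (fun t => F t.1 * G t.2) (z * w).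
Proof.
move=> [Fr Fi] [Gr Gi]; split.
  case: z Fr Fi => a b; case: w Gr Gi => c e /= Gr Gi Fr Fi.
  apply: eq_has_int (has_intB (has_int_tensor Fr Gr) (has_int_tensor Fi Gi)).
  by move=> x /=; case: (F _) => ? ?; case: (G _).
case: z Fr Fi => a b; case: w Gr Gi => c e /= Gr Gi Fr Fi.
apply: eq_has_int (has_intD (has_int_tensor Fr Gi) (has_int_tensor Fi Gr)).
by move=> x /=; case: (F _) => ? ?; case: (G _).
Qed.

End Tensor.

(** * The square of the L^2 norm: Young's inequality, limit theorems, completeness *)

Section SquareNorm.
Context d (T : measurableType d) (R : realType) (mu : {measure set T -> \bar R}).
Implicit Types (f g : T -> R).
Local Notation L2 := (Lfun mu 2%:E).

Definition sqn f : R := \int[mu]_x (f x ^+ 2).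

Lemma Lfun_meas f : f \in L2 -> measurable_fun setT f.
Proof. by move=> /sub_Lfun_mfun; rewrite inE. Qed.

Lemma Lfun2_sqr f : f \in L2 -> has_int mu (fun x => f x ^+ 2) (sqn f).
Proof. by move=> fL; split => //; exact: Lfun2_integrable_sqr. Qed.

Lemma Lfun2I f : measurable_fun setT f ->
  (\int[mu]_x (f x ^+ 2)%:E < +oo)%E -> f \in L2.
Proof.
move=> mf fy; rewrite inE; apply/andP; split; rewrite inE//=.
rewrite /finite_norm unlock; apply: poweR_lty.
apply: le_lt_trans fy; rewrite le_eqVlt; apply/orP; left; apply/eqP.
by apply: eq_integral => x _ /=; rewrite powR_mulrn// real_normK// num_real.
Qed.

Lemma Lfun2_has_int f r : measurable_fun setT f ->
  has_int mu (fun x => f x ^+ 2) r -> f \in L2.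
Proof. by move=> mf /has_intE fr; apply: Lfun2I => //; rewrite fr ltry. Qed.

Lemma Lfun2_dom f g : measurable_fun setT f ->
  (forall x, f x ^+ 2 <= g x) -> mu.-integrable setT (EFin \o g) -> f \in L2.
Proof.
move=> mf fg gi; apply: (@Lfun2_has_int _ (sqn f)) => //; split => //.
apply: integrable_dom gi; first exact: measurable_funX.
by move=> x; rewrite ger0_norm ?sqr_ge0.
Qed.

Lemma Lfun2D f g : f \in L2 -> g \in L2 -> (fun x => f x + g x) \in L2.
Proof.
move=> fL gL; apply: (@Lfun2_dom _ (fun x => 2 * f x ^+ 2 + 2 * g x ^+ 2)).
- exact: measurable_funD (Lfun_meas fL) (Lfun_meas gL).
- by move=> x; rewrite -subr_ge0; have := sqr_ge0 (f x - g x); lra.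
- by have [] := has_intD (has_intZ 2 (Lfun2_sqr fL)) (has_intZ 2 (Lfun2_sqr gL)).
Qed.

Lemma Lfun2Z c f : f \in L2 -> (fun x => c * f x) \in L2.
Proof.
move=> fL; apply: (@Lfun2_dom _ (fun x => c ^+ 2 * f x ^+ 2)).
- exact/measurable_funM/Lfun_meas.
- by move=> x; rewrite exprMn.
- by have [] := has_intZ (c ^+ 2) (Lfun2_sqr fL).
Qed.

Lemma Lfun2B f g : f \in L2 -> g \in L2 -> (fun x => f x - g x) \in L2.
Proof.
move=> fL /(Lfun2Z (- 1)) gL; have := Lfun2D fL gL.
by under eq_fun do rewrite mulN1r.
Qed.

Lemma Lfun2_mul f g : f \in L2 -> g \in L2 ->
  mu.-integrable setT (EFin \o (fun x => f x * g x)).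
Proof. by move=> fL gL; apply/Lfun1_integrable; exact: Lfun2_mul_Lfun1. Qed.

Lemma sqn_ge0 f : 0 <= sqn f.
Proof. by apply: Rintegral_ge0 => x _; exact: sqr_ge0. Qed.

Lemma sqnZ c f : f \in L2 -> sqn (fun x => c * f x) = c ^+ 2 * sqn f.
Proof.
move=> /Lfun2_sqr/(has_intZ (c ^+ 2))[_ <-].
by apply: eq_Rintegral => x _; rewrite exprMn.
Qed.

Lemma sqn_sym f g : sqn (fun x => f x - g x) = sqn (fun x => g x - f x).
Proof. by apply: eq_Rintegral => x _; rewrite -sqrrN opprB. Qed.

Lemma sqn_mono f g : f \in L2 -> g \in L2 ->
  (forall x, f x ^+ 2 <= g x ^+ 2) -> sqn f <= sqn g.
Proof.
by move=> /Lfun2_sqr fL /Lfun2_sqr gL fg; exact: has_int_le fg fL gL.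
Qed.

(** Replaces the triangle inequality without square roots. The factor [1 + e] tends to 1, so that
    adding a much smaller [g] costs nothing in the limit and sharp constants survive. *)
Lemma sqn_young e f g : 0 < e -> f \in L2 -> g \in L2 ->
  sqn (fun x => f x + g x) <= (1 + e) * sqn f + (1 + e^-1) * sqn g.
Proof.
move=> e0 fL gL.
apply: (has_int_le _ (Lfun2_sqr (Lfun2D fL gL)) (has_intD
  (has_intZ (1 + e) (Lfun2_sqr fL)) (has_intZ (1 + e^-1) (Lfun2_sqr gL)))).
move=> x; rewrite -subr_ge0.
have -> : (1 + e) * f x ^+ 2 + (1 + e^-1) * g x ^+ 2 - (f x + g x) ^+ 2 =
  e^-1 * (e * f x - g x) ^+ 2 by field; rewrite gt_eqF.
by rewrite mulr_ge0 ?sqr_ge0// invr_ge0 ltW.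
Qed.

Lemma sqnD2 f g : f \in L2 -> g \in L2 ->
  sqn (fun x => f x + g x) <= 2 * (sqn f + sqn g).
Proof.
move=> fL gL; have := sqn_young ltr01 fL gL.
by rewrite invr1 -mulrDr.
Qed.

Lemma sqn_dist f g h : f \in L2 -> g \in L2 -> h \in L2 ->
  sqn (fun x => f x - h x) <=
  2 * (sqn (fun x => f x - g x) + sqn (fun x => g x - h x)).
Proof.
move=> fL gL hL; have := sqnD2 (Lfun2B fL gL) (Lfun2B gL hL).
by under eq_fun do rewrite subrKA.
Qed.

(** Fatou's lemma for the squares. It yields both that the limit is in L^2 and the bound, and so
    upgrades pointwise limits to L^2 statements. *)
Lemma sqn_fatou (f_ : (T -> R)^nat) f M : (forall n, f_ n \in L2) ->
  measurable_fun setT f -> {ae mu, forall x, f_ n x @[n --> \oo] --> f x} ->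
  (forall n, sqn (f_ n) <= M) -> f \in L2 /\ sqn f <= M.
Proof.
move=> fL mf ff fM.
have mf2 n : measurable_fun setT (fun x => (f_ n x ^+ 2)%:E).
  by apply/measurable_EFinP/measurable_funX; exact: Lfun_meas.
have mg : measurable_fun setT (fun x => (f x ^+ 2)%:E).
  by apply/measurable_EFinP/measurable_funX.
have le : (\int[mu]_x (f x ^+ 2)%:E <= M%:E)%E.
  have := @fatou _ _ _ mu setT measurableT (fun n x => (f_ n x ^+ 2)%:E) mf2
    (fun n x _ => sqr_ge0 (f_ n x)).
  rewrite (_ : limn_einf _ = limn_einf (fun n => (sqn (f_ n))%:E)); last first.
    by congr limn_einf; apply/funext => n; rewrite (has_intE (Lfun2_sqr (fL n))).
  rewrite -(@ae_eq_integral _ _ _ mu setT _ (fun x => (f x ^+ 2)%:E))//.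
  - move=> /le_trans; apply; rewrite limn_einf_lim; apply: lime_le.
      exact: is_cvg_einfs.
    apply: nearW => n; apply: (@le_trans _ _ (sqn (f_ n))%:E).
      by apply: ereal_inf_lbound; exists n => /=.
    by rewrite lee_fin.
  - apply: measurableT_comp => //; apply: measurable_fun_limn_esup => n.
    exact: measurableT_comp.
  - apply: filterS ff => x fx _; apply/esym.
    have : (f_ n x ^+ 2)%:E @[n --> \oo] --> (f x ^+ 2)%:E.
      apply: cvg_EFin; first exact: nearW.
      by rewrite expr2; under eq_fun do rewrite /= expr2; exact: (cvgM fx fx).
    by move=> /cvg_limn_einf_sup[].
have fL2 : f \in L2 by apply: Lfun2I => //; apply: le_lt_trans le _; rewrite ltry.
by split => //; rewrite -lee_fin -(has_intE (Lfun2_sqr fL2)).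
Qed.

Lemma sqn_dominated (f_ : (T -> R)^nat) g :
  (forall n, measurable_fun setT (f_ n)) ->
  (forall x, f_ n x @[n --> \oo] --> 0) ->
  (forall n x, f_ n x ^+ 2 <= g x) -> mu.-integrable setT (EFin \o g) ->
  forall e, 0 < e -> exists N, forall n, (N <= n)%N -> sqn (f_ n) < e.
Proof.
move=> mf f0 fg gi e e0.
have fL n : f_ n \in L2 by exact: Lfun2_dom (mf n) (fg n) gi.
have : (\int[mu]_x (f_ n x ^+ 2)%:E)%E @[n --> \oo] --> (\int[mu]_x 0)%E.
  apply: (@dominated_cvg _ _ _ mu setT measurableT
    (fun n x => (f_ n x ^+ 2)%:E) (fun=> 0%E) (EFin \o g)) => //.
  - by move=> n; apply/measurable_EFinP; exact: measurable_funX.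
  - move=> x _; apply: cvg_EFin; first exact: nearW.
    rewrite -[X in _ --> X](mulr0 (0 : R)).
    by under eq_fun do rewrite /= expr2; exact: (cvgM (f0 x) (f0 x)).
  - by move=> n x _; rewrite /= lee_fin ger0_norm ?sqr_ge0.
rewrite integral0 => /fine_cvgP[_ /(@cvgr_lt _ _ _ _) /(_ e e0)[N _ Ne]].
by exists N => n /Ne.
Qed.

(** Riesz-Fischer. Along a subsequence the increments D_k have square norm at most 16^-k, so the sum
    of 4^k D_k^2 has a finite integral and is finite almost everywhere. There |D_k| is at most a
    constant times 2^-k and the subsequence converges; Fatou's lemma bounds the distance to the
    limit. *)
Lemma Lfun2_complete (f_ : (T -> R)^nat) : (forall n, f_ n \in L2) ->
  (forall e, 0 < e -> exists N, forall m n, (N <= m)%N -> (N <= n)%N ->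
     sqn (fun x => f_ m x - f_ n x) < e) ->
  exists2 f, f \in L2 & forall e, 0 < e ->
    exists N, forall n, (N <= n)%N -> sqn (fun x => f x - f_ n x) <= e.
Proof.
move=> fL fC.
have q0 k : 0 < 16%:R ^- k :> R by rewrite invr_gt0 exprn_gt0.
have /choice[N NP] : forall k, exists N, forall m n, (N <= m)%N -> (N <= n)%N ->
  sqn (fun x => f_ m x - f_ n x) < 16%:R ^- k by move=> k; exact: fC.
(* A sum in place of a maximum: [M k] dominates both [k] and [N k], and [M k.+1] dominates [N k]. *)
pose M k := (k + \sum_(i < k.+1) N i)%N.
have MN k : (N k <= M k)%N.
  by rewrite /M big_ord_recr/= addnA leq_addl.
have MNS k : (N k <= M k.+1)%N.
  by rewrite /M big_ord_recr/= (leq_trans (MN k))// /M leq_add// leq_addr.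
have Mk k : (k <= M k)%N by rewrite /M leq_addr.
pose g k := f_ (M k).
pose D k x := g k.+1 x - g k x.
have DL k : D k \in L2 by exact: (Lfun2B (fL _) (fL _)).
have Dq k : sqn (D k) <= 16%:R ^- k by rewrite ltW// NP.
pose H x := (\sum_(0 <= k <oo) (4 ^+ k * D k x ^+ 2)%:E)%E.
have mD k : measurable_fun setT (fun x => (4 ^+ k * D k x ^+ 2)%:E).
  apply/measurable_EFinP/measurable_funM => //.
  exact/measurable_funX/Lfun_meas.
have D0 k x : (0 <= (4 ^+ k * D k x ^+ 2)%:E)%E.
  by rewrite lee_fin mulr_ge0 ?sqr_ge0// exprn_ge0.
have HI : (\int[mu]_x H x <= 2%:E)%E.
  rewrite integral_nneseries//; apply: lime_le.
    by apply: is_cvg_nneseries => n _ _; exact: integral_ge0.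
  apply: nearW => n.
  (* Strengthened for the induction: the n-th term is at most 4^-n, while the right-hand side grows
     by (3/2) 4^-n. *)
  suff : (\sum_(0 <= k < n) \int[mu]_x (4 ^+ k * D k x ^+ 2)%:E <=
      (2 - 2 * 4^-1 ^+ n)%:E)%E.
    by move=> /le_trans; apply; rewrite lee_fin gerBl mulr_ge0 ?exprn_ge0.
  elim: n => [|n ih]; first by rewrite big_nil lee_fin expr0; lra.
  rewrite big_nat_recr//=; apply: (le_trans (leeD ih (lexx _))).
  rewrite (has_intE (has_intZ (4 ^+ n) (Lfun2_sqr (DL n)))) -EFinD lee_fin.
  have : 4 ^+ n * sqn (D n) <= 4^-1 ^+ n.
    rewrite (le_trans (ler_wpM2l _ (Dq n)))// ?exprn_ge0//.
    rewrite -exprVn -exprMn le_eqVlt; apply/orP; left; apply/eqP.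
    by congr (_ ^+ _); lra.
  have : 0 <= 4^-1 ^+ n :> R by rewrite exprn_ge0.
  rewrite exprS; lra.
have H0 x : (0 <= H x)%E by apply: nneseries_ge0.
have mH : measurable_fun setT H.
  by apply: ge0_emeasurable_sum => // k x _ _; exact: D0.
have Hfin : {ae mu, forall x, H x \is a fin_num}.
  have Hint : mu.-integrable setT H.
    apply/integrableP; split => //.
    under eq_integral do rewrite gee0_abs//.
    by apply: le_lt_trans HI _; rewrite ltry.
  by apply: filterS (integrable_ae measurableT Hint) => x; apply.
(* The upper limit is measurable without any knowledge of convergence, and it is the limit wherever
   there is one. *)
pose f x := fine (limn_esup (fun k => (g k x)%:E)).
have mf : measurable_fun setT f.
  apply: (@measurableT_comp _ _ _ _ _ _ fine).
    exact: fine_measurable.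
  by apply: measurable_fun_limn_esup => n; apply/measurable_EFinP; exact: (Lfun_meas (fL _)).
have gf : {ae mu, forall x, g k x @[k --> \oo] --> f x}.
  apply: filterS Hfin => x Hx.
  pose h := fine (H x).
  have h0 : 0 <= h by rewrite fine_ge0.
  (* From 4^k D_k^2 <= h; the inequality h <= (1 + h)^2 avoids a square root. *)
  have Dh k : `|D k x| <= (1 + h) * 2^-1 ^+ k.
    have : 4 ^+ k * D k x ^+ 2 <= h.
      rewrite -lee_fin fineK//; apply: (le_trans _ (nneseries_lim_ge k.+1 _)) => //.
      by rewrite big_nat_recr//= leeDr// sume_ge0.
    have e0 : 0 <= (1 + h) * 2^-1 ^+ k by rewrite mulr_ge0 ?exprn_ge0 ?addr_ge0.
    move=> h4; rewrite -ler_sqr ?nnegrE// real_normK ?num_real// exprMn -exprM.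
    have p4 : 0 < 4 ^+ k :> R by rewrite exprn_gt0.
    rewrite mulnC exprM (_ : 2^-1 ^+ 2 = 4^-1); last by lra.
    rewrite exprVn ler_pdivlMr// [X in X <= _]mulrC (le_trans h4)//.
    by rewrite expr2; nra.
  have cg : cvgn (fun k => g k x).
    have : cvgn (series (fun k => D k x)).
      apply: normed_cvg; apply: (@series_le_cvg _ _ (geometric (1 + h) 2^-1)).
      - by move=> n /=.
      - by move=> n /=; rewrite mulr_ge0 ?exprn_ge0 ?addr_ge0.
      - by move=> n /=; exact: Dh.
      - by apply: is_cvg_geometric_series; rewrite ger0_norm//; lra.
    have -> : series (fun k => D k x) = [sequence g n x - g 0 x]_n.
      exact: (telescopeK (fun n => g n x)).
    move=> /cvg_ex[l /= gl]; apply/cvg_ex; exists (l + g 0 x).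
    have : (g n x - g 0 x) + g 0 x @[n --> \oo] --> l + g 0 x.
      by apply: cvgD; [exact: gl | exact: cvg_cst].
    by under eq_fun do rewrite subrK.
  move: cg => /cvg_ex[l gl]; suff -> : f x = l by [].
  rewrite /f; have : (g k x)%:E @[k --> \oo] --> l%:E.
    by apply: cvg_EFin => //; exact: nearW.
  by move=> /cvg_limn_einf_sup[_ ->].
have key e (e0 : 0 < e) : exists N, forall n, (N <= n)%N ->
    (fun x => f x - f_ n x) \in L2 /\ sqn (fun x => f x - f_ n x) <= e.
  have [K KP] := fC _ e0; exists K => n Kn.
  apply: (@sqn_fatou (fun k x => g (k + K)%N x - f_ n x)).
  - by move=> k; exact: (Lfun2B (fL _) (fL _)).
  - exact: measurable_funB mf (Lfun_meas (fL n)).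
  - apply: filterS gf => x gx; apply: cvgB; last exact: cvg_cst.
    have := cvg_shiftn K (fun k => g k x) (nbhs (f x)).
    by move=> /= ->.
  - by move=> k; rewrite ltW// KP// (leq_trans _ (Mk _))// leq_addl.
exists f.
  have [K /(_ K (leqnn K))[KL _]] := key _ ltr01.
  have := Lfun2D KL (fL K).
  by under eq_fun do rewrite subrK.
by move=> e e0; have [K KP] := key _ e0; exists K => n /KP[].
Qed.

End SquareNorm.

(** * Fourier transforms of intervals *)

Section ChangeOfVariables.
Context d (T : measurableType d) (R : realType) (mu : {measure set T -> \bar R}).
Variables (phi : T -> T) (mphi : measurable_fun setT phi).
Variables (c : R) (c0 : 0 < c).
Hypothesis phiE : forall A, measurable A -> (mu A = c%:E * mu (phi @^-1` A))%E.

(** By [phiE], the measure is [c] times its own image under [phi]. *)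
Lemma ge0_integral_comp (f : T -> R) : measurable_fun setT f ->
  (forall x, 0 <= f x) ->
  (\int[mu]_x (f x)%:E = c%:E * \int[mu]_x (f (phi x))%:E)%E.
Proof.
move=> mf f0.
have mf' : measurable_fun setT (EFin \o f) by exact/measurable_EFinP.
have f0' : {in setT, forall y : T, (0 <= (EFin \o f) y)%E}.
  by move=> x _ /=; rewrite lee_fin.
have := ge0_integral_pushforward mphi mu measurableT mf' f0'.
rewrite preimage_setT => /= <-.
rewrite -(ge0_integral_mscale _ measurableT (NngNum (ltW c0)))//; last first.
  by move=> x _; rewrite lee_fin.
by apply: eq_measure_integral => A mA _; exact: phiE.
Qed.

(** The nonnegative case is applied to the positive and negative parts, written [max (s * f) 0] with
    s = 1 and s = -1. *)
Lemma has_int_comp (f : T -> R) r :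
  has_int mu f r -> has_int mu (fun x => f (phi x)) (c^-1 * r).
Proof.
move=> fr; have mf := has_int_meas fr.
have mfphi : measurable_fun setT (fun x => f (phi x)) by exact: measurableT_comp.
have cn : c != 0 by rewrite gt_eqF.
have ge0 (g : T -> R) s : measurable_fun setT g -> (forall x, 0 <= g x) ->
    has_int mu g s -> has_int mu (fun x => g (phi x)) (c^-1 * s).
  move=> mg g0 /has_intE; rewrite ge0_integral_comp// => gE.
  have gE' : (\int[mu]_x (g (phi x))%:E = (c^-1 * s)%:E)%E.
    rewrite EFinM -gE muleA -EFinM mulVf// mul1e//.
  split; last by rewrite /Rintegral gE'.
  apply/integrableP; split.
    by apply/measurable_EFinP; exact: measurableT_comp.
  under eq_integral do rewrite /= ger0_norm//.
  by rewrite gE' ltry.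
have [fi _] := fr.
have pos (s : R) : exists t, has_int mu (fun x => Num.max (s * f x) 0) t.
  have [si _] := has_intZ s fr.
  have mm : measurable_fun setT (fun x => Num.max (s * f x) 0).
    apply: measurable_maxr; last exact: measurable_cst.
    exact: measurable_funM.
  exists (\int[mu]_x Num.max (s * f x) 0); apply: has_int_Rintegral.
  apply: (@integrable_dom _ _ _ _ _ (fun x => `|s * f x|)) => //.
    move=> x; have [h|h] := leP (s * f x) 0; last by [].
    by rewrite normr0.
  exact: (integrable_norm si).
have [p pP] := pos 1; have [q qP] := pos (- 1).
have E g : has_int mu (fun x => f (g x)) = has_int mu
    (fun x => Num.max (1 * f (g x)) 0 - Num.max (- 1 * f (g x)) 0).
  congr (has_int mu _); apply/funext => x; rewrite mul1r mulN1r.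
  by have [] := leP (f (g x)) 0; have [] := leP (- f (g x)) 0; lra.
have mm (s : R) : measurable_fun setT (fun x => Num.max (s * f x) 0).
  apply: measurable_maxr; last exact: measurable_cst.
  exact: measurable_funM.
have nn (s : R) x : 0 <= Num.max (s * f x) 0 by rewrite le_max lexx orbT.
have rE : r = p - q.
  by have := has_intB pP qP; rewrite -(E id) => /(has_int_unique fr).
rewrite E rE mulrBr.
exact: (has_intB (ge0 _ _ (mm 1) (nn 1) pP) (ge0 _ _ (mm (- 1)) (nn _) qP)).
Qed.

End ChangeOfVariables.

Section RealLine.
Context (R : realType).
Local Notation lam := (@lebesgue_measure R).
Implicit Types (I J : R * R).

Lemma measurable_affine (a b : R) : measurable_fun setT (fun x : R => a * x + b).
Proof. by apply: measurable_funD => //; exact: measurable_funM. Qed.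

(** Both sides are measures in [A]; by uniqueness of the Lebesgue measure they need only be compared
    on intervals []u, v]]. *)
Lemma lebesgue_measure_affine (a b : R) : 0 < a ->
  forall A, measurable A -> (lam A = a%:E * lam ((fun x => a * x + b)%R @^-1` A))%E.
Proof.
move=> a0.
pose phi : measurableTypeR R -> measurableTypeR R := fun x => a * x + b.
have mphi : measurable_fun setT phi by exact: measurable_affine.
pose phi_mixin := isMeasurableFun.Build _ _ _ _ _ mphi.
pose phi_pack : {mfun _ >-> _} := HB.pack phi phi_mixin.
apply: (@lebesgue_measure_unique _
  (mscale (NngNum (ltW a0)) (pushforward lam phi_pack))) => _ [[u v] _ <-].
change (lam `]u, v] = a%:E * lam (phi @^-1` `]u, v]))%E.
have -> : phi @^-1` `]u, v] = `](u - b) / a, (v - b) / a]%classic.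
  apply/seteqP; split => x /=; rewrite !in_itv/= /phi => /andP[h1 h2];
    apply/andP; split.
  - by rewrite ltr_pdivrMr//; lra.
  - by rewrite ler_pdivlMr//; lra.
  - by move: h1; rewrite ltr_pdivrMr//; lra.
  - by move: h2; rewrite ler_pdivlMr//; lra.
rewrite !lebesgue_measure_itv/= !lte_fin ltr_pM2r ?invr_gt0// ltrD2r.
case: ifPn => _; last by rewrite mule0.
by rewrite -!EFinD -EFinM; congr EFin; field; rewrite gt_eqF.
Qed.

Lemma has_int_affine (a b : R) f r : 0 < a ->
  has_int lam f r -> has_int lam (fun x => f (a * x + b)) (a^-1 * r).
Proof.
move=> a0; apply: has_int_comp => //; first exact: measurable_affine.
exact: lebesgue_measure_affine.
Qed.

Lemma has_int_opp f r :
  has_int lam f r -> has_int lam (fun x => f (- x)) r.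
Proof.
move=> fr; rewrite -[r]mul1r -[1]invr1.
apply: (has_int_comp (phi := (-%R : measurableTypeR R -> measurableTypeR R))) => // A mA.
by rewrite mul1e -[LHS]lebesgue_measureN.
Qed.

Lemma has_int_odd f : lam.-integrable setT (EFin \o f) ->
  (forall x, f (- x) = - f x) -> has_int lam f 0.
Proof.
move=> /has_int_Rintegral fr fo; have := has_int_opp fr.
under eq_fun do rewrite fo.
have := has_intZ (- 1) fr; under eq_fun do rewrite mulN1r.
move=> h /(has_int_unique h) h'.
have h0 : \int[lam]_x f x = 0 by lra.
by move: fr; rewrite h0.
Qed.

(** The formula 1/x = x (1/|x|)^2, also valid at 0 where all inverses are 0, reduces the claim to
    the measurability of real powers. *)
Lemma measurable_invr : measurable_fun setT (fun x : R => x^-1).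
Proof.
have -> : (fun x : R => x^-1) = (fun x => x * (`|x| `^ (- 1)) ^+ 2).
  apply/funext => x; rewrite powR_inv1//.
  have [->|x0] := eqVneq x 0; first by rewrite invr0 mul0r.
  by rewrite exprVn real_normK ?num_real//; field.
apply: measurable_funM => //; apply: measurable_funX.
exact: (measurableT_comp (measurable_powR (- 1)) (@normr_measurable R setT)).
Qed.

Lemma measurable_sin_comp d (T : measurableType d) (f : T -> R) :
  measurable_fun setT f -> measurable_fun setT (fun x => sin (f x)).
Proof.
apply: measurableT_comp; apply: continuous_measurable_fun.
exact: continuous_sin.
Qed.

Lemma measurable_cos_comp d (T : measurableType d) (f : T -> R) :
  measurable_fun setT f -> measurable_fun setT (fun x => cos (f x)).
Proof.
apply: measurableT_comp; apply: continuous_measurable_fun.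
exact: continuous_cos.
Qed.

Lemma norm_sin_le (x : R) : `|sin x| <= `|x|.
Proof.
wlog x0 : x / 0 < x => [H|].
  have [x0|x0|->] := ltgtP x 0; last by rewrite sin0.
    by rewrite -normrN -sinN -[in X in _ <= X]normrN; apply: H; lra.
  exact: H.
have [|y _] := @MVT R sin cos 0 x x0 (fun z _ => is_derive_sin z).
  by apply: continuous_subspaceT => z; exact: continuous_sin.
rewrite sin0 !subr0 => ->; rewrite normrM ler_piMl//.
by rewrite ler_norml cos_geN1 cos_le1.
Qed.

Lemma onem_cos_le (x : R) : 1 - cos x <= x ^+ 2 / 2.
Proof.
have -> : cos x = 1 - 2 * sin (x / 2) ^+ 2.
  have e : x = (x / 2) *+ 2 by lra.
  by rewrite [in LHS]e cos_mulr2n; have := cos2Dsin2 (x / 2); lra.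
have := norm_sin_le (x / 2); rewrite -ler_sqr ?nnegrE// !real_normK ?num_real//.
lra.
Qed.

(** A Fejér kernel up to normalization, of integral pi over the line. At 0 it has the default value
    0 and not its limit 1/2, a change on a null set. *)
Definition fejer (x : R) : R := (1 - cos x) / x ^+ 2.

Definition fejer_int : R := \int[lam]_x fejer x.

Lemma fejer_ge0 x : 0 <= fejer x.
Proof. by rewrite /fejer divr_ge0 ?sqr_ge0// subr_ge0 cos_le1. Qed.

Lemma measurable_fejer : measurable_fun setT fejer.
Proof.
apply: measurable_funM.
  by apply: measurable_funB => //; exact: measurable_cos_comp.
by apply: (measurableT_comp measurable_invr); exact: measurable_funX.
Qed.

(** The bounds 1 - cos x <= x^2 / 2 near 0 and 1 - cos x <= 2 far away combine into (1 - cos x) (1 +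
    x^2) <= 4 x^2, which gives an integrable majorant. *)
Lemma has_int_fejer : has_int lam fejer fejer_int.
Proof.
apply: has_int_Rintegral.
apply: (@integrable_dom _ _ R lam fejer (fun x : R => 4 * (oneDsqr x)^-1)).
- exact: measurable_fejer.
- move=> x; rewrite ger0_norm ?fejer_ge0// /fejer.
  have o0 : 0 < oneDsqr x by rewrite /oneDsqr; have := sqr_ge0 x; lra.
  have [->|x0] := eqVneq x 0.
    by rewrite expr0n/= invr0 mulr0 mulr_ge0// invr_ge0 ltW.
  have x2 : 0 < x ^+ 2 by rewrite exprn_even_gt0.
  rewrite ler_pdivrMr// mulrAC ler_pdivlMr// /oneDsqr.
  have := onem_cos_le x; have := cos_geN1 x; have := cos_le1 x.
  set c := cos x; set y := x ^+ 2 in x2 *; nra.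
suff fi : lam.-integrable setT (EFin \o (fun x : R => (oneDsqr x)^-1)).
  exact: (integrableZl measurableT 4 fi).
apply/integrableP; split.
  apply/measurable_EFinP.
  apply: (@continuous_measurable_fun R (fun x => (oneDsqr x)^-1)).
  exact: continuous_oneDsqrV.
rewrite (_ : (\int[lam]_x _)%E = (\int[lam]_x ((oneDsqr x)^-1)%:E)%E); last first.
  by apply: eq_integral => y _ /=; rewrite ger0_norm// invr_ge0.
rewrite ge0_symfun_integralT.
- rewrite (_ : [set x | _] = `[0%R, +oo[%classic); last first.
    by apply/seteqP; split => x /=; rewrite in_itv/= andbT.
  by rewrite integral0y_oneDsqr -EFinM ltry.
- by move=> x; rewrite invr_ge0 /oneDsqr; have := sqr_ge0 x; lra.
- exact: continuous_oneDsqrV.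
- by move=> x; rewrite /= /oneDsqr sqrrN.
Qed.

Definition ind I (x : R) : R := (I.1 < x <= I.2)%R%:R.

Lemma indE I : ind I = \1_`]I.1, I.2]%classic.
Proof.
by apply/funext => x; rewrite /ind indicE mem_setE in_itv.
Qed.

Lemma measurable_ind I : measurable_fun setT (ind I).
Proof. by rewrite indE; exact: measurable_indic. Qed.

Lemma has_int_ind I : I.1 <= I.2 -> has_int lam (ind I) (I.2 - I.1).
Proof.
move=> le12.
have E : (\int[lam]_x (ind I x)%:E = (I.2 - I.1)%:E)%E.
  rewrite indE integral_indic// setIT.
  transitivity (lam `]I.1, I.2]%classic) => //.
  rewrite lebesgue_measure_itv/= lte_fin.
  case: ltP => // h; congr EFin; apply/esym/eqP.
  by rewrite subr_eq0 eq_le le12 h.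
split; last by rewrite /Rintegral E.
apply/integrableP; split.
  by apply/measurable_EFinP; exact: measurable_ind.
under eq_integral do rewrite /= ger0_norm ?ler0n//.
by rewrite E ltry.
Qed.

(* Only the finiteness and the positivity of the integral of the Fejer kernel
   matter: it is, up to a factor, the constant in Plancherel's identity. *)
Lemma fejer_int_gt0 : 0 < fejer_int.
Proof.
have p0 := pi_gt0 R.
have h := has_intZ (pi ^- 2) (@has_int_ind (pi / 2, pi) ltac:(rewrite /=; lra)).
apply: (@lt_le_trans _ _ (pi ^- 2 * (pi - pi / 2))).
  by rewrite mulr_gt0 ?invr_gt0 ?exprn_gt0//; lra.
apply: has_int_le h has_int_fejer => x; rewrite /ind/=.
have [/andP[x1 x2]|_] := boolP (pi / 2 < x <= pi); last first.
  by rewrite mulr0 fejer_ge0.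
rewrite mulr1 /fejer.
have x0 : 0 < x by lra.
have c0 : cos x <= 0.
  have := @sin_ge0_pi R (x - pi / 2); rewrite sinBpihalf => h'.
  by rewrite -oppr_ge0; apply: h'; apply/andP; split; lra.
rewrite -[X in X <= _]mul1r; apply: ler_pM => //; last 2 first.
- lra.
- by rewrite lef_pV2 ?posrE ?exprn_gt0// ler_sqr ?nnegrE//; lra.
- by rewrite invr_ge0 exprn_ge0// ltW.
Qed.

(** The integrand is z^2 times the kernel at |z| x, and the dilation takes back one factor |z|. This
    is how cosines of differences of endpoints turn into distances between endpoints. *)
Lemma has_int_fejer_scale (z : R) :
  has_int lam (fun x => (1 - cos (z * x)) / x ^+ 2) (`|z| * fejer_int).
Proof.
have [->|z0] := eqVneq z 0.
  rewrite normr0 mul0r; apply: (eq_has_int _ (has_int0 lam)) => x.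
  by rewrite mul0r cos0 subrr mul0r.
have nz : 0 < `|z| by rewrite normr_gt0.
have := has_intZ (`|z| ^+ 2) (has_int_affine 0 nz has_int_fejer).
have -> : `|z| ^+ 2 * (`|z|^-1 * fejer_int) = `|z| * fejer_int.
  by field; rewrite gt_eqF.
move=> h; apply: (eq_has_int _ h) => x; rewrite addr0 /fejer.
have -> : cos (`|z| * x) = cos (z * x).
  have [zp|zn] := leP 0 z; first by rewrite ger0_norm.
  by rewrite ltr0_norm// mulNr cosN.
have [->|x0] := eqVneq x 0; first by rewrite !mulr0 !expr0n/= !invr0 !mulr0.
by rewrite exprMn; field; rewrite x0 gt_eqF.
Qed.

Definition cis (t : R) : R[i] := cos t +i* sin t.

Lemma cisD s t : cis (s + t) = cis s * cis t.
Proof.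
rewrite /cis cosD sinD; apply/eqP; rewrite eq_complex /=.
by apply/andP; split; apply/eqP; ring.
Qed.

Definition normsqc (z : R[i]) : R := complex.Re z ^+ 2 + complex.Im z ^+ 2.

Lemma normsqcM z w : normsqc (z * w) = normsqc z * normsqc w.
Proof. by case: z w => a b [c e]; rewrite /normsqc /=; ring. Qed.

Lemma normsqc_cis t : normsqc (cis t) = 1.
Proof. by rewrite /normsqc /= cos2Dsin2. Qed.

(* The Fourier transform of the indicator of the interval ]I.1, I.2]; at 0,
   where the quotients vanish, only the first term remains. *)
Definition ind_hat I (x : R) : R[i] :=
  ((x == 0)%R%:R * (I.2 - I.1) + (sin (I.2 * x) - sin (I.1 * x)) / x)
  +i* ((cos (I.2 * x) - cos (I.1 * x)) / x).

Lemma measurable_ind_hat_Re I :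
  measurable_fun setT (fun x => complex.Re (ind_hat I x)).
Proof.
rewrite /=; apply: measurable_funD.
  apply: measurable_funM => //.
  rewrite (_ : (fun x => _) = \1_[set (0 : R)]); first exact: measurable_indic.
  by apply/funext => x; rewrite indicE; congr (nat_of_bool _)%:R; apply/eqP/idP => [->|]; rewrite inE.
apply: measurable_funM; last exact: measurable_invr.
by apply: measurable_funB; apply: measurable_sin_comp; exact: measurable_funM.
Qed.

Lemma measurable_ind_hat_Im I :
  measurable_fun setT (fun x => complex.Im (ind_hat I x)).
Proof.
rewrite /=; apply: measurable_funM; last exact: measurable_invr.
by apply: measurable_funB; apply: measurable_cos_comp; exact: measurable_funM.
Qed.

Lemma ind_hat_opp I x : ind_hat I (- x) = conjc (ind_hat I x).
Proof.
rewrite /ind_hat oppr_eq0 !mulrN !sinN !cosN invrN /=.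
by apply/eqP; rewrite eq_complex /=; apply/andP; split; apply/eqP; ring.
Qed.

Lemma ind_hat_shift I v x :
  ind_hat (I.1 - v, I.2 - v) x = cis (v * x) * ind_hat I x.
Proof.
rewrite /ind_hat /cis; apply/eqP; rewrite eq_complex /=.
have [->|x0] := eqVneq x 0.
  rewrite !mulr0 !sin0 !cos0 invr0 !mulr0.
  by apply/andP; split; apply/eqP; ring.
rewrite !mulrBl !sinB !cosB ?mulr0n !mul0r !add0r.
by apply/andP; split; apply/eqP; ring.
Qed.

Definition overlap I J : R :=
  Num.max 0 (Num.min I.2 J.2 - Num.max I.1 J.1).

Lemma ae_neq0 (P : R -> Prop) :
  (forall x, x != 0 -> P x) -> {ae lam, forall x, P x}.
Proof.
move=> H; exists [set 0]; split => //; first exact: lebesgue_measure_set1.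
move=> x /= nP; apply: contrapT => /eqP x0; apply: nP; exact: H.
Qed.

Lemma Re_mulJ (z w : R[i]) : complex.Re (z * conjc w) =
  complex.Re z * complex.Re w + complex.Im z * complex.Im w.
Proof. by case: z w => a b [c e] /=; ring. Qed.

Lemma Im_mulJ (z w : R[i]) : complex.Im (z * conjc w) =
  complex.Im z * complex.Re w - complex.Re z * complex.Im w.
Proof. by case: z w => a b [c e] /=; ring. Qed.

Lemma measurable_ind_hat_Re_mulJ I J :
  measurable_fun setT (fun x => complex.Re (ind_hat I x * conjc (ind_hat J x))).
Proof.
under eq_fun do rewrite Re_mulJ.
by apply: measurable_funD; apply: measurable_funM;
  (exact: measurable_ind_hat_Re || exact: measurable_ind_hat_Im).
Qed.

Lemma measurable_ind_hat_Im_mulJ I J :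
  measurable_fun setT (fun x => complex.Im (ind_hat I x * conjc (ind_hat J x))).
Proof.
under eq_fun do rewrite Im_mulJ.
by apply: measurable_funB; apply: measurable_funM;
  (exact: measurable_ind_hat_Re || exact: measurable_ind_hat_Im).
Qed.

(** For I = (a, b) and J = (c, e), the addition formulas turn x^2 times the integrand into a signed
    sum of four terms 1 - cos(z x), with z = b - c, a - e (sign +) and z = b - e, a - c (sign -).
    The same signed sum of the |z| is twice the length of the intersection, whatever the position of
    the intervals. *)
Lemma has_int_ind_hat_Re I J : I.1 <= I.2 -> J.1 <= J.2 ->
  has_int lam (fun x => complex.Re (ind_hat I x * conjc (ind_hat J x)))
    (2 * fejer_int * overlap I J).
Proof.
case: I J => a b [c e] /= ab ce.
have K z := has_int_fejer_scale z.
have := has_intB (has_intB (has_intD (K (b - c)) (K (a - e))) (K (b - e))) (K (a - c)).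
have -> : `|b - c| * fejer_int + `|a - e| * fejer_int - `|b - e| * fejer_int
    - `|a - c| * fejer_int = 2 * fejer_int * overlap (a, b) (c, e).
  rewrite -mulrDl -!mulrBl [RHS]mulrAC; congr (_ * _); rewrite /overlap /=.
  have [bc|cb] := leP b c.
    have ac := le_trans ab bc; have be := le_trans bc ce; have ae := le_trans ab be.
    by rewrite !ler0_norm ?subr_le0// (min_l be) (max_r ac) max_l ?subr_le0//; ring.
  have [ea|ae] := leP e a.
    have eb := le_trans ea ab; have ca := le_trans ce ea.
    rewrite !ger0_norm ?subr_ge0// ?(ltW cb)// (min_r eb) (max_l ca) max_l ?subr_le0//.
    by ring.
  rewrite (gtr0_norm (x := b - c)) ?subr_gt0// (ltr0_norm (x := a - e)) ?subr_lt0//.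
  have [be|/ltW eb] := leP b e; have [ac|/ltW ca] := leP a c;
    rewrite max_r ?subr_ge0 ?(ltW cb) ?(ltW ae)//.
  - by rewrite !ler0_norm ?subr_le0//; ring.
  - by rewrite ler0_norm ?subr_le0// ger0_norm ?subr_ge0//; ring.
  - by rewrite ger0_norm ?subr_ge0// ler0_norm ?subr_le0//; ring.
  - by rewrite !ger0_norm ?subr_ge0//; ring.
apply: has_int_ae; first exact: (measurable_ind_hat_Re_mulJ (a, b) (c, e)).
apply: ae_neq0 => x x0; rewrite ?Re_mulJ /ind_hat /= (negbTE x0) mul0r.
rewrite !mul0r !add0r !mulrBl !cosB.
by field.
Qed.

Lemma has_int_ind_hat_sqr I : I.1 <= I.2 ->
  has_int lam (fun x => normsqc (ind_hat I x)) (2 * fejer_int * overlap I I).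
Proof.
move=> le12; apply: (eq_has_int _ (has_int_ind_hat_Re le12 le12)) => x.
by rewrite Re_mulJ /normsqc !expr2.
Qed.

(** The imaginary part is odd, since [ind_hat] at -x is the conjugate of its value at x. It has to
    be controlled because the real part of a product of three one-dimensional factors also involves
    their imaginary parts. *)
Lemma has_cint_ind_hat I J : I.1 <= I.2 -> J.1 <= J.2 ->
  has_cint lam (fun x => ind_hat I x * conjc (ind_hat J x))
    (2 * fejer_int * overlap I J)%:C.
Proof.
move=> leI leJ; split; first exact: has_int_ind_hat_Re.
apply: has_int_odd.
  have [fi _] := has_intD (has_int_ind_hat_sqr leI) (has_int_ind_hat_sqr leJ).
  apply: integrable_dom fi.
    exact: measurable_ind_hat_Im_mulJ.
  move=> x; rewrite Im_mulJ /normsqc.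
  case: (ind_hat I x) => a b; case: (ind_hat J x) => c e /=.
  rewrite ler_norml; apply/andP; split.
    have := sqr_ge0 (b + c); have := sqr_ge0 (a - e).
    have := sqr_ge0 a; have := sqr_ge0 b; have := sqr_ge0 c; have := sqr_ge0 e.
    nra.
  have := sqr_ge0 (b - c); have := sqr_ge0 (a + e).
  have := sqr_ge0 a; have := sqr_ge0 b; have := sqr_ge0 c; have := sqr_ge0 e.
  nra.
by move=> x; rewrite !ind_hat_opp !Im_mulJ; case: (ind_hat I x) => a b;
  case: (ind_hat J x) => c e /=; ring.
Qed.

(** The outer maximum in the second endpoint keeps the endpoints ordered when the intervals are
    disjoint; the result is then empty. *)
Definition cap I J : R * R :=
  (Num.max I.1 J.1, Num.max (Num.max I.1 J.1) (Num.min I.2 J.2)).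

Lemma cap_le I J : (cap I J).1 <= (cap I J).2.
Proof. by rewrite /cap /= le_max lexx. Qed.

Lemma ind_cap I J x : ind (cap I J) x = ind I x * ind J x.
Proof.
rewrite /ind /cap /= -natrM mulnb; congr (nat_of_bool _)%:R.
rewrite gt_max le_max le_min.
case: (ltP I.1 x) => //= h1; case: (ltP J.1 x) => //= h2; rewrite ?andbF ?andbT//.
by rewrite (_ : (x <= Num.max I.1 J.1) = false)// le_max !leNgt h1 h2.
Qed.

Lemma has_int_ind_mul I J :
  has_int lam (fun x => ind I x * ind J x) (overlap I J).
Proof.
have := has_int_ind (cap_le I J).
have -> : (cap I J).2 - (cap I J).1 = overlap I J.
  rewrite /cap /overlap /=; set m := Num.max I.1 J.1; set M := Num.min _ _.
  by have [] := leP m M; have [] := leP 0 (M - m); lra.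
by move=> h; apply: (eq_has_int _ h) => x; exact: ind_cap.
Qed.

Lemma is_derive_scaled (g dg : R -> R) (x y : R) :
  (forall t : R, is_derive t 1 g (dg t)) -> x != 0 ->
  is_derive y 1 (fun y : R => g (y * x) / x) (dg (y * x)).
Proof.
move=> dgP x0.
have h1 : is_derive y 1 (fun y : R => y * x) x.
  apply/is_derive1_caratheodory; exists (fun=> x); split => //.
    by move=> z; ring.
  exact: cst_continuous.
have /is_derive1_caratheodory[G [GE cG Gy]] := 
  @is_derive1_comp R g (fun y : R => y * x) y _ _ (dgP (y * x)) h1.
apply/is_derive1_caratheodory; exists (fun z => G z / x); split.
- by move=> z; rewrite -mulrBl mulrAC -GE.
- by apply: cvgM; [exact: cG | exact: cvg_cst].
- by rewrite Gy mulfK.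
Qed.

(** Ties the closed formula [ind_hat] to the Fourier integral. For x nonzero this is the fundamental
    theorem of calculus with antiderivatives sin(y x) / x and cos(y x) / x; at 0 only the length
    remains. *)
Lemma has_cint_ind I x : I.1 <= I.2 ->
  has_cint lam (fun y => (ind I y)%:C * cis (- (y * x))) (ind_hat I x).
Proof.
case: I => a b /= ab.
have rea y : complex.Re ((ind (a, b) y)%:C * cis (- (y * x))) =
    ind (a, b) y * cos (y * x) by rewrite /= sinN cosN; ring.
have ima y : complex.Im ((ind (a, b) y)%:C * cis (- (y * x))) =
    - 1 * (ind (a, b) y * sin (y * x)) by rewrite /= sinN cosN; ring.
have FTC (f F : R -> R) : continuous f ->
    (forall y : R, is_derive y 1 F (f y)) ->
    has_int lam (fun y => ind (a, b) y * f y) (F b - F a).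
  move=> cf dF.
  have E : has_int lam (fun y => ind (a, b) y * f y)
      (\int[lam]_(y in `]a, b]) f y).
    rewrite (_ : (fun y => _) = f \_ `]a, b]%classic); last first.
      apply/funext => y; rewrite indE patchE indicE.
      by case: ifPn => _; rewrite ?mul1r ?mul0r.
    rewrite Rintegral_mkcond; apply: has_int_Rintegral.
    have fi : lam.-integrable `]a, b] (EFin \o f).
      apply: (@integrableS _ _ _ lam `[a, b]%classic) => //.
        by apply: subset_itvr; rewrite bnd_simp.
      apply: continuous_compact_integrable; first exact: segment_compact.
      exact: continuous_subspaceT.
    have := (@integrable_mkcond _ _ _ lam `]a, b]%classic
      (EFin \o f) (measurable_itv _)).1 fi.
    by apply: eq_integrable => // y _; rewrite /= !patchE; case: ifP.
  suff <- : \int[lam]_(y in `]a, b]) f y = F b - F a by [].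
  move: ab; rewrite le_eqVlt => /orP[/eqP ->|ab].
    by rewrite set_itvoc0// Rintegral_set0 subrr.
  rewrite Rintegral_itv_obnd_cbnd; last first.
    apply: (@integrableS _ _ _ lam `[a, b]%classic) => //.
      by apply: subset_itvr; rewrite bnd_simp.
    apply: continuous_compact_integrable; first exact: segment_compact.
    exact: continuous_subspaceT.
  rewrite /Rintegral (@continuous_FTC2 _ f F a b ab)//.
  - exact: continuous_subspaceT.
  - have cF : continuous F.
      move=> y; apply: differentiable_continuous; apply/derivable1_diffP.
      by have [] := dF y.
    split => //.
    + by apply: cvg_at_right_filter; exact: cF.
    + by apply: cvg_at_left_filter; exact: cF.
  - by move=> y _; rewrite derive1E; have [_ ->] := dF y.
have ccos : continuous (fun y : R => cos (y * x)).
  move=> y; apply: (@cvg_comp _ _ _ (fun y : R => y * x) cos _ (nbhs (y * x)));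
    last exact: continuous_cos.
  by apply: cvgM; [exact: cvg_id | exact: cvg_cst].
have csin : continuous (fun y : R => sin (y * x)).
  move=> y; apply: (@cvg_comp _ _ _ (fun y : R => y * x) sin _ (nbhs (y * x)));
    last exact: continuous_sin.
  by apply: cvgM; [exact: cvg_id | exact: cvg_cst].
split.
  have [x0|x0] := eqVneq x 0.
    have := @has_int_ind (a, b) ab; rewrite /ind_hat/= x0 eqxx mul1r.
    rewrite !mulr0 sin0 subrr mul0r addr0.
    by apply: eq_has_int => y; rewrite mulr0 oppr0 sin0 cos0; ring.
  have := FTC _ _ ccos (fun y => is_derive_scaled y (fun t => is_derive_sin t) x0).
  rewrite /ind_hat/= (negbTE x0) mul0r add0r mulrBl.
  by apply: eq_has_int => y; rewrite -rea.
have [x0|x0] := eqVneq x 0.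
  rewrite /ind_hat/= x0 invr0 mulr0.
  apply: (eq_has_int _ (has_int0 lam)) => y.
  by rewrite mulr0 oppr0 sin0 mulr0 mul0r addr0.
have csin' : continuous (fun y : R => - sin (y * x)).
  by move=> y; apply: cvgN; exact: csin.
have := FTC _ _ csin' (fun y => is_derive_scaled y (fun t => is_derive_cos t) x0).
rewrite /ind_hat/= mulrBl; apply: eq_has_int => y.
by rewrite sinN; ring.
Qed.

End RealLine.

(** * Step functions on boxes *)

Section Generation.
Context d1 d2 (T1 : measurableType d1) (T2 : measurableType d2).
Variables (C1 : set (set T1)) (C2 : set (set T2)).
Hypothesis g1 : forall A : set T1, measurable A -> <<s C1 >> A.
Hypothesis g2 : forall A : set T2, measurable A -> <<s C2 >> A.
Variables (E1 : (set T1)^nat) (E2 : (set T2)^nat).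
Hypotheses (CE1 : forall n, C1 (E1 n)) (CE2 : forall n, C2 (E2 n)).
Hypotheses (E1T : \bigcup_n E1 n = setT) (E2T : \bigcup_n E2 n = setT).

(** A cylinder over a generator is a countable union of rectangles of generators, which is what the
    exhausting sequences [E1] and [E2] are for; a measurable rectangle is the intersection of two
    cylinders. *)
Lemma measurable_prod_generated (A : set (T1 * T2)) :
  measurable A -> <<s [set A `*` B | A in C1 & B in C2] >> A.
Proof.
rewrite measurable_prod_measurableType.
set G := [set _ `*` _ | _ in C1 & _ in C2].
have sG : sigma_algebra setT <<s G >> by exact: smallest_sigma_algebra.
have GT1 B : measurable B -> <<s G >> (B `*` setT).
  move=> /g1; move: B; apply: smallest_sub => [|B C1B].
    split=> [|B GB|F GF] /=.
    - by rewrite set0X; case: sG.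
    - have -> : (setT `\` B) `*` [set: T2] = setT `\` (B `*` setT).
        by apply/seteqP; split => -[x y] /=; tauto.
      by case: sG => _ + _; apply.
    - by rewrite setX_bigcupl; case: sG => _ _; apply.
  rewrite /= -E2T setX_bigcupr; case: sG => _ _; apply => n.
  by apply: sub_gen_smallest; exists B => //; exists (E2 n).
have GT2 B : measurable B -> <<s G >> (setT `*` B).
  move=> /g2; move: B; apply: smallest_sub => [|B C2B].
    split=> [|B GB|F GF] /=.
    - by rewrite setX0; case: sG.
    - have -> : [set: T1] `*` (setT `\` B) = setT `\` (setT `*` B).
        by apply/seteqP; split => -[x y] /=; tauto.
      by case: sG => _ + _; apply.
    - by rewrite setX_bigcupr; case: sG => _ _; apply.
  rewrite /= -E1T setX_bigcupl; case: sG => _ _; apply => n.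
  by apply: sub_gen_smallest; exists (E1 n) => //; exists B.
move: A; apply: smallest_sub => // _ [A mA [B mB <-]].
have -> : A `*` B = (A `*` setT) `&` (setT `*` B).
  by apply/seteqP; split => -[x y] /=; tauto.
rewrite -(setCK (_ `&` _)) setCI -!setTD -bigcup2E.
case: (sG) => s0 sC sU; apply: (sC); apply: sU => -[|[|n]] /=.
- by apply: sC; exact: GT1.
- by apply: sC; exact: GT2.
- exact: s0.
Qed.

End Generation.

Section ProductSigmaFinite.
Context d1 d2 (T1 : measurableType d1) (T2 : measurableType d2) (R : realType).
Variable m1 : {sigma_finite_measure set T1 -> \bar R}.
Variable m2 : {sigma_finite_measure set T2 -> \bar R}.

(* An alias for the product measure on which the sigma-finite structure can be
   inferred: the canonical one for \x expects subprobabilities. *)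
Definition prod_meas : set (T1 * T2) -> \bar R := (m1 \x m2)%E.

HB.instance Definition _ := Measure.on prod_meas.

Let prod_meas_sigma_finite : sigma_finite setT prod_meas.
Proof.
have /sigma_finiteP[F [TF ndF Foo]] := sigma_finiteT m1.
have /sigma_finiteP[G [TG ndG Goo]] := sigma_finiteT m2.
exists (fun n => F n `*` G n).
  rewrite -setXTT TF TG predeqE => -[x y]; split.
    move=> [/= [n _ Fnx] [k _ Gky]]; exists (maxn n k) => //; split.
    - by move: x Fnx; exact/subsetPset/ndF/leq_maxl.
    - by move: y Gky; exact/subsetPset/ndG/leq_maxr.
  by move=> [n _ []/= ? ?]; split; exists n.
move=> k; have [? ?] := Foo k; have [? ?] := Goo k.
split; first exact: measurableX.
rewrite /prod_meas product_measure1E// lte_mul_pinfty// ge0_fin_numE//.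
Qed.

HB.instance Definition _ := Measure_isSigmaFinite.Build _ _ _ prod_meas
  prod_meas_sigma_finite.

End ProductSigmaFinite.

Section Boxes.
Context (R : realType).
Local Notation lam := (@lebesgue_measure R).
Local Notation R3 := (R3 R).
(* The measurable structure carried by the domain of the Lebesgue measure. *)
Local Notation mR := (measurableTypeR R).
Local Notation mR3 := (mR * mR * mR)%type.
Local Notation leb3 := (@leb3 R).
Local Notation L2 := (Lfun leb3 2%:E).
Local Notation box := ((R * R) * (R * R) * (R * R))%type.
Local Notation step := (seq (R * box)).
Implicit Types (b Q : box) (s t : step) (x xi : R3).

(* Endpoints are reordered so that every pair denotes an interval ]a, b] with
   a <= b, possibly empty. *)
Definition bnd (I : R * R) : R * R := (I.1, Num.max I.1 I.2).

Lemma bnd_le I : (bnd I).1 <= (bnd I).2.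
Proof. by rewrite /bnd /= le_max lexx. Qed.

Lemma ind_bnd I y : ind (bnd I) y = ind I y.
Proof.
rewrite /ind /bnd /= le_max; congr (nat_of_bool _)%:R.
by case: (ltP I.1 y) => //= h; rewrite leNgt h.
Qed.

Definition box_ind b x : R :=
  ind (bnd b.1.1) x.1.1 * ind (bnd b.1.2) x.1.2 * ind (bnd b.2) x.2.

Definition box_hat b xi : R[i] :=
  ind_hat (bnd b.1.1) xi.1.1 * ind_hat (bnd b.1.2) xi.1.2
  * ind_hat (bnd b.2) xi.2.

Definition box_overlap b Q : R :=
  overlap (bnd b.1.1) (bnd Q.1.1) * overlap (bnd b.1.2) (bnd Q.1.2)
  * overlap (bnd b.2) (bnd Q.2).

(** The boxes may overlap, so that a sum of step functions is a concatenation of lists, without a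
    common refinement. *)
Definition step_fun s x : R := \sum_(p <- s) p.1 * box_ind p.2 x.
Definition step_hat s xi : R[i] := \sum_(p <- s) p.1%:C * box_hat p.2 xi.
Definition step_dot s t : R :=
  \sum_(p <- s) \sum_(q <- t) p.1 * (q.1 * box_overlap p.2 q.2).

(** The constant of Plancherel's identity, one factor per dimension; its value is (2 pi)^3. *)
Definition planch : R := (2 * @fejer_int R) ^+ 3.

Lemma planch_gt0 : 0 < planch.
Proof. by rewrite exprn_gt0// mulr_gt0// fejer_int_gt0. Qed.

Lemma has_cint_tensor3 (F1 F2 F3 : R -> R[i]) z1 z2 z3 :
  has_cint lam F1 z1 -> has_cint lam F2 z2 -> has_cint lam F3 z3 ->
  has_cint leb3 (fun x => F1 x.1.1 * F2 x.1.2 * F3 x.2) (z1 * z2 * z3).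
Proof.
move=> h1 h2 h3.
exact (@has_cint_tensor _ _ _ _ _ (prod_meas lam lam) lam _ _ _ _
  (has_cint_tensor h1 h2) h3).
Qed.

Lemma has_int_tensor3 (F1 F2 F3 : R -> R) z1 z2 z3 :
  has_int lam F1 z1 -> has_int lam F2 z2 -> has_int lam F3 z3 ->
  has_int leb3 (fun x => F1 x.1.1 * F2 x.1.2 * F3 x.2) (z1 * z2 * z3).
Proof.
move=> h1 h2 h3.
exact (@has_int_tensor _ _ _ _ _ (prod_meas lam lam) lam _ _ _ _
  (has_int_tensor h1 h2) h3).
Qed.

Lemma has_int_box_mul b Q :
  has_int leb3 (fun x => box_ind b x * box_ind Q x) (box_overlap b Q).
Proof.
apply: (eq_has_int _ (has_int_tensor3 (has_int_ind_mul _ _)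
  (has_int_ind_mul _ _) (has_int_ind_mul _ _))) => x.
by rewrite /box_ind; ring.
Qed.

Lemma has_int_box_hat b Q :
  has_int leb3 (fun x => complex.Re (box_hat b x * conjc (box_hat Q x)))
    (planch * box_overlap b Q).
Proof.
have H I J := has_cint_ind_hat (bnd_le I) (bnd_le J).
have [+ _] := has_cint_tensor3 (H b.1.1 Q.1.1) (H b.1.2 Q.1.2) (H b.2 Q.2).
have -> : complex.Re ((2 * fejer_int R * overlap (bnd b.1.1) (bnd Q.1.1))%:C *
    (2 * fejer_int R * overlap (bnd b.1.2) (bnd Q.1.2))%:C *
    (2 * fejer_int R * overlap (bnd b.2) (bnd Q.2))%:C) =
    planch * box_overlap b Q.
  by rewrite /= /planch /box_overlap; ring.
apply: eq_has_int => x; rewrite /box_hat.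
move: (ind_hat (bnd b.1.1) _) (ind_hat (bnd b.1.2) _) (ind_hat (bnd b.2) _) =>
  [a1 a2] [b1 b2] [c1 c2].
move: (ind_hat (bnd Q.1.1) _) (ind_hat (bnd Q.1.2) _) (ind_hat (bnd Q.2) _) =>
  [e1 e2] [f1 f2] [g1 g2].
by rewrite /=; ring.
Qed.

Lemma step_fun_cons p s x :
  step_fun (p :: s) x = p.1 * box_ind p.2 x + step_fun s x.
Proof. by rewrite /step_fun big_cons. Qed.

Lemma step_hat_cons p s x :
  step_hat (p :: s) x = p.1%:C * box_hat p.2 x + step_hat s x.
Proof. by rewrite /step_hat big_cons. Qed.

Lemma has_int_step s t :
  has_int leb3 (fun x => step_fun s x * step_fun t x) (step_dot s t).
Proof.
have H b u : has_int leb3 (fun x => box_ind b x * step_fun u x)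
    (\sum_(q <- u) q.1 * box_overlap b q.2).
  elim: u => [|q u ih].
    rewrite big_nil; apply: (eq_has_int _ (has_int0 leb3)) => x.
    by rewrite /step_fun big_nil mulr0.
  rewrite big_cons.
  apply: (eq_has_int _ (has_intD (has_intZ q.1 (has_int_box_mul b q.2)) ih)) => x.
  by rewrite step_fun_cons; ring.
rewrite /step_dot; elim: s => [|p s ih].
  rewrite big_nil; apply: (eq_has_int _ (has_int0 leb3)) => x.
  by rewrite /step_fun big_nil mul0r.
rewrite big_cons -mulr_sumr.
apply: (eq_has_int _ (has_intD (has_intZ p.1 (H p.2 t)) ih)) => x.
by rewrite step_fun_cons; ring.
Qed.

Lemma has_int_step_hat s t :
  has_int leb3 (fun x => complex.Re (step_hat s x * conjc (step_hat t x)))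
    (planch * step_dot s t).
Proof.
have H b u : has_int leb3
    (fun x => complex.Re (box_hat b x * conjc (step_hat u x)))
    (planch * \sum_(q <- u) q.1 * box_overlap b q.2).
  elim: u => [|q u ih].
    rewrite big_nil mulr0; apply: (eq_has_int _ (has_int0 leb3)) => x.
    by rewrite /step_hat big_nil; case: box_hat => ? ? /=; ring.
  rewrite big_cons mulrDr [planch * (_ * _)]mulrCA.
  apply: (eq_has_int _ (has_intD (has_intZ q.1 (has_int_box_hat b q.2)) ih)) => x.
  rewrite step_hat_cons; case: (box_hat b x) => ? ?.
  by case: (box_hat _ _) => ? ?; case: (step_hat _ _) => ? ? /=; ring.
rewrite /step_dot; elim: s => [|p s ih].
  rewrite big_nil mulr0; apply: (eq_has_int _ (has_int0 leb3)) => x.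
  by rewrite /step_hat big_nil mul0r.
rewrite big_cons mulrDr -mulr_sumr [planch * (_ * _)]mulrCA.
apply: (eq_has_int _ (has_intD (has_intZ p.1 (H p.2 t)) ih)) => x.
rewrite step_hat_cons; case: (step_hat t x) => ? ?.
by case: (box_hat _ _) => ? ?; case: (step_hat _ _) => ? ? /=; ring.
Qed.

Lemma measurable_fst3 : measurable_fun [set: mR3] (fun x : R3 => x.1.1).
Proof. exact: (measurableT_comp measurable_fst measurable_fst). Qed.

Lemma measurable_snd3 : measurable_fun [set: mR3] (fun x : R3 => x.1.2).
Proof. exact: (measurableT_comp measurable_snd measurable_fst). Qed.

Lemma measurable_box_ind b : measurable_fun [set: mR3] (box_ind b).
Proof.
by have /has_int_meas := has_int_tensor3 (has_int_ind (bnd_le b.1.1))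
  (has_int_ind (bnd_le b.1.2)) (has_int_ind (bnd_le b.2)).
Qed.

Lemma measurable_step_fun s : measurable_fun [set: mR3] (step_fun s).
Proof.
elim: s => [|p s ih].
  rewrite (_ : step_fun _ = fun=> 0); first exact: measurable_cst.
  by apply/funext => x; rewrite /step_fun big_nil.
rewrite (_ : step_fun _ = fun x => p.1 * box_ind p.2 x + step_fun s x).
  by apply: measurable_funD => //; apply: measurable_funM => //; exact: measurable_box_ind.
by apply/funext => x; rewrite step_fun_cons.
Qed.

Definition sqnc (F : R3 -> R[i]) : R :=
  sqn leb3 (fun x => complex.Re (F x)) + sqn leb3 (fun x => complex.Im (F x)).

Definition cmeas (F : R3 -> R[i]) :=
  measurable_fun [set: mR3] (fun x => complex.Re (F x)) /\
  measurable_fun [set: mR3] (fun x => complex.Im (F x)).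

Lemma cmeasM F G : cmeas F -> cmeas G -> cmeas (fun x => F x * G x).
Proof.
move=> [F1 F2] [G1 G2]; split.
  rewrite (_ : (fun x => _) = fun x => complex.Re (F x) * complex.Re (G x)
      - complex.Im (F x) * complex.Im (G x)).
    by apply: measurable_funB; exact: measurable_funM.
  by apply/funext => x; case: (F x) => ? ?; case: (G x).
rewrite (_ : (fun x => _) = fun x => complex.Re (F x) * complex.Im (G x)
    + complex.Im (F x) * complex.Re (G x)).
  by apply: measurable_funD; exact: measurable_funM.
by apply/funext => x; case: (F x) => ? ?; case: (G x) => ? ? /=; ring.
Qed.

Lemma cmeasD F G : cmeas F -> cmeas G -> cmeas (fun x => F x + G x).
Proof.
move=> [F1 F2] [G1 G2]; split.
  rewrite (_ : (fun x => _) = fun x => complex.Re (F x) + complex.Re (G x)).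
    exact: measurable_funD.
  by apply/funext => x; case: (F x) => ? ?; case: (G x).
rewrite (_ : (fun x => _) = fun x => complex.Im (F x) + complex.Im (G x)).
  exact: measurable_funD.
by apply/funext => x; case: (F x) => ? ?; case: (G x).
Qed.

Lemma cmeas_box_hat b : cmeas (box_hat b).
Proof.
apply: cmeasM; first apply: cmeasM.
- split; [exact: (measurableT_comp (measurable_ind_hat_Re _) measurable_fst3)|
    exact: (measurableT_comp (measurable_ind_hat_Im _) measurable_fst3)].
- split; [exact: (measurableT_comp (measurable_ind_hat_Re _) measurable_snd3)|
    exact: (measurableT_comp (measurable_ind_hat_Im _) measurable_snd3)].
- split; [exact: (measurableT_comp (measurable_ind_hat_Re _) measurable_snd)|
    exact: (measurableT_comp (measurable_ind_hat_Im _) measurable_snd)].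
Qed.

Lemma cmeas_cst z : cmeas (fun=> z).
Proof. by split; exact: measurable_cst. Qed.

Lemma cmeas_step_hat s : cmeas (step_hat s).
Proof.
elim: s => [|p s ih].
  rewrite (_ : step_hat _ = fun=> 0); first exact: cmeas_cst.
  by apply/funext => x; rewrite /step_hat big_nil.
rewrite (_ : step_hat _ = fun x => p.1%:C * box_hat p.2 x + step_hat s x).
  by apply: cmeasD => //; apply: cmeasM; [exact: cmeas_cst|exact: cmeas_box_hat].
by apply/funext => x; rewrite step_hat_cons.
Qed.

Lemma lt_quarters (a b c e : R) :
  a <= 2 * (b + c) -> b < e / 4 -> c < e / 4 -> a < e.
Proof. lra. Qed.

(* Copies of generic lemmas at [leb3], whose measure structure is slow to infer. *)
Lemma Lfun_meas3 f : f \in L2 -> measurable_fun [set: mR3] f.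
Proof. exact: (@Lfun_meas _ _ _ leb3 f). Qed.

Lemma Lfun2_sqr3 f : f \in L2 -> has_int leb3 (fun x => f x ^+ 2) (sqn leb3 f).
Proof. exact: (@Lfun2_sqr _ _ _ leb3 f). Qed.

Lemma Lfun2B3 f g : f \in L2 -> g \in L2 -> (fun x => f x - g x) \in L2.
Proof. exact: (@Lfun2B _ _ _ leb3 f g). Qed.

Lemma Lfun2_mul3 f g : f \in L2 -> g \in L2 ->
  has_int leb3 (fun x => f x * g x) (\int[leb3]_x (f x * g x)).
Proof.
by move=> fL gL; apply: (@has_int_Rintegral _ _ _ leb3); exact: (@Lfun2_mul _ _ _ leb3).
Qed.

Lemma sqnZ3 c f : f \in L2 -> sqn leb3 (fun x => c * f x) = c ^+ 2 * sqn leb3 f.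
Proof. exact: (@sqnZ _ _ _ leb3 c f). Qed.

Lemma sqnD23 f g : f \in L2 -> g \in L2 ->
  sqn leb3 (fun x => f x + g x) <= 2 * (sqn leb3 f + sqn leb3 g).
Proof. exact: (@sqnD2 _ _ _ leb3 f g). Qed.

Lemma sqn_dist3 f g h : f \in L2 -> g \in L2 -> h \in L2 ->
  sqn leb3 (fun x => f x - h x) <=
  2 * (sqn leb3 (fun x => f x - g x) + sqn leb3 (fun x => g x - h x)).
Proof. exact: (@sqn_dist _ _ _ leb3 f g h). Qed.

Lemma sqn_young3 e f g : 0 < e -> f \in L2 -> g \in L2 ->
  sqn leb3 (fun x => f x + g x) <= (1 + e) * sqn leb3 f + (1 + e^-1) * sqn leb3 g.
Proof. exact: (@sqn_young _ _ _ leb3 e f g). Qed.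

Lemma L2complexI F r : cmeas F ->
  has_int leb3 (fun x => normsqc (F x)) r -> L2complex F /\ sqnc F = r.
Proof.
move=> [F1 F2] Fr; have [Fi _] := Fr.
have L1 : (fun x => complex.Re (F x)) \in L2.
  by apply: (Lfun2_dom F1 _ Fi) => x; rewrite /normsqc lerDl sqr_ge0.
have L2' : (fun x => complex.Im (F x)) \in L2.
  by apply: (Lfun2_dom F2 _ Fi) => x; rewrite /normsqc lerDr sqr_ge0.
split => //; apply: has_int_unique Fr.
exact: (@has_intD _ _ _ leb3 _ _ _ _ (Lfun2_sqr3 L1) (Lfun2_sqr3 L2')).
Qed.

Lemma L2complex_normsqc F : L2complex F ->
  has_int leb3 (fun x => normsqc (F x)) (sqnc F).
Proof. by move=> [F1 F2]; exact: (@has_intD _ _ _ leb3 _ _ _ _ (Lfun2_sqr3 F1) (Lfun2_sqr3 F2)). Qed.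

Lemma Lfun2_step s : step_fun s \in L2.
Proof.
apply: (@Lfun2_has_int _ _ _ _ _ (step_dot s s)); first exact: measurable_step_fun.
by apply: (eq_has_int _ (has_int_step s s)) => x; rewrite expr2.
Qed.

Lemma L2complex_step s : L2complex (step_hat s).
Proof.
have [] // := @L2complexI (step_hat s) (planch * step_dot s s).
  exact: cmeas_step_hat.
by apply: (eq_has_int _ (has_int_step_hat s s)) => x; rewrite Re_mulJ /normsqc !expr2.
Qed.

(** Both sides are [planch * step_dot s s], where overlapping boxes are accounted for by the sum
    over all pairs. *)
Lemma plancherel_step s : sqnc (step_hat s) = planch * sqn leb3 (step_fun s).
Proof.
have [] // := @L2complexI (step_hat s) (planch * step_dot s s).
  exact: cmeas_step_hat.
- by apply: (eq_has_int _ (has_int_step_hat s s)) => x; rewrite Re_mulJ /normsqc !expr2.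
move=> _ ->; congr (_ * _); symmetry; apply: (@has_int_unique _ _ _ leb3 _ _ _ (Lfun2_sqr3 (Lfun2_step s))).
by apply: (eq_has_int _ (has_int_step s s)) => x; rewrite expr2.
Qed.

Definition step_scale (c : R) s : step := [seq (c * p.1, p.2) | p <- s].

Lemma step_fun_cat s t x : step_fun (s ++ t) x = step_fun s x + step_fun t x.
Proof. by rewrite /step_fun big_cat. Qed.

Lemma step_hat_cat s t x : step_hat (s ++ t) x = step_hat s x + step_hat t x.
Proof. by rewrite /step_hat big_cat. Qed.

Lemma step_fun_scale c s x : step_fun (step_scale c s) x = c * step_fun s x.
Proof.
by rewrite /step_fun /step_scale big_map mulr_sumr; apply: eq_bigr => p _; rewrite mulrA.
Qed.

Lemma step_hat_scale c s x : step_hat (step_scale c s) x = c%:C * step_hat s x.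
Proof.
rewrite /step_hat /step_scale big_map mulr_sumr; apply: eq_bigr => p _.
by rewrite mulrA; congr (_ * _); exact: (rmorphM (real_complex R)).
Qed.

(** Endpoints move by -v because the translated function is taken at x + v. *)
Definition shift_itv (v : R) (I : R * R) : R * R := (I.1 - v, I.2 - v).
Definition shift_box (v : R3) b : box :=
  (shift_itv v.1.1 b.1.1, shift_itv v.1.2 b.1.2, shift_itv v.2 b.2).
Definition step_shift (v : R3) s : step := [seq (p.1, shift_box v p.2) | p <- s].

Lemma bnd_shift v I : bnd (shift_itv v I) = ((bnd I).1 - v, (bnd I).2 - v).
Proof.
by rewrite /bnd /shift_itv /=; congr pair; have [h|h] := leP I.1 I.2;
  have [h'|h'] := leP (I.1 - v) (I.2 - v); lra.
Qed.

Lemma dot3 x xi :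
  dot (coords x) (coords xi) = x.1.1 * xi.1.1 + x.1.2 * xi.1.2 + x.2 * xi.2.
Proof. by rewrite /dot !big_ord_recl big_ord0 addr0 !mxE /= addrA. Qed.

Lemma step_fun_shift v s x : step_fun (step_shift v s) x = step_fun s (x + v).
Proof.
rewrite /step_fun /step_shift big_map; apply: eq_bigr => p _; congr (_ * _).
rewrite /box_ind /= !bnd_shift /ind /=.
by rewrite !ltrBlDr !lerBrDr.
Qed.

Lemma step_hat_shift v s xi : step_hat (step_shift v s) xi =
  cis (dot (coords v) (coords xi)) * step_hat s xi.
Proof.
rewrite /step_hat /step_shift big_map mulr_sumr; apply: eq_bigr => p _.
rewrite [RHS]mulrCA; congr (_ * _).
rewrite /box_hat /= !bnd_shift !ind_hat_shift dot3 !cisD.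
by ring.
Qed.

Definition cap_box b Q : box :=
  (cap (bnd b.1.1) (bnd Q.1.1), cap (bnd b.1.2) (bnd Q.1.2),
   cap (bnd b.2) (bnd Q.2)).

Lemma box_ind_cap b Q x : box_ind (cap_box b Q) x = box_ind b x * box_ind Q x.
Proof. by rewrite /box_ind /= !ind_bnd !ind_cap !ind_bnd; ring. Qed.

Definition step_clip Q s : step := [seq (p.1, cap_box p.2 Q) | p <- s].

Lemma step_fun_clip Q s x : step_fun (step_clip Q s) x = step_fun s x * box_ind Q x.
Proof.
rewrite /step_fun /step_clip big_map mulr_suml; apply: eq_bigr => p _ /=.
by rewrite box_ind_cap mulrA.
Qed.

Lemma box_indB b x : box_ind b x = 0 \/ box_ind b x = 1.
Proof.
rewrite /box_ind /ind.
by do 3!case: (_ && _); rewrite ?mulr0 ?mul0r ?mulr1; auto.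
Qed.

Lemma has_cint_step s xi : has_cint leb3
  (fun x => (step_fun s x)%:C * cis (- dot (coords x) (coords xi)))
  (step_hat s xi).
Proof.
have H b : has_cint leb3
    (fun x => (box_ind b x)%:C * cis (- dot (coords x) (coords xi))) (box_hat b xi).
  have := has_cint_tensor3 (has_cint_ind xi.1.1 (bnd_le b.1.1))
    (has_cint_ind xi.1.2 (bnd_le b.1.2)) (has_cint_ind xi.2 (bnd_le b.2)).
  apply: eq_has_cint => x; rewrite dot3 !opprD !cisD /box_ind.
  rewrite !(rmorphM (real_complex R)) /=.
  by ring.
elim: s => [|p s [ih1 ih2]].
  rewrite /step_hat big_nil; split; apply: (eq_has_int _ (has_int0 leb3)) => x;
  by rewrite /step_fun big_nil /= !mul0r ?addr0 ?subr0.
have [h1 h2] := H p.2; rewrite step_hat_cons; split.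
  rewrite (_ : complex.Re _ = p.1 * complex.Re (box_hat p.2 xi) + complex.Re (step_hat s xi)); last first.
    by case: (box_hat _ _) => ? ?; case: (step_hat _ _) => ? ? /=; ring.
  apply: (eq_has_int _ (has_intD (has_intZ p.1 h1) ih1)) => x.
  by rewrite step_fun_cons /=; ring.
rewrite (_ : complex.Im _ = p.1 * complex.Im (box_hat p.2 xi) + complex.Im (step_hat s xi)); last first.
  by case: (box_hat _ _) => ? ?; case: (step_hat _ _) => ? ? /=; ring.
apply: (eq_has_int _ (has_intD (has_intZ p.1 h2) ih2)) => x.
by rewrite step_fun_cons /=; ring.
Qed.

End Boxes.

Import HBNNSimple.

(** * Density of step functions among L^2 functions of bounded support *)

Section Density.
Context (R : realType).
Local Notation lam := (@lebesgue_measure R).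
Local Notation R3 := (R3 R).
Local Notation mR := (measurableTypeR R).
Local Notation mR3 := (mR * mR * mR)%type.
Local Notation leb3 := (@leb3 R).
Local Notation L2 := (Lfun leb3 2%:E).
Local Notation box := ((R * R) * (R * R) * (R * R))%type.
Local Notation step := (seq (R * box)).
Implicit Types (f g : R3 -> R) (Q : box) (s : step).

Definition approx f := f \in L2 /\ forall e, 0 < e ->
  exists s, sqn leb3 (fun x => f x - step_fun s x) < e.

Lemma eq_approx f g : f =1 g -> approx f -> approx g.
Proof. by move=> /funext ->. Qed.

Lemma approxD f g : approx f -> approx g -> approx (fun x => f x + g x).
Proof.
move=> [fL fa] [gL ga]; split; first exact: Lfun2D.
move=> e e0; have e4 : 0 < e / 4 by lra.
have [s sP] := fa _ e4; have [t tP] := ga _ e4.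
exists (s ++ t).
apply: lt_quarters _ sP tP.
have := sqnD23 (Lfun2B3 fL (Lfun2_step s)) (Lfun2B3 gL (Lfun2_step t)).
rewrite (_ : (fun x => _) = fun x => f x + g x - step_fun (s ++ t) x); last first.
  by apply/funext => x; rewrite step_fun_cat; ring.
by [].
Qed.

Lemma approxZ c f : approx f -> approx (fun x => c * f x).
Proof.
move=> [fL fa]; split; first exact: Lfun2Z.
move=> e e0; have c0 : 0 < c ^+ 2 + 1 by rewrite ltr_wpDl ?sqr_ge0.
have [s sP] := fa _ (divr_gt0 e0 c0); exists (step_scale c s).
rewrite (_ : (fun x => _) = fun x => c * (f x - step_fun s x)); last first.
  by apply/funext => x; rewrite step_fun_scale mulrBr.
rewrite sqnZ3; last exact: Lfun2B3 (Lfun2_step s).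
apply: (@le_lt_trans _ _ ((c ^+ 2 + 1) * sqn leb3 (fun x => f x - step_fun s x))).
  by rewrite ler_wpM2r ?sqn_ge0// lerDl.
by rewrite mulrC -ltr_pdivlMr.
Qed.

Lemma approx_step s : approx (step_fun s).
Proof.
split; first exact: Lfun2_step.
move=> e e0; exists s; rewrite (_ : (fun x => _) = fun=> 0).
  by rewrite /sqn /Rintegral expr0n/= integral0.
by apply/funext => x; rewrite subrr.
Qed.

Lemma approx_box Q : approx (box_ind Q).
Proof.
apply: (eq_approx _ (approx_step [:: (1, Q)])) => x.
by rewrite step_fun_cons /step_fun big_nil addr0 mul1r.
Qed.

Lemma approx0 : approx (fun=> 0).
Proof.
by apply: (eq_approx _ (approx_step [::])) => x; rewrite /step_fun big_nil.
Qed.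

Lemma approx_sum (I : Type) (l : seq I) (F : I -> R3 -> R) :
  (forall i, approx (F i)) -> approx (fun x => \sum_(i <- l) F i x).
Proof.
move=> FP; elim: l => [|i l ih].
  by apply: (eq_approx _ approx0) => x; rewrite big_nil.
by apply: (eq_approx _ (approxD (FP i) ih)) => x; rewrite big_cons.
Qed.

Lemma approx_lim f : f \in L2 ->
  (forall e, 0 < e -> exists2 g, approx g & sqn leb3 (fun x => f x - g x) < e) ->
  approx f.
Proof.
move=> fL H; split => // e e0; have e4 : 0 < e / 4 by lra.
have [g [gL ga] gf] := H _ e4; have [s sP] := ga _ e4; exists s.
exact: lt_quarters (sqn_dist3 fL gL (Lfun2_step s)) gf sP.
Qed.

Lemma integrable_box Q : leb3.-integrable setT (EFin \o box_ind Q).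
Proof.
by have [] := has_int_tensor3 (has_int_ind (bnd_le Q.1.1))
  (has_int_ind (bnd_le Q.1.2)) (has_int_ind (bnd_le Q.2)).
Qed.

Lemma box_ind_sqr Q x : box_ind Q x ^+ 2 = box_ind Q x.
Proof. by have [->|->] := box_indB Q x; rewrite ?expr0n ?expr1n. Qed.

Lemma box_ind_ge0 Q x : 0 <= box_ind Q x.
Proof. by have [->|->] := box_indB Q x. Qed.

Let G3 : set (set mR3) :=
  [set A `*` B | A in [set A `*` B | A in @ocitv R & B in @ocitv R] &
     B in @ocitv R].

(** The product lemma is used twice, with the intervals ]-n, n] and their squares as exhausting
    sequences. *)
Lemma measurable_G3 (A : set mR3) : measurable A -> <<s G3 >> A.
Proof.
have gR (B : set mR) : measurable B -> <<s @ocitv R >> B by [].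
pose E n : set mR := `]- n%:R, n%:R]%classic.
have EC n : ocitv (E n) by exists (- n%:R, n%:R).
have ET : \bigcup_n E n = setT.
  apply/seteqP; split => // x _.
  have [n nx] : exists n : nat, `|x| < n%:R.
    by eexists; exact: truncnS_gt.
  exists n => //; rewrite /E /= in_itv/=; move: nx; rewrite ltr_norml => /andP[h1 h2].
  by rewrite h1 ltW.
pose E2 n : set (mR * mR) := E n `*` E n.
have E2T : \bigcup_n E2 n = setT.
  apply/seteqP; split => // -[x y] _.
  have [n _ nx] : (\bigcup_n E n) x by rewrite ET.
  have [m _ my] : (\bigcup_n E n) y by rewrite ET.
  have mono p q z : (p <= q)%N -> E p z -> E q z.
    rewrite /E /= !in_itv/= -(@ler_nat R) => pq /andP[h1 h2].
    by apply/andP; split; lra.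
  exists (maxn n m) => //; split => /=.
    by apply: mono nx; rewrite leq_maxl.
  by apply: mono my; rewrite leq_maxr.
apply: (@measurable_prod_generated _ _ _ _ _ _ _ _ E2 E) => //.
- exact: (@measurable_prod_generated _ _ _ _ _ _ _ _ E E).
- by move=> n; exists (E n) => //; exists (E n).
Qed.

Lemma setI_closed_G3 : setI_closed G3.
Proof.
move=> _ _ [_ [A oA [B oB <-]] [C oC <-]] [_ [A' oA' [B' oB' <-]] [C' oC' <-]].
exists ((A `&` A') `*` (B `&` B')).
  by exists (A `&` A'); [exact: ocitvI|exists (B `&` B') => //; exact: ocitvI].
exists (C `&` C'); first exact: ocitvI.
by apply/seteqP; split => -[[x y] z] /=; tauto.
Qed.

Lemma G3_box A : G3 A -> exists b : box, forall x, \1_A x = box_ind b x.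
Proof.
move=> [_ [_ [[a1 a2] _ <-] [_ [[b1 b2] _ <-] <-]] [_ [[c1 c2] _ <-] <-]].
exists (((a1, a2), (b1, b2)), (c1, c2)) => -[[x y] z].
rewrite /box_ind !ind_bnd !indE !indicE -!natrM !mulnb /=.
congr (nat_of_bool _)%:R; apply/idP/andP.
  rewrite inE => -[[h1 h2] h3]; split; last by rewrite inE.
  by apply/andP; split; rewrite inE.
by move=> [/andP[]]; rewrite !inE.
Qed.

(** Dynkin's pi-lambda theorem: boxes are stable under intersection, and the sets with this property
    for every [Q] form a lambda-system. Cutting by a box keeps complements and countable unions in
    L^2, as the whole space has infinite measure. *)
Lemma approx_indic (A : set mR3) Q : measurable A ->
  approx (fun x => \1_A x * box_ind Q x).
Proof.
move=> mA.
pose D := [set A : set mR3 | measurable A /\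
  forall Q, approx (fun x => \1_A x * box_ind Q x)].
suff : D A by move=> [_]; exact.
move: A mA; suff GD : <<d G3 >> `<=` D.
  by move=> A /measurable_G3; rewrite -setI_closed_g_dynkin_g_sigma_algebra;
    [exact: GD | exact: setI_closed_G3].
apply: smallest_sub => [|A GA]; last first.
  split.
    case: GA => _ [_ [[a1 a2] _ <-] [_ [[b1 b2] _ <-] <-]] [_ [[c1 c2] _ <-] <-].
    by apply: measurableX => //; exact: measurableX.
  move=> Q'; have [b bE] := G3_box GA.
  by apply: (eq_approx _ (approx_box (cap_box b Q'))) => x; rewrite box_ind_cap bE.
split.
- split=> // Q'; apply: (eq_approx _ (approx_box Q')) => x.
  by rewrite indicT mul1r.
- move=> A [mA AP]; split; first exact: measurableC.
  move=> Q'; apply: (eq_approx _ (approxD (approx_box Q') (approxZ (- 1) (AP Q')))).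
  by move=> x; rewrite !indicE in_setC; case: (_ \in _); rewrite /=; ring.
- move=> F tF FD; have mF n : measurable (F n) by have [] := FD n.
  split; first exact: bigcupT_measurable.
  move=> Q'.
  have mU : measurable (\bigcup_k F k) by exact: bigcupT_measurable.
  have i01 (B : set mR3) x : 0 <= (\1_B x : R) <= 1.
    by rewrite indicE; case: (_ \in _) => /=; rewrite ler01 lexx.
  (* The sets are disjoint, so at each point the partial sums reach the indicator of the union in
     one jump, after the index [j] of the set that contains the point; outside the union any [j]
     works. The remainder thus vanishes eventually and stays below 1. *)
  have S x : exists j : nat, forall n,
      \1_(\bigcup_k F k) x - \sum_(0 <= k < n) \1_(F k) x =
      \1_(\bigcup_k F k) x * (n <= j)%N%:R :> R.
    have [[j _ Fjx]|nU] := pselect ((\bigcup_k F k) x).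
      exists j => n; rewrite indicE mem_set/=; last by exists j.
      have Fk k : \1_(F k) x = (k == j)%:R :> R.
        rewrite indicE; congr (nat_of_bool _)%:R; apply/idP/eqP => [|->].
          rewrite inE => Fkx; apply: contrapT => /eqP kj.
          move/trivIsetP : tF => /(_ k j Logic.I Logic.I kj).
          by move/seteqP => [/(_ x) + _]; apply.
        by rewrite inE.
      under eq_bigr do rewrite Fk.
      rewrite mul1r leqNgt; have [jn|nj] := ltnP j n.
        rewrite (bigD1_seq j) ?iota_uniq ?mem_index_iota//= eqxx.
        by rewrite big1 ?addr0 ?subrr// => i /negbTE ->.
      rewrite big_nat big1 ?subr0// => i /andP[_ ilt].
      by rewrite (_ : (i == j) = false)//; apply/negbTE; rewrite neq_ltn (leq_trans ilt).
    exists 0%N => n.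
    have F0 k : \1_(F k) x = 0 :> R.
      by rewrite indicE memNset// => Fkx; apply: nU; exists k.
    under eq_bigr do rewrite F0.
    by rewrite big1// subr0 indicE memNset// mul0r.
  have fL : (fun x => \1_(\bigcup_k F k) x * box_ind Q' x) \in L2.
    apply: (Lfun2_dom _ _ (integrable_box Q')).
      apply: measurable_funM; last exact: measurable_box_ind.
      exact: measurable_indic.
    move=> x; rewrite exprMn box_ind_sqr.
    case/andP: (i01 (\bigcup_k F k) x) => h0 h1.
    by apply: ler_piMl; [exact: box_ind_ge0 | exact: exprn_ile1].
  apply: approx_lim => // e e0.
  have [] := @sqn_dominated _ _ _ leb3
    (fun n x => (\1_(\bigcup_k F k) x - \sum_(0 <= k < n) \1_(F k) x) * box_ind Q' x)
    (box_ind Q') _ _ _ (integrable_box Q') e e0.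
  + move=> n; apply: measurable_funM; last exact: measurable_box_ind.
    apply: measurable_funB; first exact: measurable_indic.
    by apply: measurable_sum => k; exact: measurable_indic.
  + move=> x; have [j jP] := S x.
    apply: cvg_near_cst; exists j.+1 => // n /= jn.
    by rewrite jP leqNgt jn /= mulr0 mul0r.
  + move=> n x; have [j jP] := S x.
    rewrite exprMn box_ind_sqr jP.
    case/andP: (i01 (\bigcup_k F k) x) => h0 h1.
    apply: ler_piMl; first exact: box_ind_ge0.
    by apply: exprn_ile1; case: (n <= j)%N; rewrite ?mulr1 ?mulr0.
  move=> N /(_ N (leqnn N)) NP.
  exists (fun x => \sum_(0 <= k < N) \1_(F k) x * box_ind Q' x).
    by apply: approx_sum => k; have [_] := FD k; apply.
  rewrite (_ : (fun x => _) = fun x => (\1_(\bigcup_k F k) x -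
    \sum_(0 <= k < N) \1_(F k) x) * box_ind Q' x)//.
  by apply/funext => x; rewrite mulrBl mulr_suml.
Qed.

(** Increasing simple functions, cut by [Q], converge to [f] pointwise, and the squares of the
    differences are dominated by f^2. *)
Lemma approx_ge0 f Q : f \in L2 -> (forall x, 0 <= f x) ->
  (forall x, f x * box_ind Q x = f x) -> approx f.
Proof.
move=> fL f0 fQ.
have mf : measurable_fun [set: mR3] (EFin \o f).
  by apply/measurable_EFinP; exact: Lfun_meas3 fL.
pose a := nnsfun_approx measurableT mf.
have cva x : a n x @[n --> \oo] --> f x.
  have := @cvg_nnsfun_approx _ _ _ _ measurableT _ mf.
  move=> /(_ (fun x _ => f0 x) x Logic.I).
  by move=> /fine_cvgP[_].
have a0 n x : 0 <= a n x by exact: fun_ge0.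
have ale n x : a n x <= f x.
  have <- : limn (fun n => a n x) = f x by apply: cvg_lim (cva x).
  apply: (@nondecreasing_cvgn_le _ (fun n => a n x)).
    by move=> m p mp; have /lefP := nd_nnsfun_approx measurableT mf mp; apply.
  by apply/cvg_ex; exists (f x).
have aQ n : approx (fun x => a n x * box_ind Q x).
  apply: (eq_approx _ (approx_sum (finmap.enum_fset (fset_set (range (a n))))
    (fun y => approxZ y (approx_indic Q
      (measurable_funPTI (a n) (measurable_set1 y)))))) => x.
  rewrite fimfunE fsbig_finite//= mulr_suml.
  by apply: eq_bigr => y _; rewrite mulrA.
apply: approx_lim => // e e0.
have [fi _] := Lfun2_sqr3 fL.
have [] := @sqn_dominated _ _ _ leb3 (fun n x => f x - a n x * box_ind Q x)
  (fun x => f x ^+ 2) _ _ _ fi e e0.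
- move=> n; apply: measurable_funB; first exact: Lfun_meas3 fL.
  by apply: measurable_funM => //; exact: measurable_box_ind.
- move=> x; rewrite -[0](subrr (f x)) -[X in _ - X]fQ.
  apply: cvgB; first exact: cvg_cst.
  by apply: cvgM; [exact: cva | exact: cvg_cst].
- move=> n x; rewrite -[in X in X <= _](fQ x) -mulrBl exprMn box_ind_sqr.
  rewrite -[leRHS]mulr1 ler_pM ?sqr_ge0 ?box_ind_ge0//.
    by rewrite ler_sqr ?nnegrE ?subr_ge0// gerBl.
  by have [->|->] := box_indB Q x.
move=> N /(_ N (leqnn N)) NP.
by exists (fun x => a N x * box_ind Q x).
Qed.

Lemma approx_supported f Q : f \in L2 ->
  (forall x, f x * box_ind Q x = f x) -> approx f.
Proof.
move=> fL fQ.
have P (c : R) : c ^+ 2 = 1 -> approx (fun x => Num.max (c * f x) 0).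
  move=> c1; apply: (@approx_ge0 _ Q).
  - have [fi _] := Lfun2_sqr3 fL; apply: (Lfun2_dom _ _ fi).
      apply: measurable_maxr; last exact: measurable_cst.
      by apply: measurable_funM => //; exact: Lfun_meas3 fL.
    move=> x; have [h|h] := leP (c * f x) 0.
      by rewrite expr0n/= sqr_ge0.
    by rewrite exprMn c1 mul1r.
  - by move=> x; rewrite le_max lexx orbT.
  - move=> x; have := fQ x; have [->|->] := box_indB Q x; rewrite ?mulr0 ?mulr1//.
    by move=> <-; rewrite mulr0 maxxx.
have c1 : 1 ^+ 2 = 1 :> R by rewrite expr1n.
have c2 : (- 1) ^+ 2 = 1 :> R by rewrite sqrrN expr1n.
apply: (eq_approx _ (approxD (P 1 c1) (approxZ (- 1) (P (- 1) c2)))) => x.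
rewrite mul1r !mulN1r.
by have [] := leP (f x) 0; have [] := leP (- f x) 0; lra.
Qed.

End Density.

(** * Plancherel's identity *)

Section ComplexSquareNorm.
Context (R : realType).
Local Notation R3 := (R3 R).
Local Notation leb3 := (@leb3 R).
Implicit Types (F G H : R3 -> R[i]).

Lemma ReD (z w : R[i]) : complex.Re (z + w) = complex.Re z + complex.Re w.
Proof. by case: z w => ? ? []. Qed.
Lemma ImD (z w : R[i]) : complex.Im (z + w) = complex.Im z + complex.Im w.
Proof. by case: z w => ? ? []. Qed.
Lemma ReB (z w : R[i]) : complex.Re (z - w) = complex.Re z - complex.Re w.
Proof. by case: z w => ? ? []. Qed.
Lemma ImB (z w : R[i]) : complex.Im (z - w) = complex.Im z - complex.Im w.
Proof. by case: z w => ? ? []. Qed.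
Lemma ReZ (c : R) (w : R[i]) : complex.Re (c%:C * w) = c * complex.Re w.
Proof. by case: w => ? ? /=; rewrite mul0r subr0. Qed.
Lemma ImZ (c : R) (w : R[i]) : complex.Im (c%:C * w) = c * complex.Im w.
Proof. by case: w => ? ? /=; rewrite mul0r addr0. Qed.

Lemma sqnc_ge0 F : 0 <= sqnc F.
Proof. by rewrite addr_ge0 ?sqn_ge0. Qed.

Lemma L2complexD F G : L2complex F -> L2complex G ->
  L2complex (fun x => F x + G x).
Proof.
move=> [F1 F2] [G1 G2]; split.
  by under eq_fun do rewrite ReD; exact: Lfun2D.
by under eq_fun do rewrite ImD; exact: Lfun2D.
Qed.

Lemma L2complexB F G : L2complex F -> L2complex G ->
  L2complex (fun x => F x - G x).
Proof.
move=> [F1 F2] [G1 G2]; split.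
  by under eq_fun do rewrite ReB; exact: Lfun2B3.
by under eq_fun do rewrite ImB; exact: Lfun2B3.
Qed.

Lemma L2complexZ (c : R) F : L2complex F -> L2complex (fun x => c%:C * F x).
Proof.
move=> [F1 F2]; split.
  by under eq_fun do rewrite ReZ; exact: Lfun2Z.
by under eq_fun do rewrite ImZ; exact: Lfun2Z.
Qed.

Lemma sqncZ (c : R) F : L2complex F ->
  sqnc (fun x => c%:C * F x) = c ^+ 2 * sqnc F.
Proof.
move=> [F1 F2]; rewrite /sqnc mulrDr -(sqnZ3 c F1) -(sqnZ3 c F2).
by congr (_ + _); congr (sqn leb3 _); apply/funext => x; rewrite ?ReZ ?ImZ.
Qed.

Lemma sqnc_young e F G : 0 < e -> L2complex F -> L2complex G ->
  sqnc (fun x => F x + G x) <= (1 + e) * sqnc F + (1 + e^-1) * sqnc G.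
Proof.
move=> e0 [F1 F2] [G1 G2].
have := sqn_young3 e0 F1 G1; have := sqn_young3 e0 F2 G2; rewrite /sqnc.
rewrite (_ : (fun x => complex.Re (F x + G x)) =
  fun x => complex.Re (F x) + complex.Re (G x)); last by apply/funext => x; rewrite ReD.
rewrite (_ : (fun x => complex.Im (F x + G x)) =
  fun x => complex.Im (F x) + complex.Im (G x)); last by apply/funext => x; rewrite ImD.
rewrite !mulrDr; lra.
Qed.

Lemma sqncD2 F G : L2complex F -> L2complex G ->
  sqnc (fun x => F x + G x) <= 2 * (sqnc F + sqnc G).
Proof.
by move=> FL GL; have := sqnc_young ltr01 FL GL; rewrite invr1 -mulrDr.
Qed.

Lemma sqnc_dist F G H : L2complex F -> L2complex G -> L2complex H ->
  sqnc (fun x => F x - H x) <=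
  2 * (sqnc (fun x => F x - G x) + sqnc (fun x => G x - H x)).
Proof.
move=> FL GL HL; have := sqncD2 (L2complexB FL GL) (L2complexB GL HL).
by under eq_fun do rewrite subrKA.
Qed.

Lemma sqnc_mono F G : L2complex F -> L2complex G ->
  (forall x, normsqc (F x) <= normsqc (G x)) -> sqnc F <= sqnc G.
Proof.
by move=> /L2complex_normsqc FL /L2complex_normsqc GL FG; exact: (@has_int_le _ _ _ leb3 _ _ _ _ FG FL GL).
Qed.

Lemma sqnc_normsqc F G : L2complex F -> L2complex G ->
  (forall x, normsqc (F x) = normsqc (G x)) -> sqnc F = sqnc G.
Proof.
by move=> FL GL FG; apply/le_anti/andP; split; apply: sqnc_mono => // x; rewrite FG.
Qed.

End ComplexSquareNorm.

Section Translation.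
Context (R : realType).
Local Notation lam := (@lebesgue_measure R).
Local Notation R3 := (R3 R).
Local Notation mR := (measurableTypeR R).
Local Notation mR3 := (mR * mR * mR)%type.
Local Notation leb3 := (@leb3 R).

(** The image of the product measure agrees with it on rectangles, and the product measure is
    characterized by its values there. *)
Lemma prod_meas_preserved d1 d2 (T1 : measurableType d1) (T2 : measurableType d2)
    (m1 : {sigma_finite_measure set T1 -> \bar R})
    (m2 : {sigma_finite_measure set T2 -> \bar R})
    (phi1 : T1 -> T1) (phi2 : T2 -> T2) :
  measurable_fun setT phi1 -> measurable_fun setT phi2 ->
  (forall A, measurable A -> m1 A = m1 (phi1 @^-1` A)) ->
  (forall A, measurable A -> m2 A = m2 (phi2 @^-1` A)) ->
  let phi z := (phi1 z.1, phi2 z.2) in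
  measurable_fun setT phi /\
  forall A, measurable A -> prod_meas m1 m2 A = prod_meas m1 m2 (phi @^-1` A).
Proof.
move=> mphi1 mphi2 p1 p2 phi.
have mphi : measurable_fun setT phi.
  apply: measurable_fun_pair.
    exact: (measurableT_comp mphi1 measurable_fst).
  exact: (measurableT_comp mphi2 measurable_snd).
split=> // A mA.
pose phi_mixin := isMeasurableFun.Build _ _ _ _ _ mphi.
pose phi_pack : {mfun _ >-> _} := HB.pack phi phi_mixin.
apply: (@product_measure_unique _ _ _ _ _ m1 m2
  (pushforward (prod_meas m1 m2) phi_pack)) => // B C mB mC.
change (prod_meas m1 m2 (phi @^-1` (B `*` C)) = (m1 B * m2 C)%E).
have -> : phi @^-1` (B `*` C) = (phi1 @^-1` B) `*` (phi2 @^-1` C) by [].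
have m1' : measurable (phi1 @^-1` B) by rewrite -[X in measurable X]setTI; exact: mphi1.
have m2' : measurable (phi2 @^-1` C) by rewrite -[X in measurable X]setTI; exact: mphi2.
transitivity (m1 (phi1 @^-1` B) * m2 (phi2 @^-1` C))%E.
  exact: product_measure1E.
by rewrite -p1// -p2.
Qed.

Lemma has_int_translate (v : R3) (f : R3 -> R) r :
  has_int leb3 f r -> has_int leb3 (fun x => f (x + v)) r.
Proof.
have H (b : R) : forall A : set mR, measurable A ->
    lam A = lam ((fun x : mR => 1 * x + b) @^-1` A).
  by move=> A mA; rewrite {1}(lebesgue_measure_affine b ltr01 mA) mul1e.
have mH (b : R) : measurable_fun [set: mR] (fun x : mR => 1 * x + b).
  exact: measurable_affine.
have [mp p12] := prod_meas_preserved (mH v.1.1) (mH v.1.2) (H _) (H _).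
have [mp3 p123] := @prod_meas_preserved _ _ _ _ (prod_meas lam lam) lam _ _
  mp (mH v.2) p12 (H _).
move=> fr.
have fr' : has_int (prod_meas (prod_meas lam lam) lam) f r by exact fr.
have E A mA := etrans (p123 A mA) (esym (mul1e _)).
have := has_int_comp mp3 ltr01 E fr'; rewrite invr1 mul1r => h.
have -> : (fun x => f (x + v)) = fun x : R3 =>
    f ((1 * x.1.1 + v.1.1, 1 * x.1.2 + v.1.2), 1 * x.2 + v.2).
  by apply/funext => -[[x y] z]; rewrite /= !mul1r.
exact h.
Qed.

Lemma Lfun2_translate (v : R3) (f : R3 -> R) : f \in Lfun leb3 2%:E ->
  (fun x => f (x + v)) \in Lfun leb3 2%:E.
Proof.
move=> fL; have h := has_int_translate v (Lfun2_sqr3 fL).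
apply: Lfun2_has_int h.
have [h' _] := Lfun2_sqr3 fL.
have mv : measurable_fun [set: mR3] (fun x : mR3 => (x + v : mR3)).
  apply: (@measurable_fun_pair _ _ _ _ _ _
    (fun x : mR3 => (x.1 + v.1 : (mR * mR)%type)) (fun x : mR3 => x.2 + v.2 : mR)).
    apply: (@measurable_fun_pair _ _ _ _ _ _
      (fun x : mR3 => x.1.1 + v.1.1 : mR) (fun x : mR3 => x.1.2 + v.1.2 : mR)).
      by apply: measurable_funD => //; exact: measurable_fst3.
    by apply: measurable_funD => //; exact: measurable_snd3.
  by apply: measurable_funD => //; exact: measurable_snd.
exact: (measurableT_comp (Lfun_meas3 fL) mv).
Qed.

Lemma sqn_translate (v : R3) (f : R3 -> R) : f \in Lfun leb3 2%:E ->
  sqn leb3 (fun x => f (x + v)) = sqn leb3 f.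
Proof. by move=> /Lfun2_sqr3/(has_int_translate v)[]. Qed.

End Translation.

Section Plancherel.
Context (R : realType).
Local Notation lam := (@lebesgue_measure R).
Local Notation R3 := (R3 R).
Local Notation mR := (measurableTypeR R).
Local Notation mR3 := (mR * mR * mR)%type.
Local Notation leb3 := (@leb3 R).
Local Notation L2 := (Lfun leb3 2%:E).
Implicit Types (f g : R3 -> R) (F G : R3 -> R[i]).

(* F is the Fourier transform of f, as a limit of the explicit transforms of
   step functions; unlike [fourierL2], this is visibly stable under translations. *)
Definition step_fourier f F := [/\ f \in L2, L2complex F & forall e, 0 < e ->
  exists s, sqn leb3 (fun x => f x - step_fun s x) < e /\
            sqnc (fun x => F x - step_hat s x) < e].

Lemma eq_step_fourier f g F G : f =1 g -> F =1 G ->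
  step_fourier f F -> step_fourier g G.
Proof. by move=> /funext -> /funext ->. Qed.

Lemma step_fourierD f g F G : step_fourier f F -> step_fourier g G ->
  step_fourier (fun x => f x + g x) (fun x => F x + G x).
Proof.
move=> [fL FL H] [gL GL K]; split; [exact: Lfun2D | exact: L2complexD|].
move=> e e0; have e4 : 0 < e / 4 by lra.
have [s [s1 s2]] := H _ e4; have [t [t1 t2]] := K _ e4.
exists (s ++ t); split.
  apply: lt_quarters _ s1 t1.
  have := sqnD23 (Lfun2B3 fL (Lfun2_step s)) (Lfun2B3 gL (Lfun2_step t)).
  rewrite (_ : (fun x => _) = fun x => f x + g x - step_fun (s ++ t) x); last first.
    by apply/funext => x; rewrite step_fun_cat; ring.
  by [].
apply: lt_quarters _ s2 t2.
have := sqncD2 (L2complexB FL (L2complex_step s)) (L2complexB GL (L2complex_step t)).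
rewrite (_ : (fun x => _) = fun x => F x + G x - step_hat (s ++ t) x); last first.
  by apply/funext => x; rewrite step_hat_cat opprD addrACA.
by [].
Qed.

Lemma step_fourierZ c f F : step_fourier f F ->
  step_fourier (fun x => c * f x) (fun x => c%:C * F x).
Proof.
move=> [fL FL H]; split; [exact: Lfun2Z | exact: L2complexZ|].
move=> e e0; have c0 : 0 < c ^+ 2 + 1 by rewrite ltr_wpDl ?sqr_ge0.
have [s [s1 s2]] := H _ (divr_gt0 e0 c0); exists (step_scale c s).
have le z : 0 <= z -> z < e / (c ^+ 2 + 1) -> c ^+ 2 * z < e.
  rewrite ltr_pdivlMr// => z0 ze; apply: le_lt_trans ze.
  by rewrite mulrC ler_wpM2l// lerDl.
split.
  rewrite (_ : (fun x => _) = fun x => c * (f x - step_fun s x)); last first.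
    by apply/funext => x; rewrite step_fun_scale mulrBr.
  rewrite sqnZ3; last exact: Lfun2B3 (Lfun2_step s).
  exact: le (sqn_ge0 _ _) s1.
rewrite (_ : (fun x => _) = fun x => c%:C * (F x - step_hat s x)); last first.
  by apply/funext => x; rewrite step_hat_scale mulrBr.
rewrite sqncZ; last exact: L2complexB (L2complex_step s).
exact: le (sqnc_ge0 _) s2.
Qed.

Lemma cmeas_cis (v : R3) : cmeas (fun xi => cis (dot (coords v) (coords xi))).
Proof.
have m : measurable_fun [set: mR3] (fun xi : mR3 => dot (coords v) (coords xi)).
  under eq_fun do rewrite dot3.
  apply: measurable_funD; first apply: measurable_funD.
  - by apply: measurable_funM => //; exact: measurable_fst3.
  - by apply: measurable_funM => //; exact: measurable_snd3.
  - by apply: measurable_funM => //; exact: measurable_snd.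
by split; [exact: measurable_cos_comp m | exact: measurable_sin_comp m].
Qed.

Lemma L2complex_cis (v : R3) F : L2complex F ->
  L2complex (fun xi => cis (dot (coords v) (coords xi)) * F xi).
Proof.
move=> FL; have [] // := @L2complexI _
  (fun xi => cis (dot (coords v) (coords xi)) * F xi) (sqnc F).
  apply: cmeasM; first exact: cmeas_cis.
  by case: FL => F1 F2; split; [exact: (Lfun_meas3 F1) | exact: (Lfun_meas3 F2)].
apply: (eq_has_int _ (L2complex_normsqc FL)) => x.
by rewrite normsqcM normsqc_cis mul1r.
Qed.

(** The approximating step function is translated along with [f]. The error in x keeps its norm by
    translation invariance, the error in xi because it is multiplied by a factor of modulus 1. *)
Lemma step_fourier_translate (v : R3) f F : step_fourier f F ->
  step_fourier (fun x => f (x + v))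
    (fun xi => cis (dot (coords v) (coords xi)) * F xi).
Proof.
move=> [fL FL H]; split; [exact: Lfun2_translate | exact: L2complex_cis|].
move=> e /H[s [s1 s2]]; exists (step_shift v s); split.
  rewrite (_ : sqn leb3 _ = sqn leb3 (fun x => f x - step_fun s x))//.
  rewrite -(sqn_translate v (Lfun2B3 fL (Lfun2_step s))).
  by congr (sqn leb3 _); apply/funext => x; rewrite step_fun_shift.
have BL := L2complexB FL (L2complex_step s).
rewrite (_ : (fun x => _) = fun x =>
  cis (dot (coords v) (coords x)) * (F x - step_hat s x)); last first.
  by apply/funext => x; rewrite step_hat_shift mulrBr.
rewrite (sqnc_normsqc _ BL)//; first exact: L2complex_cis.
by move=> x; rewrite normsqcM normsqc_cis mul1r.
Qed.

Lemma step_fourier_lim f F : f \in L2 -> L2complex F ->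
  (forall e, 0 < e -> exists g G, [/\ step_fourier g G,
     sqn leb3 (fun x => f x - g x) < e & sqnc (fun x => F x - G x) < e]) ->
  step_fourier f F.
Proof.
move=> fL FL H; split => // e e0; have e4 : 0 < e / 4 by lra.
have [g [G [[gL GL K] h1 h2]]] := H _ e4; have [s [s1 s2]] := K _ e4; exists s.
split; first exact: lt_quarters (sqn_dist3 fL gL (Lfun2_step s)) h1 s1.
exact: lt_quarters (sqnc_dist FL GL (L2complex_step s)) h2 s2.
Qed.

(** Two chained uses of Young's inequality, through an intermediate quantity [S e]; all losses
    vanish as e tends to 0. *)
Lemma ler_young_limit (X S : R -> R) (x y c : R) : 0 <= c -> 0 <= y ->
  (forall e, 0 < e -> e <= 1 -> x <= (1 + e) * (c * S e) + 2 * e) ->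
  (forall e, 0 < e -> e <= 1 -> S e <= (1 + e) * y + 2 * e) -> x <= c * y.
Proof.
move=> c0 y0 H1 H2; apply/ler_addgt0Pr => e e0.
(* For d <= 1, expanding the chained bound and replacing d^2 by d leaves c y + d M. *)
pose M := 3 * c * y + 4 * c + 2.
have M0 : 0 < M by rewrite /M; have := mulr_ge0 c0 y0; nra.
pose d := Num.min 1 (e / M).
have d0 : 0 < d by rewrite lt_min ltr01 divr_gt0.
have d1 : d <= 1 by rewrite ge_min lexx.
have dM : d * M <= e by rewrite -ler_pdivlMr// ge_min lexx orbT.
have h1 := H1 _ d0 d1; have h2 := H2 _ d0 d1.
have h3 : c * S d <= c * ((1 + d) * y + 2 * d) by rewrite ler_wpM2l.
have h4 : (1 + d) * (c * S d) <= (1 + d) * (c * ((1 + d) * y + 2 * d)).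
  by rewrite ler_wpM2l//; lra.
apply: (le_trans h1); apply: (le_trans (lerD h4 (lexx _))).
suff : (1 + d) * (c * ((1 + d) * y + 2 * d)) + 2 * d <= c * y + d * M by lra.
have cy := mulr_ge0 c0 y0.
have dd : d ^+ 2 <= d by rewrite expr2 ler_piMl// ltW.
have e1 : d ^+ 2 * (c * y) <= d * (c * y) by rewrite ler_wpM2r.
have e2 : d ^+ 2 * c <= d * c by rewrite ler_wpM2r.
rewrite (_ : (1 + d) * (c * ((1 + d) * y + 2 * d)) + 2 * d = c * y +
  2 * (d * (c * y)) + d ^+ 2 * (c * y) + 2 * (d * c) + 2 * (d ^+ 2 * c) + 2 * d); last by ring.
rewrite (_ : d * M = 3 * (d * (c * y)) + 4 * (d * c) + 2 * d); last by rewrite /M; ring.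
by lra.
Qed.

(** Two inequalities, each passing through a step function that approximates [f] and [F] at once;
    the second is divided by [planch] to take the same form as the first. *)
Lemma plancherel f F : step_fourier f F -> sqnc F = planch R * sqn leb3 f.
Proof.
move=> [fL FL H].
have K0 := planch_gt0 R.
(* Accuracy e^2 and not e, because Young's inequality multiplies the error by 1 + 1/e. *)
have /choice[s sP] : forall e, exists s, 0 < e ->
    sqn leb3 (fun x => f x - step_fun s x) < e ^+ 2 /\
    sqnc (fun x => F x - step_hat s x) < e ^+ 2.
  move=> e; have [e0|e0] := ltP 0 e; last by exists [::].
  by have [s sP] := H _ (exprn_gt0 2 e0); exists s.
have small (e y : R) : 0 < e -> e <= 1 -> 0 <= y -> y < e ^+ 2 -> (1 + e^-1) * y <= 2 * e.
  move=> e0 e1 y0 ye; apply: (@le_trans _ _ ((1 + e^-1) * e ^+ 2)).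
    by rewrite ler_wpM2l ?ltW// addr_gt0 ?invr_gt0.
  rewrite mulrDl mul1r expr2 mulKf ?gt_eqF//.
  have : e * e <= e by rewrite ler_piMl// ltW.
  by lra.
have sL e := Lfun2_step (s e); have hL e := L2complex_step (s e).
apply/le_anti/andP; split.
  apply: (@ler_young_limit (fun=> 0) (fun e => sqn leb3 (step_fun (s e)))).
  - exact: ltW.
  - exact: sqn_ge0.
  - move=> e e0 e1; have [_ h] := sP _ e0.
    have := sqnc_young e0 (hL e) (L2complexB FL (hL e)).
    rewrite (_ : (fun x => _) = F); last by apply/funext => x; rewrite addrC subrK.
    rewrite plancherel_step => /le_trans; apply; rewrite lerD2l.
    exact: small (sqnc_ge0 _) h.
  - move=> e e0 e1; have [h _] := sP _ e0.
    have := sqn_young3 e0 fL (Lfun2B3 (sL e) fL).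
    rewrite (_ : (fun x => _) = step_fun (s e)); last by apply/funext => x; rewrite addrC subrK.
    move=> /le_trans; apply; rewrite lerD2l sqn_sym.
    exact: small (sqn_ge0 _ _) h.
rewrite mulrC -ler_pdivlMr// mulrC.
apply: (@ler_young_limit (fun=> 0) (fun e => sqnc (step_hat (s e)))).
- by rewrite invr_ge0 ltW.
- exact: sqnc_ge0.
- move=> e e0 e1; have [h _] := sP _ e0.
  rewrite plancherel_step mulKf ?gt_eqF//.
  have := sqn_young3 e0 (sL e) (Lfun2B3 fL (sL e)).
  rewrite (_ : (fun x => _) = f); last by apply/funext => x; rewrite addrC subrK.
  move=> /le_trans; apply; rewrite lerD2l.
  exact: small (sqn_ge0 _ _) h.
- move=> e e0 e1; have [_ h] := sP _ e0.
  have := sqnc_young e0 FL (L2complexB (hL e) FL).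
  rewrite (_ : (fun x => _) = step_hat (s e)); last by apply/funext => x; rewrite addrC subrK.
  move=> /le_trans; apply; rewrite lerD2l.
  rewrite (_ : sqnc _ = sqnc (fun x => F x - step_hat (s e) x)).
    exact: small (sqnc_ge0 _) h.
  apply: sqnc_normsqc; [exact: L2complexB | exact: L2complexB|].
  by move=> x; rewrite /normsqc !ReB !ImB; ring.
Qed.

End Plancherel.

(** * Fourier integrals of L^2 functions of bounded support *)

Section FourierIntegral.
Context (R : realType).
Local Notation R3 := (R3 R).
Local Notation mR := (measurableTypeR R).
Local Notation mR3 := (mR * mR * mR)%type.
Local Notation leb3 := (@leb3 R).
Local Notation L2 := (Lfun leb3 2%:E).
Local Notation box := ((R * R) * (R * R) * (R * R))%type.
Implicit Types (f g : R3 -> R) (F G : R3 -> R[i]) (Q : box).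

(** On a box L^2 embeds in L^1, here through |g| <= e + g^2 / e. With e = h and a square norm of at
    most h^2, the bound is of order h. *)
Lemma supported_integral_bound g Q (c : R3 -> R) (e : R) : g \in L2 ->
  (forall x, g x * box_ind Q x = g x) ->
  measurable_fun [set: mR3] c -> (forall x, `|c x| <= 1) -> 0 < e ->
  leb3.-integrable setT (EFin \o (fun x => g x * c x)) /\
  `|\int[leb3]_x (g x * c x)| <=
    e * \int[leb3]_x box_ind Q x + e^-1 * sqn leb3 g.
Proof.
move=> gL gQ mc c1 e0.
have h := has_intD (has_intZ e (has_int_Rintegral (integrable_box Q)))
  (has_intZ e^-1 (Lfun2_sqr3 gL)).
have le x : `|g x * c x| <= e * box_ind Q x + e^-1 * g x ^+ 2.
  rewrite normrM; apply: (@le_trans _ _ `|g x|); first by rewrite ler_piMr.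
  have := gQ x; have [->|->] := box_indB Q x; rewrite ?mulr0 => gE.
    by rewrite -gE normr0 add0r mulr_ge0 ?sqr_ge0// invr_ge0 ltW.
  rewrite mulr1 -subr_ge0 -(real_normK (num_real (g x))).
  set a := `|g x|.
  have -> : e + e^-1 * a ^+ 2 - a = e^-1 * ((a - e / 2) ^+ 2 + 3 / 4 * e ^+ 2).
    by field; rewrite gt_eqF.
  apply: mulr_ge0; first by rewrite invr_ge0 ltW.
  by have := sqr_ge0 (a - e / 2); have := sqr_ge0 e; lra.
have gi : leb3.-integrable setT (EFin \o (fun x => g x * c x)).
  have [hi _] := h; apply: (@integrable_dom _ _ _ leb3 _ _ _ le hi).
  by apply: measurable_funM => //; exact: Lfun_meas3 gL.
split => //; apply: (le_trans (le_normr_Rintegral measurableT gi)).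
have := @has_int_le _ _ _ leb3 (fun x => `|g x * c x|) _ _ _ le
  (has_int_Rintegral (integrable_norm gi)) h.
by [].
Qed.

Definition fourier_integral f (xi : R3) : R[i] :=
  (\int[leb3]_x (f x * cos (dot (coords x) (coords xi))))
  +i* (- \int[leb3]_x (f x * sin (dot (coords x) (coords xi)))).

Lemma measurable_dot (xi : R3) :
  measurable_fun [set: mR3] (fun x : mR3 => dot (coords x) (coords xi)).
Proof.
under eq_fun do rewrite dot3.
apply: measurable_funD; first apply: measurable_funD.
- by apply: measurable_funM => //; exact: measurable_fst3.
- by apply: measurable_funM => //; exact: measurable_snd3.
- by apply: measurable_funM => //; exact: measurable_snd.
Qed.

Lemma step_hat_integral s (xi : R3) : step_hat s xi = fourier_integral (step_fun s) xi.
Proof.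
have [h1 h2] := has_cint_step s xi.
have h1' : has_int leb3
    (fun x => step_fun s x * cos (dot (coords x) (coords xi)))
    (complex.Re (step_hat s xi)).
  by apply: (eq_has_int _ h1) => x /=; rewrite cosN sinN; ring.
have h2' : has_int leb3
    (fun x => step_fun s x * sin (dot (coords x) (coords xi)))
    (- 1 * complex.Im (step_hat s xi)).
  by apply: (eq_has_int _ (has_intZ (- 1) h2)) => x /=; rewrite cosN sinN; ring.
apply/eqP; rewrite eq_complex /= h1'.2 h2'.2 eqxx /=.
by apply/eqP; ring.
Qed.

(** Step functions supported in the same box converge to [f] in L^2, hence in L^1, so that their
    transforms converge pointwise to the Fourier integral. By Plancherel these transforms are also
    Cauchy in L^2, and Fatou's lemma identifies the L^2 limit with the pointwise one. *)
Lemma step_fourier_supported f Q : f \in L2 ->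
  (forall x, f x * box_ind Q x = f x) -> step_fourier f (fourier_integral f).
Proof.
move=> fL fQ.
pose h k : R := k.+1%:R^-1.
have h0 k : 0 < h k by rewrite invr_gt0.
have [_ fa] := approx_supported fL fQ.
have /choice[s' s'P] : forall k, exists s,
    sqn leb3 (fun x => f x - step_fun s x) < h k ^+ 2.
  by move=> k; apply: fa; rewrite exprn_gt0.
(* Clipping to [Q] does not increase the distance to [f], which vanishes outside [Q], and it makes
   the L^1 bound available. *)
pose s k := step_clip Q (s' k).
have sQ k x : step_fun (s k) x * box_ind Q x = step_fun (s k) x.
  by rewrite step_fun_clip -mulrA -expr2 box_ind_sqr.
have sP k : sqn leb3 (fun x => f x - step_fun (s k) x) <= h k ^+ 2.
  apply: le_trans (ltW (s'P k)); apply: sqn_mono.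
  - exact: Lfun2B3 (Lfun2_step _).
  - exact: Lfun2B3 (Lfun2_step _).
  - move=> x; rewrite -[in leLHS](fQ x) step_fun_clip -mulrBl exprMn box_ind_sqr.
    by rewrite ler_piMr ?sqr_ge0//; have [->|->] := box_indB Q x.
have conv (c : R3 -> R) : measurable_fun [set: mR3] c -> (forall x, `|c x| <= 1) ->
    \int[leb3]_x (step_fun (s k) x * c x) @[k --> \oo] -->
    \int[leb3]_x (f x * c x).
  move=> mc c1; pose V := \int[leb3]_x box_ind Q x.
  have bnd k : `|\int[leb3]_x (step_fun (s k) x * c x) -
      \int[leb3]_x (f x * c x)| <= (V + 1) * h k.
    have [fi _] := supported_integral_bound fL fQ mc c1 (h0 k).
    have [si _] := supported_integral_bound (Lfun2_step _) (sQ k) mc c1 (h0 k).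
    rewrite distrC.
    have DL := Lfun2B3 fL (Lfun2_step (s k)).
    have DQ x : (f x - step_fun (s k) x) * box_ind Q x = f x - step_fun (s k) x.
      by rewrite mulrBl fQ sQ.
    have [_ +] := supported_integral_bound DL DQ mc c1 (h0 k).
    rewrite (_ : \int[leb3]_x ((f x - step_fun (s k) x) * c x) =
      \int[leb3]_x (f x * c x) - \int[leb3]_x (step_fun (s k) x * c x)); last first.
      rewrite -RintegralB//; apply: eq_Rintegral => x _; exact: mulrBl.
    move=> /le_trans; apply; rewrite mulrDl mul1r [h k * _]mulrC lerD2l.
    rewrite mulrC ler_pdivrMr// -expr2; exact: sP.
  have lim0 : (V + 1) * h k @[k --> \oo] --> 0.
    rewrite -[X in _ --> X](mulr0 (V + 1)).
    by apply: cvgM; [exact: cvg_cst | exact: cvg_harmonic].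
  apply/cvgrPdist_le => e e0.
  move/cvgrPdist_le : lim0 => /(_ _ e0); apply: filterS => k.
  rewrite sub0r normrN => /(le_trans (ler_norm _)) hk.
  by rewrite distrC; exact: le_trans (bnd k) hk.
have mcos (xi : R3) : measurable_fun [set: mR3]
    (fun x : mR3 => cos (dot (coords x) (coords xi))).
  exact: measurable_cos_comp (measurable_dot xi).
have msin (xi : R3) : measurable_fun [set: mR3]
    (fun x : mR3 => sin (dot (coords x) (coords xi))).
  exact: measurable_sin_comp (measurable_dot xi).
have n1cos y : `|cos y : R| <= 1 by rewrite ler_norml cos_geN1 cos_le1.
have n1sin y : `|sin y : R| <= 1 by rewrite ler_norml sin_geN1 sin_le1.
have cRe xi : complex.Re (step_hat (s k) xi) @[k --> \oo] -->
    complex.Re (fourier_integral f xi).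
  under eq_fun do rewrite step_hat_integral /=.
  by apply: conv => // x; exact: n1cos.
have cIm xi : complex.Im (step_hat (s k) xi) @[k --> \oo] -->
    complex.Im (fourier_integral f xi).
  under eq_fun do rewrite step_hat_integral /=.
  by apply: cvgN; apply: conv => // x; exact: n1sin.
have mRe : measurable_fun [set: mR3] (fun xi => complex.Re (fourier_integral f xi)).
  apply: (@measurable_fun_cvg _ _ _ _ (fun k xi => complex.Re (step_hat (s k) xi))).
    by move=> k; have [] := cmeas_step_hat (s k).
  by move=> xi _; exact: cRe.
have mIm : measurable_fun [set: mR3] (fun xi => complex.Im (fourier_integral f xi)).
  apply: (@measurable_fun_cvg _ _ _ _ (fun k xi => complex.Im (step_hat (s k) xi))).
    by move=> k; have [] := cmeas_step_hat (s k).
  by move=> xi _; exact: cIm.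
have K0 := planch_gt0 R.
have Cauchy k l : (l <= k)%N -> sqnc (fun xi => step_hat (s k) xi - step_hat (s l) xi)
    <= planch R * (4 * h l ^+ 2).
  move=> lk.
  rewrite (_ : (fun xi => _) = step_hat (s k ++ step_scale (- 1) (s l))); last first.
    apply/funext => xi; rewrite step_hat_cat step_hat_scale.
    by rewrite (rmorphN1 (real_complex R)) mulN1r.
  rewrite plancherel_step ler_wpM2l ?(ltW K0)//.
  rewrite (_ : step_fun _ = fun x => step_fun (s k) x - step_fun (s l) x); last first.
    by apply/funext => x; rewrite step_fun_cat step_fun_scale mulN1r.
  have := sqn_dist3 (Lfun2_step (s k)) fL (Lfun2_step (s l)).
  rewrite [X in 2 * (X + _)]sqn_sym => /le_trans; apply.
  have hkl : h k ^+ 2 <= h l ^+ 2.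
    by rewrite /h ler_sqr ?nnegrE ?invr_ge0// lef_pV2 ?posrE// ler_nat.
  rewrite (_ : 4 * _ = 2 * (h l ^+ 2 + h l ^+ 2)); last by ring.
  by rewrite ler_wpM2l// lerD// (le_trans (sP k)).
have key l : L2complex (fun xi => fourier_integral f xi - step_hat (s l) xi) /\
    sqnc (fun xi => fourier_integral f xi - step_hat (s l) xi) <=
      2 * (planch R * (4 * h l ^+ 2)).
  pose D k xi := step_hat (s (k + l)%N) xi - step_hat (s l) xi.
  have DL k : L2complex (D k) by exact: L2complexB (L2complex_step _) (L2complex_step _).
  have DC k : sqnc (D k) <= planch R * (4 * h l ^+ 2) by apply: Cauchy; exact: leq_addl.
  have [m1 m2] := cmeas_step_hat (s l).
  have [|||L1 l1] := @sqn_fatou _ _ _ leb3 (fun k xi => complex.Re (D k xi))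
    (fun xi => complex.Re (fourier_integral f xi - step_hat (s l) xi))
    (planch R * (4 * h l ^+ 2)) (fun k => (DL k).1).
  - by under eq_fun do rewrite ReB; exact: measurable_funB.
  - apply: aeW => xi; rewrite ReB; under eq_fun do rewrite ReB.
    apply: cvgB; last exact: cvg_cst.
    have := cvg_shiftn l (fun k => complex.Re (step_hat (s k) xi))
      (nbhs (complex.Re (fourier_integral f xi))).
    by move=> /= ->; exact: cRe.
  - by move=> k; apply: le_trans (DC k); rewrite lerDl sqn_ge0.
  have [|||L2' l2] := @sqn_fatou _ _ _ leb3 (fun k xi => complex.Im (D k xi))
    (fun xi => complex.Im (fourier_integral f xi - step_hat (s l) xi))
    (planch R * (4 * h l ^+ 2)) (fun k => (DL k).2).
  - by under eq_fun do rewrite ImB; exact: measurable_funB.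
  - apply: aeW => xi; rewrite ImB; under eq_fun do rewrite ImB.
    apply: cvgB; last exact: cvg_cst.
    have := cvg_shiftn l (fun k => complex.Im (step_hat (s k) xi))
      (nbhs (complex.Im (fourier_integral f xi))).
    by move=> /= ->; exact: cIm.
  - by move=> k; apply: le_trans (DC k); rewrite lerDr sqn_ge0.
  by split => //; rewrite [leRHS]mulr_natl mulr2n; exact: lerD l1 l2.
split => //.
  have [kL _] := key 0%N.
  have := L2complexD kL (L2complex_step (s 0%N)).
  by under eq_fun do rewrite subrK.
move=> e e0.
(* One threshold for both errors, which are at most h^2 and 8 [planch] h^2, with h^2 <= h. *)
have [l lP] : exists l, (8 * planch R + 1) * h l < e.
  have M0 : 0 < 8 * planch R + 1 by rewrite addr_gt0// mulr_gt0.
  exists (Num.truncn ((8 * planch R + 1) / e)).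
  rewrite /h ltr_pdivrMr// [e * _]mulrC -ltr_pdivrMr//.
  exact: truncnS_gt.
have hl1 : h l <= 1 by rewrite invf_le1// ler1n.
have hl2 : h l ^+ 2 <= h l by rewrite expr2 ler_piMl// ltW.
exists (s l); split.
  apply: le_lt_trans (sP l) (le_lt_trans hl2 (le_lt_trans _ lP)).
  by rewrite mulrDl mul1r lerDr; apply: mulr_ge0; [apply: mulr_ge0|]; rewrite // ltW.
have [_ /le_lt_trans] := key l; apply; apply: le_lt_trans lP.
rewrite (_ : 2 * _ = 8 * planch R * h l ^+ 2); last by ring.
by rewrite [leRHS]mulrDl mul1r ler_wpDr ?(ltW (h0 l))// ler_wpM2l//; apply: mulr_ge0; rewrite // ltW.
Qed.

End FourierIntegral.

Section FourierL2.
Context (R : realType).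
Local Notation R3 := (R3 R).
Local Notation mR := (measurableTypeR R).
Local Notation mR3 := (mR * mR * mR)%type.
Local Notation leb3 := (@leb3 R).
Local Notation L2 := (Lfun leb3 2%:E).

Lemma normc_sqr (z : R[i]) : normc z ^+ 2 = normsqc z.
Proof. by case: z => a b; rewrite /normc /normsqc sqr_sqrtr// addr_ge0 ?sqr_ge0. Qed.

(** The truncations to balls have bounded support, so their Fourier integrals are transforms in the
    sense of [step_fourier]. They converge to [f] by dominated convergence, and their transforms to
    [F] by the definition of [fourierL2]. *)
Lemma fourierL2_step_fourier (f : R3 -> R) F : fourierL2 f F -> step_fourier f F.
Proof.
move=> [fL FL FN].
pose r2 (x : R3) := dot (coords x) (coords x).
pose chi n (x : R3) : R := (r2 x <= n%:R ^+ 2)%R%:R.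
pose fn n x := f x * chi n x.
have mr2 : measurable_fun [set: mR3] (r2 : mR3 -> R).
  rewrite /r2; under eq_fun do rewrite dot3.
  apply: measurable_funD; first apply: measurable_funD.
  - by apply: measurable_funM; exact: measurable_fst3.
  - by apply: measurable_funM; exact: measurable_snd3.
  - by apply: measurable_funM; exact: measurable_snd.
pose B n : set mR3 := [set x | r2 x <= n%:R ^+ 2].
have mB n : measurable (B n).
  have -> : B n = r2 @^-1` `]-oo, n%:R ^+ 2]%classic.
    by apply/seteqP; split => x; rewrite /= in_itv.
  by rewrite -[X in measurable X]setTI; exact: mr2.
have chiE n : chi n = \1_(B n).
  apply/funext => x; rewrite /chi indicE; congr (nat_of_bool _)%:R.
  by apply/idP/idP => [|/[!inE]//]; rewrite inE.
have mchi n : measurable_fun [set: mR3] (chi n).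
  by rewrite chiE; exact: measurable_indic.
have chi01 n x : chi n x ^+ 2 <= 1.
  by rewrite /chi; case: (r2 x <= _); rewrite ?expr1n ?expr0n.
have fnL n : fn n \in L2.
  have [fi _] := Lfun2_sqr3 fL; apply: (Lfun2_dom _ _ fi).
    by apply: measurable_funM => //; exact: Lfun_meas3 fL.
  by move=> x; rewrite exprMn ler_piMr ?sqr_ge0.
(* The left endpoint is -(n + 1) because the interval is open on the left and has to contain -n. *)
pose I n : R * R := (- (n.+1%:R), n%:R).
have fnQ n x : fn n x * box_ind (I n, I n, I n) x = fn n x.
  rewrite /fn /chi; have [h|_] /= := boolP (r2 x <= n%:R ^+ 2); last by rewrite mulr0 mul0r.
  suff -> : box_ind (I n, I n, I n) x = 1 by rewrite mulr1.
  have n0 : 0 <= n%:R :> R by [].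
  have K y : y ^+ 2 <= n%:R ^+ 2 -> ind (I n) y = 1.
    rewrite -[y ^+ 2]real_normK ?num_real// ler_sqr ?nnegrE// ler_norml.
    move=> /andP[y1 y2]; rewrite /ind /I /= y2 andbT.
    by rewrite (_ : - n.+1%:R < y)// -natr1; lra.
  move: h; rewrite /r2 dot3 -!expr2 => h.
  have h1 := sqr_ge0 x.1.1; have h2 := sqr_ge0 x.1.2; have h3 := sqr_ge0 x.2.
  by rewrite /box_ind !ind_bnd !K ?mulr1//; lra.
have fbE n xi : fourier_ball f n xi = fourier_integral (fn n) xi.
  have E (c : R3 -> R) : \int[leb3]_(x in B n) (f x * c x) =
      \int[leb3]_x (fn n x * c x).
    rewrite Rintegral_mkcond; apply: eq_Rintegral => x _.
    rewrite /fn chiE patchE indicE; case: ifP => _; first by rewrite mulr1.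
    by rewrite mulr0 mul0r.
  by rewrite /fourier_ball /fourier_integral -!E.
have fnF n : step_fourier (fn n) (fun xi => fourier_ball f n xi).
  apply: (eq_step_fourier (frefl _) _ (step_fourier_supported (fnL n) (fnQ n))).
  by move=> xi; rewrite fbE.
apply: step_fourier_lim => // e e0.
have [N1 N1P] : exists N, forall n, (N <= n)%N ->
    sqn leb3 (fun x => f x - fn n x) < e.
  have [fi _] := Lfun2_sqr3 fL.
  apply: (sqn_dominated _ _ _ fi) => //.
  - by move=> n; exact: measurable_funB (Lfun_meas3 fL) (Lfun_meas3 (fnL n)).
  - move=> x; apply: cvg_near_cst.
    exists (Num.truncn (r2 x)).+1 => // n /= nx.
    rewrite /fn /chi (_ : r2 x <= n%:R ^+ 2) ?mulr1 ?subrr//.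
    have h1 : r2 x <= n%:R.
      apply: ltW; apply: (lt_le_trans (truncnS_gt _)).
      by rewrite ler_nat.
    apply: (le_trans h1); rewrite -natrX ler_nat -[leqLHS]expn1 leq_pexp2l//.
    exact: leq_trans nx.
  - move=> n x; rewrite /fn /chi; case: (r2 x <= _).
      by rewrite mulr1 subrr expr0n/= sqr_ge0.
    by rewrite mulr0 subr0.
(* [fourierL2] controls the norm and [sqnc] is its square: d^2 <= d < e. *)
pose d := Num.min 1 (e / 2).
have d0 : 0 < d by rewrite lt_min ltr01 divr_gt0.
have d1 : d <= 1 by rewrite ge_min lexx.
have de : d <= e / 2 by rewrite ge_min lexx orbT.
have d0' : (0 < d%:E)%E by rewrite lte_fin.
have [N2 _ N2P] : \forall n \near \oo,
   ('N[leb3]_2%:E[(fun xi => (normc (fourier_ball f n xi - F xi))%:E)] < d%:E)%E.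
  have := FN; move=> /fine_cvgP[ffin].
  move=> /(@cvgr_lt _ _ _ _) /(_ d d0); apply: filterS2 ffin => n nf /=.
  by rewrite -lte_fin fineK.
pose n := maxn N1 N2.
exists (fn n), (fun xi => fourier_ball f n xi); split => //.
  by apply: N1P; rewrite leq_maxl.
have [_ FnL _] := fnF n.
have GL := L2complexB FnL FL.
rewrite (_ : sqnc _ = sqnc (fun xi => fourier_ball f n xi - F xi)); last first.
  apply: sqnc_normsqc => //; first exact: L2complexB.
  by move=> x; rewrite /normsqc !ReB !ImB; ring.
have hE : ((sqnc (fun xi => fourier_ball f n xi - F xi))%:E =
  'N[leb3]_2%:E[(fun xi => (normc (fourier_ball f n xi - F xi))%:E)] `^ 2)%E.
  rewrite poweR_Lnorm// -(has_intE (L2complex_normsqc GL)).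
  apply: eq_integral => xi _ /=.
  by rewrite powR_mulrn// real_normK ?num_real// normc_sqr.
have : ((sqnc (fun xi => fourier_ball f n xi - F xi))%:E <= (d ^+ 2)%:E)%E.
  rewrite hE; have /N2P /ltW hn : (N2 <= n)%N by rewrite leq_maxr.
  have hd : (d%:E `^ 2 = (d ^+ 2)%:E)%E by rewrite poweR_EFin powR_mulrn// ltW.
  rewrite -hd; apply: gt0_ler_poweR => //.
  - by rewrite in_itv/= leey Lnorm_ge0.
  - by rewrite in_itv/= leey andbT lee_fin ltW.
rewrite lee_fin => /le_lt_trans; apply.
have : d ^+ 2 <= d by rewrite expr2 ler_piMl// ltW.
by lra.
Qed.

End FourierL2.

(** * Weak derivatives *)

Section TestFunctions.
Context (R : realType).
Local Notation R3 := (R3 R).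
Local Notation mR := (measurableTypeR R).
Local Notation mR3 := (mR * mR * mR)%type.
Local Notation leb3 := (@leb3 R).
Local Notation L2 := (Lfun leb3 2%:E).
Local Notation box := ((R * R) * (R * R) * (R * R))%type.
Implicit Types (phi : R3 -> R) (x v : R3) (j : 'I_3).

Definition rat_cell (t : (rat * rat * rat * nat)%type) : set mR3 :=
  (`]ratr t.1.1.1 - t.2.+1%:R^-1, ratr t.1.1.1 + t.2.+1%:R^-1[ `*`
   `]ratr t.1.1.2 - t.2.+1%:R^-1, ratr t.1.1.2 + t.2.+1%:R^-1[) `*`
   `]ratr t.1.2 - t.2.+1%:R^-1, ratr t.1.2 + t.2.+1%:R^-1[.

(** The measurable structure is generated by rectangles, not by open sets; an open set is the union
    of the rational cubes that it contains, which are countably many. *)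
Lemma open_measurable3 (U : set R3) : open U -> measurable (U : set mR3).
Proof.
move=> oU.
have -> : U = \bigcup_t [set x | rat_cell t `<=` U /\ rat_cell t x].
  apply/seteqP; split => [x Ux|x [t _ [tU tx]]]; last exact: tU.
  have /nbhs_ballP[e /= e0 xe] : nbhs x U by exact: open_nbhs_nbhs.
  (* The half-side d is below e / 2: the center of the cube is within d of x and its points within d
     of the center, so that the cube lies in the ball of radius e. *)
  pose n := Num.truncn (2 / e).
  have ne : n.+1%:R^-1 < e / 2.
    by rewrite -(invf_div 2 e) ltf_pV2 ?posrE ?divr_gt0// truncnS_gt.
  have n0 : 0 < n.+1%:R^-1 :> R by rewrite invr_gt0.
  set d : R := n.+1%:R^-1 in ne n0.
  have q (y : R) : exists q : rat, y - d < ratr q < y + d.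
    have lt : y - d < y + d by lra.
    by have [q] := rat_in_itvoo lt; rewrite in_itv/= => qP; exists q.
  have [q1 /andP[a1 b1]] := q x.1.1; have [q2 /andP[a2 b2]] := q x.1.2.
  have [q3 /andP[a3 b3]] := q x.2.
  exists (q1, q2, q3, n) => //; rewrite /rat_cell /= -/d; split.
    move=> [[y1 y2] y3] /=; rewrite !in_itv/= => -[[/andP[c1 d1] /andP[c2 d2]] /andP[c3 d3]].
    apply: xe; split => /=; [split => /=|]; rewrite /ball/= ltr_distl;
      apply/andP; split; lra.
  by rewrite !in_itv/=; split; [split|]; apply/andP; split; lra.
apply: countable_bigcupT_measurable => [|t]; first exact: countableP.
have mt : measurable (rat_cell t) by do 2!apply: measurableX => //.
have [tU|ntU] := pselect (rat_cell t `<=` U).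
  rewrite (_ : [set x | _] = rat_cell t)//.
  by apply/seteqP; split => x //= [].
rewrite (_ : [set x | _] = set0)//.
by apply/seteqP; split => x //= [].
Qed.

Lemma continuous_measurable3 phi : continuous phi ->
  measurable_fun [set: mR3] phi.
Proof.
move=> cphi; apply: (measurability _ (RGenOInfty.measurableE R)) => //.
move=> _ [_ [y ->] <-]; rewrite setTI; apply: open_measurable3.
move/continuousP : cphi; apply.
exact: rray_open.
Qed.

Lemma dot_scale (h : R) v x :
  dot (coords (h *: v)) (coords x) = h * dot (coords v) (coords x).
Proof. by rewrite !dot3 /= /GRing.scale/=; ring. Qed.

Lemma dot_basis3 j x : dot (coords (basis3 R j)) (coords x) = coords x 0 j.
Proof.
rewrite dot3 /basis3 /= !mxE.
by case: j => -[|[|[|j]]] // jlt /=; ring.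
Qed.

Lemma norm_coords x : [/\ `|x.1.1| <= `|x|, `|x.1.2| <= `|x| & `|x.2| <= `|x|].
Proof.
have h1 : `|x.1| <= `|x| by rewrite prod_normE /= le_max lexx.
have h2 : `|x.1.1| <= `|x.1| by rewrite prod_normE /= le_max lexx.
have h3 : `|x.1.2| <= `|x.1| by rewrite prod_normE /= le_max lexx orbT.
by split; [exact: le_trans h1 | exact: le_trans h1 | rewrite prod_normE /= le_max lexx orbT].
Qed.

Definition cube (B : R) : box := ((- B, B), (- B, B), (- B, B)).

Lemma cube_ind (B : R) x : `|x| < B -> box_ind (cube B) x = 1.
Proof.
move=> xB; have [h1 h2 h3] := norm_coords x.
have K (y : R) : `|y| <= `|x| -> ind (- B, B) y = 1.
  move=> yx; have := le_lt_trans yx xB; rewrite ltr_norml => /andP[y1 y2].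
  by rewrite /ind /= y1 ltW.
by rewrite /box_ind !ind_bnd !K// !mulr1.
Qed.

Lemma closed_support_out phi x :
  ~ closure [set x | phi x != 0] x -> \forall y \near x, phi y = 0.
Proof.
move=> nx; have oc : open (~` closure [set x | phi x != 0]).
  exact/closed_openC/closed_closure.
have : nbhs x (~` closure [set x | phi x != 0]) by exact: open_nbhs_nbhs.
apply: filterS => y ny; apply: contrapT => /eqP y0; apply: ny.
exact: subset_closure.
Qed.

Lemma continuous_partial j phi : smooth phi -> continuous (partial j phi).
Proof.
by move=> sphi x; apply: differentiable_continuous; exact: (sphi [:: j] x).
Qed.

Lemma continuous_test phi : smooth phi -> continuous phi.
Proof. by move=> sphi x; apply: differentiable_continuous; exact: (sphi [::] x). Qed.

Lemma partial_out j phi x :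
  ~ closure [set x | phi x != 0] x -> partial j phi x = 0.
Proof.
move=> /closed_support_out nx; rewrite /partial.
rewrite (near_eq_derive (g := cst 0))//.
exact: derive_cst.
Qed.

Lemma bounded_on_compact (K : set R3) (psi : R3 -> R) : compact K -> continuous psi ->
  (forall x, ~ K x -> psi x = 0) -> exists M : R, forall x, `|psi x| <= M.
Proof.
move=> cK cpsi psi0.
have /compact_bounded [M [_ MP]] : compact (psi @` K).
  by apply: continuous_compact => //; exact: continuous_subspaceT.
exists (Num.max M 0 + 1) => x.
have [Kx|nKx] := pselect (K x).
  apply: (MP (Num.max M 0 + 1)); last by exists x.
  by rewrite (@le_lt_trans _ _ (Num.max M 0))// ?le_max ?lexx// ltrDl.
by rewrite psi0// normr0 addr_ge0// le_max lexx orbT.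
Qed.

Lemma test_function_bounds j phi : test_function phi ->
  exists M B : R, [/\ forall x, `|phi x| <= M,
    forall x, `|partial j phi x| <= M &
    forall x, B < `|x| -> phi x = 0 /\ partial j phi x = 0].
Proof.
move=> [sphi cK].
have phi0 x : ~ closure [set x | phi x != 0] x -> phi x = 0.
  by move=> /closed_support_out /nbhs_singleton.
have [M1 M1P] := bounded_on_compact cK (continuous_test sphi) phi0.
have [M2 M2P] := bounded_on_compact cK (@continuous_partial j phi sphi) (@partial_out j phi).
have [B [_ BP]] := compact_bounded cK.
exists (Num.max M1 M2), (Num.max B 0 + 1); split => x.
- by rewrite le_max M1P.
- by rewrite le_max M2P orbT.
- move=> xB; have nx : ~ closure [set x | phi x != 0] x.
    have Bm : B < Num.max B 0 + 1.
      by rewrite (@le_lt_trans _ _ (Num.max B 0))// ?le_max ?lexx// ltrDl.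
    by move=> Kx; have := BP _ Bm x Kx; rewrite /= leNgt xB.
  by split; [exact: phi0 | exact: partial_out].
Qed.

Lemma is_derive_line phi v x (t : R) : differentiable phi (t *: v + x) ->
  is_derive t 1 (fun t : R => phi (t *: v + x)) ('D_v phi (t *: v + x)).
Proof.
move=> dphi; pose p (t : R) := phi (t *: v + x).
have E : (fun h : R => h^-1 *: ((p \o shift t) (h *: 1) - p t)) =
    (fun h : R => h^-1 *: ((phi \o shift (t *: v + x)) (h *: v) - phi (t *: v + x))).
  apply/funext => h; rewrite /p /= /shift.
  by rewrite [h *: 1]mulr1 scalerDl addrA.
apply: DeriveDef.
  rewrite /derivable; have := diff_derivable (v := v) dphi.
  by rewrite /derivable -E.
by rewrite /derive -E.
Qed.

(** The mean value theorem on [-h, 0] along the line through x; the bound is uniform in h and serves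
    as domination. *)
Lemma line_quotient_bound phi v x (M h : R) : (forall y, differentiable phi y) ->
  (forall y, `|'D_v phi y| <= M) -> 0 < h ->
  `|h^-1 * (phi (x - h *: v) - phi x)| <= M.
Proof.
move=> dphi DM h0.
have Nh : - h < 0 by lra.
have [|c _] := @MVT R (fun t : R => phi (t *: v + x))
    (fun t : R => 'D_v phi (t *: v + x)) _ _ Nh (fun t _ => is_derive_line (dphi _)).
  apply: derivable_within_continuous => t _.
  by have [] := is_derive_line (dphi (t *: v + x)).
rewrite scale0r add0r scaleNr [- _ + x]addrC opprK => E.
have -> : phi (x - h *: v) - phi x = - ('D_v phi (c *: v + x) * h).
  by rewrite -opprB E add0r.
rewrite mulrN normrN mulrCA mulVf ?gt_eqF// mulr1; exact: DM.
Qed.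

Lemma cvg_line_quotient phi v x : differentiable phi x ->
  (n.+1%:R^-1)^-1 * (phi (x - n.+1%:R^-1 *: v) - phi x) @[n --> \oo] -->
  - 'D_v phi x.
Proof.
move=> dphi; pose h n : R := - n.+1%:R^-1.
have h0 : h n @[n --> \oo] --> 0^'.
  have : h n @[n --> \oo] --> 0.
    by rewrite -oppr0; apply: cvgN; exact: cvg_harmonic.
  move=> hc; apply: cvg_trans (_ : _ --> within [set y | y != 0] (nbhs 0)); last by [].
  move=> A A0; have H : \forall n \near \oo, h n != 0 -> A (h n) by exact: (hc _ A0).
  have H' : \forall n \near \oo, A (h n).
    by apply: filterS H => n; apply; rewrite /h oppr_eq0 invr_eq0 pnatr_eq0.
  exact: H'.
have := diff_derivable (v := v) dphi; rewrite /derivable => Dc.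
have D : (fun t : R => t^-1 *: ((phi \o shift x) (t *: v) - phi x)) t @[t --> 0^'] -->
    'D_v phi x by exact: Dc.
have := cvg_comp _ _ h0 D => /cvgN; apply: cvg_trans; apply: near_eq_cvg.
apply: nearW => n.
change (- ((h n)^-1 *: (phi (h n *: v + x) - phi x)) =
  (n.+1%:R^-1)^-1 * (phi (x - n.+1%:R^-1 *: v) - phi x)).
by rewrite /h scaleNr [- _ + x]addrC invrN /GRing.scale/= mulNr opprK.
Qed.

End TestFunctions.

Section WeakDerivative.
Context (R : realType).
Local Notation R3 := (R3 R).
Local Notation mR := (measurableTypeR R).
Local Notation mR3 := (mR * mR * mR)%type.
Local Notation leb3 := (@leb3 R).
Local Notation L2 := (Lfun leb3 2%:E).
Implicit Types (f g phi : R3 -> R) (F : R3 -> R[i]) (j : 'I_3).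

(** A weighted form of Cauchy-Schwarz: the weight is chosen according to which factor is small. *)
Lemma integral_mul_bound f g (e : R) : f \in L2 -> g \in L2 -> 0 < e ->
  `|\int[leb3]_x (f x * g x)| <= e * sqn leb3 f + e^-1 * sqn leb3 g.
Proof.
move=> fL gL e0; have fg := Lfun2_mul fL gL.
apply: (le_trans (le_normr_Rintegral measurableT fg)).
have le x : `|f x * g x| <= e * f x ^+ 2 + e^-1 * g x ^+ 2.
  rewrite normrM -subr_ge0 -(real_normK (num_real (f x))) -(real_normK (num_real (g x))).
  set a := `|f x|; set b := `|g x|.
  have -> : e * a ^+ 2 + e^-1 * b ^+ 2 - a * b =
    e^-1 * ((e * a - b / 2) ^+ 2 + 3 / 4 * b ^+ 2) by field; rewrite gt_eqF.
  apply: mulr_ge0; first by rewrite invr_ge0 ltW.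
  by have := sqr_ge0 (e * a - b / 2); have := sqr_ge0 b; lra.
exact: (@has_int_le _ _ _ leb3 (fun x => `|f x * g x|) _ _ _ le
  (has_int_Rintegral (integrable_norm fg))
  (has_intD (has_intZ e (Lfun2_sqr3 fL)) (has_intZ e^-1 (Lfun2_sqr3 gL)))).
Qed.

Lemma Lfun2_bounded_supported (psi : R3 -> R) (M B : R) :
  measurable_fun [set: mR3] psi -> (forall x, `|psi x| <= M) ->
  (forall x, B <= `|x| -> psi x = 0) ->
  (forall x, psi x ^+ 2 <= M ^+ 2 * box_ind (cube B) x) /\ psi \in L2.
Proof.
move=> mpsi psiM psi0.
have M0 : 0 <= M := le_trans (normr_ge0 _) (psiM 0).
have le x : psi x ^+ 2 <= M ^+ 2 * box_ind (cube B) x.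
  have [xB|xB] := leP B `|x|.
    by rewrite psi0// expr0n/= mulr_ge0 ?sqr_ge0 ?box_ind_ge0.
  rewrite cube_ind// mulr1 -[leLHS](real_normK (num_real _)).
  by rewrite ler_sqr ?nnegrE.
split => //; apply: (Lfun2_dom mpsi le).
by have [] := has_intZ (M ^+ 2) (has_int_Rintegral (integrable_box (cube B))).
Qed.

Let h n : R := n.+1%:R^-1.
Let h_gt0 n : 0 < h n. Proof. by rewrite invr_gt0. Qed.
Let h_le1 n : h n <= 1. Proof. by rewrite invf_le1// ler1n. Qed.

Definition dquot j f n x : R := (h n)^-1 * (f (x + h n *: basis3 R j) - f x).

Lemma norm_basis3 j : `|basis3 R j| <= 1.
Proof.
rewrite /basis3 !prod_normE /= !ge_max.
have H (b : bool) : `|b%:R : R| <= 1 by case: b; rewrite ?normr0 ?normr1.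
by rewrite !H.
Qed.

Lemma dquot_Lfun2 j f n : f \in L2 -> dquot j f n \in L2.
Proof.
by move=> fL; apply: (@Lfun2Z _ _ _ leb3); apply: (@Lfun2B _ _ _ leb3) => //;
  exact: Lfun2_translate.
Qed.

(** Discrete integration by parts, from the translation invariance of the integral. *)
Lemma dquot_adjoint j f phi n : f \in L2 -> phi \in L2 ->
  \int[leb3]_x (dquot j f n x * phi x) =
  \int[leb3]_x (f x * ((h n)^-1 * (phi (x - h n *: basis3 R j) - phi x))).
Proof.
move=> fL phiL; set v := h n *: basis3 R j.
have i1 := Lfun2_mul3 (Lfun2_translate v fL) phiL.
have i2 := Lfun2_mul3 fL phiL.
have i3 := Lfun2_mul3 fL (Lfun2_translate (- v) phiL).
have i13 := has_int_translate (- v) i1.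
have E : (fun x => f (x - v + v) * phi (x - v)) = fun x => f x * phi (x - v).
  by apply/funext => x; rewrite subrK.
rewrite E in i13; have e13 := has_int_unique i13 i3.
have A : has_int leb3 (fun x => dquot j f n x * phi x)
    ((h n)^-1 * (\int[leb3]_x (f (x + v) * phi x) - \int[leb3]_x (f x * phi x))).
  by apply: (eq_has_int _ (has_intZ (h n)^-1 (has_intB i1 i2))) => x;
    rewrite /dquot -/v; ring.
have B : has_int leb3 (fun x => f x * ((h n)^-1 * (phi (x - v) - phi x)))
    ((h n)^-1 * (\int[leb3]_x (f x * phi (x - v)) - \int[leb3]_x (f x * phi x))).
  by apply: (eq_has_int _ (has_intZ (h n)^-1 (has_intB i3 i2))) => x; ring.
by rewrite A.2 B.2 e13.
Qed.

Lemma ler_split_bound (e a b p q u v t : R) : a <= e * p + u -> b <= v + e * q ->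
  u <= e -> v <= e -> t <= a + b -> t <= e * (p + q + 2).
Proof. by move=> h1 h2 h3 h4 h5; rewrite !mulrDr; lra. Qed.

(** Let psi_n be the backward quotient of phi, which tends to minus its partial derivative. By
    [dquot_adjoint], the sum of the two integrals to be compared equals that of f (psi_n + partial
    phi) plus that of (g - dquot f) phi, and both tend to 0. *)
Lemma dquot_limit_weak j f g : f \in L2 -> g \in L2 ->
  (forall e, 0 < e -> exists N, forall n, (N <= n)%N ->
    sqn leb3 (fun x => g x - dquot j f n x) <= e) ->
  forall phi, test_function phi ->
  \int[leb3]_x (f x * partial j phi x) = - \int[leb3]_x (g x * phi x).
Proof.
move=> fL gL gf phi tphi; have [sphi _] := tphi.
have [M [B [phiM dM out]]] := test_function_bounds j tphi.
have dphi y : differentiable phi y := sphi [::] y.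
have mphi := continuous_measurable3 (continuous_test sphi).
have mdphi := continuous_measurable3 (@continuous_partial _ j phi sphi).
(* The margin 2 absorbs a translation by a vector of norm at most 1: the translated point is still
   beyond [B]. *)
have out1 (x : R3) : B + 2 <= `|x| -> B < `|x| by lra.
have [_ phiL] := Lfun2_bounded_supported mphi phiM
  (fun x xB => (out x (out1 x xB)).1).
have [_ dphiL] := Lfun2_bounded_supported mdphi dM
  (fun x xB => (out x (out1 x xB)).2).
pose psi n x := (h n)^-1 * (phi (x - h n *: basis3 R j) - phi x).
have psiL n : psi n \in L2.
  by apply: (@Lfun2Z _ _ _ leb3); apply: (@Lfun2B _ _ _ leb3) => //;
    exact: Lfun2_translate.
have psiM n x : `|psi n x| <= M by exact: line_quotient_bound.
have psi0 n x : B + 2 <= `|x| -> psi n x = 0.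
  move=> xB; rewrite /psi (out x (out1 x xB)).1.
  rewrite (out _ _).1 ?subrr ?mulr0//.
  have hv : `|h n *: basis3 R j| <= 1.
    rewrite normrZ gtr0_norm// -[leRHS]mulr1.
    by apply: ler_pM => //; [exact: ltW | exact: norm_basis3].
  have := lerB_dist x (h n *: basis3 R j); lra.
have mdiff n : measurable_fun [set: mR3] (fun x : mR3 => psi n x + partial j phi x).
  exact: measurable_funD (Lfun_meas3 (psiL n)) mdphi.
have diffM n x : `|psi n x + partial j phi x| <= 2 * M.
  by apply: (le_trans (ler_normD _ _)); have := psiM n x; have := dM x; lra.
have diff0 n x : B + 2 <= `|x| -> psi n x + partial j phi x = 0.
  by move=> xB; rewrite psi0// (out x (out1 x xB)).2 addr0.
have conv e : 0 < e -> exists N, forall n, (N <= n)%N ->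
    sqn leb3 (fun x => psi n x + partial j phi x) < e.
  apply: (@sqn_dominated _ _ _ leb3 (fun n x => psi n x + partial j phi x)
    (fun x => (2 * M) ^+ 2 * box_ind (cube (B + 2)) x)).
  - exact: mdiff.
  - move=> x; rewrite -(addNr (partial j phi x)).
    by apply: cvgD; [exact: cvg_line_quotient | exact: cvg_cst].
  - by move=> n x; have [] := Lfun2_bounded_supported (mdiff n) (diffM n) (diff0 n).
  - by have [] := has_intZ ((2 * M) ^+ 2)
      (has_int_Rintegral (integrable_box (cube (B + 2)))).
set X := \int[leb3]_x (f x * partial j phi x).
set Y := \int[leb3]_x (g x * phi x).
pose C := sqn leb3 f + sqn leb3 phi + 2.
have C0 : 0 < C by rewrite /C ltr_wpDl// addr_ge0 ?sqn_ge0.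
(* Both small factors are taken of square norm at most e^2 and weighted by 1/e, their partners by
   e. *)
have key e : 0 < e -> `|X + Y| <= e * C.
  move=> e0.
  have [N1 N1P] := conv _ (exprn_gt0 2 e0).
  have [N2 N2P] := gf _ (exprn_gt0 2 e0).
  pose n := maxn N1 N2.
  have P1 := N1P n (leq_maxl _ _); have P2 := N2P n (leq_maxr _ _).
  have dL := dquot_Lfun2 j n fL.
  have sL : (fun x => psi n x + partial j phi x) \in L2 by exact: Lfun2D.
  have gdL : (fun x => g x - dquot j f n x) \in L2 by exact: Lfun2B3.
  have B1 := integral_mul_bound fL sL e0.
  have einv : 0 < e^-1 by rewrite invr_gt0.
  have B2 := integral_mul_bound gdL phiL einv; rewrite invrK in B2.
  have I1 : has_int leb3 (fun x => f x * (psi n x + partial j phi x))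
      (\int[leb3]_x (f x * psi n x) + X).
    apply: (eq_has_int _ (has_intD (Lfun2_mul3 fL (psiL n))
      (Lfun2_mul3 fL dphiL))) => x.
    by rewrite mulrDr.
  have I2 : has_int leb3 (fun x => (g x - dquot j f n x) * phi x)
      (Y - \int[leb3]_x (f x * psi n x)).
    rewrite -(dquot_adjoint j n fL phiL).
    apply: (eq_has_int _ (has_intB (Lfun2_mul3 gL phiL)
      (Lfun2_mul3 dL phiL))) => x.
    by rewrite mulrBl.
  rewrite I1.2 in B1; rewrite I2.2 in B2.
  have E1 : e^-1 * sqn leb3 (fun x => psi n x + partial j phi x) <= e.
    by rewrite mulrC ler_pdivrMr// -expr2 ltW.
  have E2 : e^-1 * sqn leb3 (fun x => g x - dquot j f n x) <= e.
    by rewrite mulrC ler_pdivrMr// -expr2.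
  have := ler_normD (\int[leb3]_x (f x * psi n x) + X)
    (Y - \int[leb3]_x (f x * psi n x)).
  rewrite (_ : _ + _ + _ = X + Y); last by ring.
  exact: ler_split_bound B1 B2 E1 E2.
apply/eqP; rewrite -subr_eq0 opprK -normr_le0; apply/ler_addgt0Pl => e e0.
rewrite addr0; have := key _ (divr_gt0 e0 C0).
by rewrite divfK// gt_eqF.
Qed.

Lemma norm_sin_sub_le (t : R) : `|sin t - t| <= `|t| ^+ 3.
Proof.
wlog t0 : t / 0 < t => [H|].
  have [t0|t0|->] := ltgtP t 0; last by rewrite sin0 subrr normr0 expr0n.
    have Nt0 : 0 < - t by lra.
    by have := H _ Nt0; rewrite sinN -opprD !normrN.
  exact: H.
have [|c] := @MVT R sin cos 0 t t0 (fun z _ => is_derive_sin z).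
  by apply: continuous_subspaceT => z; exact: continuous_sin.
rewrite in_itv/= => /andP[c0 ct]; rewrite sin0 !subr0 => ->.
rewrite -{2}[t]mul1r -mulrBl normrM exprSr ler_wpM2r//.
rewrite -normrN opprB ger0_norm ?subr_ge0 ?cos_le1//.
apply: (le_trans (onem_cos_le c)); rewrite real_normK ?num_real//.
have : c ^+ 2 <= t ^+ 2 by rewrite ler_sqr ?nnegrE ?ltW.
by have := sqr_ge0 t; lra.
Qed.

(** The multiplier (e^(i h y) - 1) / h of the forward difference quotient of step h. *)
Let mult n (y : R) : R[i] := ((h n)^-1 * (cos (h n * y) - 1)) +i*
  ((h n)^-1 * sin (h n * y)).

Let multE n y : (h n)^-1%:C * (cis (h n * y) - 1) = mult n y.
Proof.
apply/eqP; rewrite eq_complex /=; apply/andP; split; apply/eqP; ring.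
Qed.

Let mult_le n y : normsqc (mult n y) <= y ^+ 2.
Proof.
rewrite /normsqc /= !exprMn -mulrDr.
have -> : (cos (h n * y) - 1) ^+ 2 + sin (h n * y) ^+ 2 = 2 * (1 - cos (h n * y)).
  by have := cos2Dsin2 (h n * y); lra.
have h0 := h_gt0 n.
rewrite exprVn mulrC ler_pdivrMr ?exprn_gt0//.
have := onem_cos_le (h n * y); rewrite exprMn; lra.
Qed.

(** The real part is at most h y^2 / 2 and the error of the imaginary part at most h |y|^3. The
    polynomial is crude on purpose: only the limit at fixed y matters. *)
Let mult_lim n y : normsqc (mult n y - (0 +i* y)) <=
  (h n * (1 + y ^+ 4 + y ^+ 6)) ^+ 2.
Proof.
have h0 := h_gt0 n; have h1 := h_le1 n.
rewrite /normsqc /= subr0.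
have A : ((h n)^-1 * (cos (h n * y) - 1)) ^+ 2 <= (h n * (y ^+ 2 / 2)) ^+ 2.
  rewrite -sqrrN -mulrN opprB ler_sqr ?nnegrE.
  - rewrite mulrC ler_pdivrMr//.
    have := onem_cos_le (h n * y); rewrite exprMn.
    by have -> : h n * (y ^+ 2 / 2) * h n = h n ^+ 2 * y ^+ 2 / 2 by ring.
  - apply: mulr_ge0; first by rewrite invr_ge0 ltW.
    by rewrite subr_ge0 cos_le1.
  - by rewrite mulr_ge0 ?(ltW h0)// mulr_ge0 ?sqr_ge0.
have B : ((h n)^-1 * sin (h n * y) - y) ^+ 2 <= (h n * `|y| ^+ 3) ^+ 2.
  have -> : (h n)^-1 * sin (h n * y) - y = (h n)^-1 * (sin (h n * y) - h n * y).
    by field; rewrite gt_eqF.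
  rewrite -[leLHS](real_normK (num_real _)) ler_sqr ?nnegrE//; last first.
    by rewrite mulr_ge0 ?(ltW h0)// exprn_ge0.
  rewrite normrM gtr0_norm ?invr_gt0// mulrC ler_pdivrMr//.
  apply: (le_trans (norm_sin_sub_le _)); rewrite normrM gtr0_norm// exprMn.
  rewrite [leRHS]mulrAC ler_wpM2r ?exprn_ge0//.
  by rewrite exprS -expr2 ler_piMl ?sqr_ge0.
apply: (le_trans (lerD A B)); rewrite !exprMn -mulrDr ler_wpM2l ?sqr_ge0//.
rewrite !(real_normK (num_real y)) (exprM y 2 2) (exprM y 2 3).
move: (sqr_ge0 y); move: (y ^+ 2) => z z0.
have p0 := sqr_ge0 z; have q0 : 0 <= z ^+ 3 by rewrite exprn_ge0.
rewrite -[z * (z * z)]/(z ^+ 3) -[z * z]/(z ^+ 2).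
move: (z ^+ 2) (z ^+ 3) p0 q0 => p q p0 q0.
by have := sqr_ge0 (p + q); nra.
Qed.

Lemma measurable_coord (j : 'I_3) :
  measurable_fun [set: mR3] (fun xi : mR3 => coords xi 0 j).
Proof.
rewrite (_ : (fun xi => _) = fun xi : R3 => dot (coords xi) (coords (basis3 R j))).
  exact: measurable_dot.
by apply/funext => xi; rewrite -dot_basis3 !dot3; ring.
Qed.

(* Plancherel turns the difference quotients of f into multiples of F that
   converge to i xi_j F, whence their strong convergence. *)
Lemma weak_derivative_exists j f F r : step_fourier f F ->
  has_int leb3 (fun xi => coords xi 0 j ^+ 2 * normsqc (F xi)) r ->
  exists g, [/\ g \in L2,
    forall phi, test_function phi ->
      \int[leb3]_x (f x * partial j phi x) = - \int[leb3]_x (g x * phi x) &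
    planch R * sqn leb3 g <= r].
Proof.
move=> fF Fr; have [fL FL _] := fF; have [Fi _] := Fr.
have K0 := planch_gt0 R.
pose D n xi := mult n (coords xi 0 j) * F xi.
have dF n : step_fourier (dquot j f n) (D n).
  have t := step_fourier_translate (h n *: basis3 R j) fF.
  have := step_fourierZ (h n)^-1 (step_fourierD t (step_fourierZ (- 1) fF)).
  apply: eq_step_fourier => x.
    by rewrite /dquot mulN1r.
  rewrite dot_scale dot_basis3 /D -multE -mulrA; congr (_ * _).
  by rewrite mulrBl mul1r (rmorphN1 (real_complex R)) mulN1r.
have dL n : dquot j f n \in L2 by have [] := dF n.
have DL n : L2complex (D n) by have [] := dF n.
pose G xi : R[i] := (0 +i* coords xi 0 j) * F xi.
have GE xi : normsqc (G xi) = coords xi 0 j ^+ 2 * normsqc (F xi).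
  by rewrite normsqcM /normsqc /= expr0n add0r.
have cF : cmeas F by case: FL => F1 F2; split; [exact: (Lfun_meas3 F1)|exact: (Lfun_meas3 F2)].
have GL : L2complex G /\ sqnc G = r.
  apply: L2complexI; last by apply: (eq_has_int _ Fr) => xi; rewrite GE.
  by apply: cmeasM => //; split; [exact: measurable_cst|exact: measurable_coord].
pose E n xi := D n xi - G xi.
have EL n : L2complex (E n) by exact: L2complexB (DL n) GL.1.
have EE n xi : E n xi = (mult n (coords xi 0 j) - (0 +i* coords xi 0 j)) * F xi.
  by rewrite /E /D /G mulrBl.
(* The multiplier and its limit both have modulus at most |xi_j|, hence their difference at most
   twice that. *)
have Ele n xi : normsqc (E n xi) <= 4 * (coords xi 0 j ^+ 2 * normsqc (F xi)).
  rewrite EE normsqcM mulrA ler_wpM2r ?addr_ge0 ?sqr_ge0//.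
  move: (coords xi 0 j) => y; have := mult_le n y; case: (mult n y) => a b.
  rewrite /normsqc /= subr0 => ab.
  by have := sqr_ge0 (b + y); have := sqr_ge0 a; lra.
have Elim xi n : normsqc (E n xi) <= (h n * ((1 + coords xi 0 j ^+ 4 +
    coords xi 0 j ^+ 6) * (1 + normsqc (F xi)))) ^+ 2.
  rewrite EE normsqcM mulrA [leRHS]exprMn.
  have n0 : 0 <= normsqc (F xi) by rewrite addr_ge0 ?sqr_ge0.
  apply: ler_pM => //; last by rewrite expr2; nra.
    by rewrite addr_ge0 ?sqr_ge0.
have hc (c : R) : h n * c @[n --> \oo] --> 0.
  rewrite -(mul0r c); apply: cvgM; last exact: cvg_cst.
  exact: cvg_harmonic.
have sq0 (u : nat -> R) (c : R) : 0 <= c -> (forall n, u n ^+ 2 <= (h n * c) ^+ 2) ->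
    u n @[n --> \oo] --> 0.
  move=> c0 uc; apply/cvgr0Pnorm_le => e e0.
  move/cvgr0Pnorm_le : (hc c) => /(_ _ e0); apply: filterS => n.
  have hn : 0 <= h n * c by rewrite mulr_ge0// ltW.
  rewrite ger0_norm// => /(le_trans _); apply.
  by rewrite -ler_sqr ?nnegrE// real_normK ?num_real.
have c0 xi : 0 <= (1 + coords xi 0 j ^+ 4 + coords xi 0 j ^+ 6) * (1 + normsqc (F xi)).
  rewrite mulr_ge0// ?addr_ge0 ?sqr_ge0//.
    by rewrite (exprM _ 2 2) sqr_ge0.
  by rewrite (exprM _ 3 2) sqr_ge0.
have [i4 _] := has_intZ 4 Fr.
have Econv e : 0 < e -> exists N, forall n, (N <= n)%N -> sqnc (E n) < e.
  move=> e0; have e2 : 0 < e / 2 by rewrite divr_gt0.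
  have [||| N1 N1P] := @sqn_dominated _ _ _ leb3 (fun n xi => complex.Re (E n xi))
    _ _ _ _ i4 _ e2.
  - by move=> n; exact: Lfun_meas3 (EL n).1.
  - move=> xi; apply: (sq0 _ _ (c0 xi)) => n; apply: le_trans (Elim xi n).
    by rewrite /normsqc lerDl sqr_ge0.
  - move=> n xi; apply: le_trans (Ele n xi).
    by rewrite /normsqc lerDl sqr_ge0.
  have [||| N2 N2P] := @sqn_dominated _ _ _ leb3 (fun n xi => complex.Im (E n xi))
    _ _ _ _ i4 _ e2.
  - by move=> n; exact: Lfun_meas3 (EL n).2.
  - move=> xi; apply: (sq0 _ _ (c0 xi)) => n; apply: le_trans (Elim xi n).
    by rewrite /normsqc lerDr sqr_ge0.
  - move=> n xi; apply: le_trans (Ele n xi).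
    by rewrite /normsqc lerDr sqr_ge0.
  exists (maxn N1 N2) => n; rewrite geq_max => /andP[/N1P n1 /N2P n2].
  by rewrite [e]splitr /sqnc ltrD.
have Cau e : 0 < e -> exists N, forall m n, (N <= m)%N -> (N <= n)%N ->
    sqn leb3 (fun x => dquot j f m x - dquot j f n x) < e.
  move=> e0; have e4 : 0 < planch R * e / 4 by rewrite divr_gt0// mulr_gt0.
  have [N NP] := Econv _ e4; exists N => m n /NP Em /NP En.
  have dmn : step_fourier (fun x => dquot j f m x - dquot j f n x)
      (fun xi => D m xi - D n xi).
    apply: eq_step_fourier (step_fourierD (dF m) (step_fourierZ (- 1) (dF n))) => x.
      by rewrite mulN1r.
    by rewrite (rmorphN1 (real_complex R)) mulN1r.
  rewrite -(ltr_pM2l K0) -(plancherel dmn).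
  have := sqnc_dist (DL m) GL.1 (DL n).
  have -> : sqnc (fun x => G x - D n x) = sqnc (E n).
    apply: sqnc_normsqc => //; first exact: L2complexB GL.1 (DL n).
    by move=> x; rewrite /E /normsqc !ReB !ImB; ring.
  by rewrite -/(E m) => hE; exact: lt_quarters hE Em En.
have [g gL gP] := Lfun2_complete dL Cau.
exists g; split => //; first exact: dquot_limit_weak.
(* The multipliers are bounded by |xi_j|, so each quotient already satisfies the bound by
   Plancherel; [ler_young_limit] with constant 1 passes it on to the limit [g]. *)
rewrite -GL.2 -ler_pdivlMl// mulrC -[leRHS]mul1r.
have /choice[N NP] : forall e, exists N, 0 < e ->
    sqn leb3 (fun x => g x - dquot j f N x) <= e ^+ 2.
  move=> e; have [e0|e0] := ltP 0 e; last by exists 0%N.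
  by have [N NP] := gP _ (exprn_gt0 2 e0); exists N => _; exact: NP.
apply: (@ler_young_limit _ (fun=> 0) (fun e => sqn leb3 (dquot j f (N e)))) => //.
- by rewrite divr_ge0 ?sqnc_ge0// ltW.
- move=> e e0 e1; have := NP _ e0.
  have := sqn_young3 e0 (dL (N e)) (Lfun2B3 gL (dL (N e))).
  rewrite (_ : (fun x => _ + _) = g); last by apply/funext => x; rewrite addrC subrK.
  rewrite mul1r => /le_trans + y; apply; rewrite lerD2l.
  apply: (@le_trans _ _ ((1 + e^-1) * e ^+ 2)).
    by rewrite ler_wpM2l// addr_ge0// invr_ge0 ltW.
  rewrite mulrDl mul1r expr2 mulKf ?gt_eqF//.
  by rewrite mulr_natl mulr2n lerD2r ler_piMl// ltW.
- move=> e e0 e1; have : sqn leb3 (dquot j f (N e)) <= sqnc G / planch R.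
    rewrite ler_pdivlMr// mulrC -(plancherel (dF _)).
    apply: sqnc_mono => //; first exact: GL.1.
    move=> xi; rewrite GE /D normsqcM ler_wpM2r ?addr_ge0 ?sqr_ge0//.
  move=> /le_trans; apply.
  rewrite [in leRHS]mulrDl mul1r -addrA lerDl addr_ge0// ?mulr_ge0 ?(ltW e0)//.
    exact: sqnc_ge0.
  by rewrite invr_ge0 ltW.
Qed.

End WeakDerivative.

(** * The system at one frequency *)

Section DissipativeSystem.
Variable R : realType.
Implicit Types (t s : R).

Lemma is_derive_eq_val (f : R -> R) t (a b : R) :
  is_derive t (1 : R) f a -> a = b -> is_derive t (1 : R) f b.
Proof. by move=> fa <-. Qed.

Lemma is_derive_sqr (f : R -> R) t (a : R) :
  is_derive t (1 : R) f a -> is_derive t (1 : R) (fun s => f s ^+ 2) (2 * (f t * a)).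
Proof.
move=> fa; have -> : (fun s => f s ^+ 2) = (f * f) by apply/funext => s; rewrite expr2.
by apply: is_derive_eq_val (is_deriveM fa fa) _; rewrite /GRing.scale/=; ring.
Qed.

Lemma is_derive_mul (f g : R -> R) t (a b : R) :
  is_derive t (1 : R) f a -> is_derive t (1 : R) g b ->
  is_derive t (1 : R) (fun s => f s * g s) (f t * b + g t * a).
Proof. by move=> fa gb; apply: is_derive_eq_val (is_deriveM fa gb) _. Qed.

Lemma is_derive_add (f g : R -> R) t (a b : R) :
  is_derive t (1 : R) f a -> is_derive t (1 : R) g b ->
  is_derive t (1 : R) (fun s => f s + g s) (a + b).
Proof. by move=> fa gb; exact: is_deriveD. Qed.

Lemma is_derive_sub (f g : R -> R) t (a b : R) :
  is_derive t (1 : R) f a -> is_derive t (1 : R) g b ->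
  is_derive t (1 : R) (fun s => f s - g s) (a - b).
Proof. by move=> fa gb; exact: is_deriveB. Qed.

Lemma is_derive_scale (f : R -> R) t (c a : R) :
  is_derive t (1 : R) f a ->
  is_derive t (1 : R) (fun s => c * f s) (c * a).
Proof. by move=> fa; exact: is_deriveZ. Qed.

Lemma nonincreasing_is_derive (f df : R -> R) (a b : R) : a <= b ->
  (forall s, a <= s <= b -> is_derive s (1 : R) f (df s)) ->
  (forall s, a <= s <= b -> df s <= 0) -> f b <= f a.
Proof.
move=> ab fd d0.
have io s : s \in `]a, b[ -> a <= s <= b.
  by rewrite in_itv/= => /andP[x y]; rewrite !ltW.
apply: (@ler0_derive1_nincr R f a b _ _ _ a b) => //.
- by move=> s /io /fd fs; exact: ex_derive.
- by move=> s /io sab; have fs := fd _ sab; rewrite derive1E derive_val; exact: d0.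
- apply: derivable_within_continuous => s; rewrite in_itv/= => /fd fs.
  exact: ex_derive.
Qed.

Variables mu chi gamma kappa : R.
Hypotheses (mu0 : 0 < mu) (chi0 : 0 < chi) (gamma0 : 0 <= gamma) (kappa0 : 0 <= kappa).
Variables x y z : R.
Let r2 := x ^+ 2 + y ^+ 2 + z ^+ 2.

(** The quadratic form <A X, X> of X = (a, d) at xi = (x, y, z). The term 4 chi a . (xi x d) gathers
    the two equal off-diagonal contributions. *)
Definition dissipation (a1 a2 a3 d1 d2 d3 : R) : R :=
  (mu + chi) * r2 * (a1 ^+ 2 + a2 ^+ 2 + a3 ^+ 2) +
  4 * chi * (a1 * (y * d3 - z * d2) + a2 * (z * d1 - x * d3) + a3 * (x * d2 - y * d1)) +
  (4 * chi + gamma * r2) * (d1 ^+ 2 + d2 ^+ 2 + d3 ^+ 2) +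
  kappa * (x * d1 + y * d2 + z * d3) ^+ 2.

(* Completing the squares of xi x a - (2 chi / (chi + mu / 2)) d in the
   dissipation leaves exactly these two constants. *)
Definition coercivity : R := Num.min (mu / 2) (4 * chi * mu / (2 * chi + mu)).

Lemma coercivity_gt0 : 0 < coercivity.
Proof.
have cm : 0 < 2 * chi + mu by rewrite addr_gt0// mulr_gt0.
by rewrite /coercivity lt_min !divr_gt0// !mulr_gt0.
Qed.

(** A part mu / 2 of the coefficient mu + chi is set aside; on the rest, Lagrange's identity |xi|^2
    |a|^2 = (xi . a)^2 + |xi x a|^2 brings out xi x a, to be paired with d since a . (xi x d) = - d
    . (xi x a). *)
Lemma coercive a1 a2 a3 d1 d2 d3 :
  coercivity * (r2 * (a1 ^+ 2 + a2 ^+ 2 + a3 ^+ 2) + (d1 ^+ 2 + d2 ^+ 2 + d3 ^+ 2))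
  <= dissipation a1 a2 a3 d1 d2 d3.
Proof.
have p0 : 0 < chi + mu / 2 by rewrite addr_gt0// divr_gt0.
have pm : 0 < 2 * chi + mu by rewrite addr_gt0// mulr_gt0.
pose q := 2 * chi / (chi + mu / 2).
pose f1 := y * a3 - z * a2; pose f2 := z * a1 - x * a3; pose f3 := x * a2 - y * a1.
have -> : dissipation a1 a2 a3 d1 d2 d3 =
    mu / 2 * (r2 * (a1 ^+ 2 + a2 ^+ 2 + a3 ^+ 2)) +
    4 * chi * mu / (2 * chi + mu) * (d1 ^+ 2 + d2 ^+ 2 + d3 ^+ 2) +
    ((chi + mu / 2) * ((x * a1 + y * a2 + z * a3) ^+ 2 +
       ((f1 - q * d1) ^+ 2 + (f2 - q * d2) ^+ 2 + (f3 - q * d3) ^+ 2)) +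
     gamma * (r2 * (d1 ^+ 2 + d2 ^+ 2 + d3 ^+ 2)) +
     kappa * (x * d1 + y * d2 + z * d3) ^+ 2).
  rewrite /dissipation /q /f1 /f2 /f3 /r2; field.
  by rewrite mulrC gt_eqF.
rewrite mulrDr -[leLHS]addr0; apply: lerD; first apply: lerD.
- by rewrite ler_wpM2r ?mulr_ge0 ?addr_ge0 ?sqr_ge0// /coercivity ge_min lexx.
- by rewrite ler_wpM2r ?addr_ge0 ?sqr_ge0// /coercivity ge_min lexx orbT.
- have r0 : 0 <= r2 by rewrite /r2 !(sqr_ge0, addr_ge0).
  by rewrite !(sqr_ge0, addr_ge0, mulr_ge0)// ltW.
Qed.

Variables a1 a2 a3 d1 d2 d3 : R -> R.

Definition energy s :=
  a1 s ^+ 2 + a2 s ^+ 2 + a3 s ^+ 2 + (d1 s ^+ 2 + d2 s ^+ 2 + d3 s ^+ 2).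

(** For a = Re U and d = Im W, the real part of 2 chi i xi x W is - 2 chi xi x d and the imaginary
    part of 2 chi i xi x U is + 2 chi xi x a: opposite signs in front of an antisymmetric matrix,
    hence a symmetric system. [da] and [dd] are single components, with [e - f] one component of a
    cross product. *)
Let da (b e f : R) := - ((mu + chi) * r2) * b - 2 * chi * (e - f).
Let dd (k b e f s : R) := - (gamma * r2) * b - kappa * k * (x * d1 s + y * d2 s + z * d3 s)
  + 2 * chi * (e - f) - 4 * chi * b.

Hypothesis Da1 : forall s, 0 < s ->
  is_derive s (1 : R) a1 (da (a1 s) (y * d3 s) (z * d2 s)).
Hypothesis Da2 : forall s, 0 < s ->
  is_derive s (1 : R) a2 (da (a2 s) (z * d1 s) (x * d3 s)).
Hypothesis Da3 : forall s, 0 < s ->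
  is_derive s (1 : R) a3 (da (a3 s) (x * d2 s) (y * d1 s)).
Hypothesis Dd1 : forall s, 0 < s ->
  is_derive s (1 : R) d1 (dd x (d1 s) (y * a3 s) (z * a2 s) s).
Hypothesis Dd2 : forall s, 0 < s ->
  is_derive s (1 : R) d2 (dd y (d2 s) (z * a1 s) (x * a3 s) s).
Hypothesis Dd3 : forall s, 0 < s ->
  is_derive s (1 : R) d3 (dd z (d3 s) (x * a2 s) (y * a1 s) s).

Let D s := dissipation (a1 s) (a2 s) (a3 s) (d1 s) (d2 s) (d3 s).

Let D_ge0 s : 0 <= D s.
Proof.
apply: le_trans (coercive _ _ _ _ _ _).
rewrite mulr_ge0 ?(ltW coercivity_gt0)// /r2.
by rewrite !(sqr_ge0, addr_ge0, mulr_ge0).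
Qed.

Let energy_ge0 s : 0 <= energy s.
Proof. by rewrite !(addr_ge0, sqr_ge0). Qed.

Let derive_energy s : 0 < s -> is_derive s (1 : R) energy (- 2 * D s).
Proof.
move=> s0.
apply: (is_derive_eq_val (is_derive_add
  (is_derive_add (is_derive_add (is_derive_sqr (Da1 s0)) (is_derive_sqr (Da2 s0)))
    (is_derive_sqr (Da3 s0)))
  (is_derive_add (is_derive_add (is_derive_sqr (Dd1 s0)) (is_derive_sqr (Dd2 s0)))
    (is_derive_sqr (Dd3 s0))))).
by rewrite /D /dissipation /da /dd /r2; ring.
Qed.

(* The system is X' = - A X with A symmetric, so D = <A X, X> has derivative
   - 2 |X'|^2. *)
Let derive_dissipation s : 0 < s -> is_derive s (1 : R) D
  (- 2 * (da (a1 s) (y * d3 s) (z * d2 s) ^+ 2 +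
     da (a2 s) (z * d1 s) (x * d3 s) ^+ 2 + da (a3 s) (x * d2 s) (y * d1 s) ^+ 2 +
     dd x (d1 s) (y * a3 s) (z * a2 s) s ^+ 2 + dd y (d2 s) (z * a1 s) (x * a3 s) s ^+ 2 +
     dd z (d3 s) (x * a2 s) (y * a1 s) s ^+ 2)).
Proof.
move=> s0; rewrite /D /dissipation.
have sqr (f1 f2 f3 : R -> R) u v w : is_derive s (1 : R) f1 u ->
    is_derive s (1 : R) f2 v -> is_derive s (1 : R) f3 w ->
    is_derive s (1 : R) (fun s => f1 s ^+ 2 + f2 s ^+ 2 + f3 s ^+ 2)
      (2 * (f1 s * u) + 2 * (f2 s * v) + 2 * (f3 s * w)).
  by move=> fu gv hw; do !apply: is_derive_add => //; exact: is_derive_sqr.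
have cr (f g h : R -> R) u v w k l : is_derive s (1 : R) f u ->
    is_derive s (1 : R) g v -> is_derive s (1 : R) h w ->
    is_derive s (1 : R) (fun s => f s * (k * g s - l * h s))
      (f s * (k * v - l * w) + (k * g s - l * h s) * u).
  by move=> fu gv hw; apply: is_derive_mul.
apply: (is_derive_eq_val (is_derive_add (is_derive_add (is_derive_add
  (is_derive_scale _ (sqr _ _ _ _ _ _ (Da1 s0) (Da2 s0) (Da3 s0)))
  (is_derive_scale _ (is_derive_add (is_derive_add
     (cr _ _ _ _ _ _ y z (Da1 s0) (Dd3 s0) (Dd2 s0))
     (cr _ _ _ _ _ _ z x (Da2 s0) (Dd1 s0) (Dd3 s0)))
     (cr _ _ _ _ _ _ x y (Da3 s0) (Dd2 s0) (Dd1 s0)))))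
  (is_derive_scale _ (sqr _ _ _ _ _ _ (Dd1 s0) (Dd2 s0) (Dd3 s0))))
  (is_derive_scale _ (is_derive_sqr (is_derive_add (is_derive_add
     (is_derive_scale x (Dd1 s0)) (is_derive_scale y (Dd2 s0)))
     (is_derive_scale z (Dd3 s0))))))).
by rewrite /da /dd; ring.
Qed.

Lemma energy_nonincreasing s t : 0 < s -> s <= t -> energy t <= energy s.
Proof.
move=> s0 st; apply: (@nonincreasing_is_derive _ (fun s => - 2 * D s)) => //.
  by move=> v /andP[sv _]; apply: derive_energy; exact: lt_le_trans sv.
by move=> v _; have := D_ge0 v; lra.
Qed.

(* energy + 2 (. - s) D is nonincreasing on [s, t]. *)
Lemma energy_smoothing s t : 0 < s -> s <= t ->
  2 * (t - s) * (coercivity * (r2 * (a1 t ^+ 2 + a2 t ^+ 2 + a3 t ^+ 2) +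
    (d1 t ^+ 2 + d2 t ^+ 2 + d3 t ^+ 2))) <= energy s.
Proof.
move=> s0 st.
have : energy t + 2 * ((t - s) * D t) <= energy s + 2 * ((s - s) * D s).
  pose N v := da (a1 v) (y * d3 v) (z * d2 v) ^+ 2 +
     da (a2 v) (z * d1 v) (x * d3 v) ^+ 2 + da (a3 v) (x * d2 v) (y * d1 v) ^+ 2 +
     dd x (d1 v) (y * a3 v) (z * a2 v) v ^+ 2 + dd y (d2 v) (z * a1 v) (x * a3 v) v ^+ 2 +
     dd z (d3 v) (x * a2 v) (y * a1 v) v ^+ 2.
  apply: (@nonincreasing_is_derive (fun v => energy v + 2 * ((v - s) * D v))
     (fun v => - (4 * (v - s) * N v))) => //.
    move=> v /andP[sv _]; have v0 : 0 < v by exact: lt_le_trans sv.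
    have id1 : is_derive v (1 : R) (fun v => v - s) 1.
      by apply: (is_derive_eq_val (is_derive_sub (is_derive_id _ _) (is_derive_cst _ _ _))); rewrite subr0.
    apply: (is_derive_eq_val (is_derive_add (derive_energy v0) (is_derive_scale 2
      (is_derive_mul id1 (derive_dissipation v0))))).
    by rewrite -/(N v); ring.
  move=> v /andP[sv _]; rewrite oppr_le0.
  rewrite mulr_ge0 ?mulr_ge0 ?subr_ge0// /N.
  by rewrite !(addr_ge0, sqr_ge0).
rewrite subrr mul0r mulr0 addr0 => /(le_trans _); apply.
have := energy_ge0 t.
have : (t - s) * (coercivity * (r2 * (a1 t ^+ 2 + a2 t ^+ 2 + a3 t ^+ 2) +
    (d1 t ^+ 2 + d2 t ^+ 2 + d3 t ^+ 2))) <= (t - s) * D t.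
  by rewrite ler_wpM2l ?subr_ge0// coercive.
rewrite -[2 * _ * _]mulrA.
by move=> h e0; rewrite (le_trans (ler_wpM2l (ler0n R 2) h))// lerDr.
Qed.

Lemma energy_decay s t : 0 < s -> s <= t ->
  energy t <= energy s /\
  2 * (t - s) * (coercivity * (r2 * (a1 t ^+ 2 + a2 t ^+ 2 + a3 t ^+ 2) +
    (d1 t ^+ 2 + d2 t ^+ 2 + d3 t ^+ 2))) <= energy s.
Proof.
by move=> s0 st; split; [exact: energy_nonincreasing|exact: energy_smoothing].
Qed.

End DissipativeSystem.

Section Symbols.
Variable R : realType.
Implicit Types (xi : R3 R) (V : 'rV[R[i]]_3).

(** The equations are packed in a product type to serve as one rewriting rule. *)
Lemma cross3 (K : pzRingType) (a b : 'rV[K]_3) :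
  (cross a b 0 0 = a 0 1 * b 0 2 - a 0 2 * b 0 1) *
  (cross a b 0 1 = a 0 2 * b 0 0 - a 0 0 * b 0 2) *
  (cross a b 0 2 = a 0 0 * b 0 1 - a 0 1 * b 0 0).
Proof.
have e (i j k : 'I_3) : (i + j = k :> nat \/ i + j = k + 3 :> nat)%N -> i + j = k.
  move=> h; apply/val_inj => /=; case: h => ->; rewrite ?modnDr modn_small//.
rewrite /cross !mxE !add0r.
rewrite (e 1 1 2); last by left.
rewrite (e 1 2 0); last by right.
rewrite (e 2 1 0); last by right.
by rewrite (e 2 2 1); last by right.
Qed.

Lemma symb3 xi : (symb xi 0 0 = (0 +i* xi.1.1)) * (symb xi 0 1 = (0 +i* xi.1.2)) *
  (symb xi 0 2 = (0 +i* xi.2)).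
Proof.
have e i : symb xi 0 i = (0 +i* coords xi 0 i).
  by rewrite /symb -complexiE !mxE; apply/eqP; rewrite eq_complex /=; apply/andP;
    split; apply/eqP; ring.
by rewrite !e !mxE.
Qed.

Lemma dotE3 (K : pzRingType) (a b : 'rV[K]_3) :
  dot a b = a 0 0 * b 0 0 + a 0 1 * b 0 1 + a 0 2 * b 0 2.
Proof.
rewrite /dot !big_ord_recl big_ord0 addr0 addrA.
rewrite (_ : lift ord0 (ord0 : 'I_2) = 1)//; last exact/val_inj.
by rewrite (_ : lift ord0 (lift ord0 (ord0 : 'I_1)) = 2)//; last exact/val_inj.
Qed.

End Symbols.

Section Frequency.
Variable R : realType.
Variables mu chi gamma kappa : R.
Hypotheses (mu0 : 0 < mu) (chi0 : 0 < chi) (gamma0 : 0 <= gamma) (kappa0 : 0 <= kappa).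
Variables (xi : R3 R) (U W : R -> 'rV[R[i]]_3).
Hypothesis ode : micropolar_ode mu chi gamma kappa xi U W.

Definition vnormsq (v : 'rV[R[i]]_3) : R := \sum_i normsqc (v 0 i).

Lemma vnormsqE v : vnormsq v =
  complex.Re (v 0 0) ^+ 2 + complex.Re (v 0 1) ^+ 2 + complex.Re (v 0 2) ^+ 2 +
  (complex.Im (v 0 0) ^+ 2 + complex.Im (v 0 1) ^+ 2 + complex.Im (v 0 2) ^+ 2).
Proof.
rewrite /vnormsq !big_ord_recl big_ord0 addr0 /normsqc.
rewrite (_ : lift ord0 (ord0 : 'I_2) = 1)//; last exact/val_inj.
rewrite (_ : lift ord0 (lift ord0 (ord0 : 'I_1)) = 2)//; last exact/val_inj.
by ring.
Qed.

Local Ltac dest v := move: (U v 0 0) (U v 0 1) (U v 0 2) (W v 0 0) (W v 0 1) (W v 0 2);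
  move=> [? ?] [? ?] [? ?] [? ?] [? ?] [? ?] /=; ring.

(* (Re U, Im W) and (Im U, - Re W) both solve the real system of [energy_decay]. *)
Lemma frequency_energy s t : 0 < s -> s <= t ->
  vnormsq (U t) + vnormsq (W t) <= vnormsq (U s) + vnormsq (W s) /\
  2 * (t - s) * (coercivity mu chi *
    (dot (coords xi) (coords xi) * vnormsq (U t) + vnormsq (W t)))
  <= vnormsq (U s) + vnormsq (W s).
Proof.
move=> s0 st.
pose u i s := complex.Re (U s 0 i); pose u' i s := complex.Im (U s 0 i).
pose w' i s := complex.Im (W s 0 i); pose w i s := -1 * complex.Re (W s 0 i).
have lin2 (A B : 'rV[R[i]]_3) a b c i : (a *: (c *: A) + b *: B) 0 i =
    a * (c * A 0 i) + b * B 0 i by rewrite !mxE.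
have lin4 (A B C D : 'rV[R[i]]_3) a b c d e f i :
    (a *: (e *: A) + b *: (f *: B) + c *: C - d *: D) 0 i =
    a * (e * A 0 i) + b * (f * B 0 i) + c * C 0 i - d * D 0 i by rewrite !mxE.
have dU (i : 'I_3) v : 0 < v -> let d := (mu + chi)%:C * (dot (symb xi) (symb xi) * U v 0 i)
    + (2 * chi)%:C * cross (symb xi) (W v) 0 i in
    is_derive (v : R) (1 : R) (u i) (complex.Re d) /\
    is_derive (v : R) (1 : R) (u' i) (complex.Im d).
  move=> v0; have [_ _ /(_ v v0)[/(_ i) + _ _]] := ode.
  by rewrite /flaplacian /fcurl lin2.
have dW (i : 'I_3) v : 0 < v -> let d :=
    gamma%:C * (dot (symb xi) (symb xi) * W v 0 i)
    + kappa%:C * (dot (symb xi) (W v) * symb xi 0 i)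
    + (2 * chi)%:C * cross (symb xi) (U v) 0 i - (4 * chi)%:C * W v 0 i in
    is_derive (v : R) (1 : R) (w i) (-1 * complex.Re d) /\
    is_derive (v : R) (1 : R) (w' i) (complex.Im d).
  move=> v0 d; have [_ _ /(_ v v0)[_ /(_ i) + _]] := ode.
  rewrite /flaplacian /fgrad /fcurl lin4 => -[h1 h2]; split => //.
  exact: is_derive_scale.
have dd := (@dotE3 R[i] (symb xi), @cross3 R[i] (symb xi), symb3 xi).
have [h1 h2] : energy (u 0) (u 1) (u 2) (w' 0) (w' 1) (w' 2) t <=
    energy (u 0) (u 1) (u 2) (w' 0) (w' 1) (w' 2) s /\
    2 * (t - s) * (coercivity mu chi *
      ((xi.1.1 ^+ 2 + xi.1.2 ^+ 2 + xi.2 ^+ 2) *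
        (u 0 t ^+ 2 + u 1 t ^+ 2 + u 2 t ^+ 2)
       + (w' 0 t ^+ 2 + w' 1 t ^+ 2 + w' 2 t ^+ 2)))
    <= energy (u 0) (u 1) (u 2) (w' 0) (w' 1) (w' 2) s.
  refine (@energy_decay R mu chi gamma kappa mu0 chi0 gamma0 kappa0 xi.1.1 xi.1.2 xi.2
      (u 0) (u 1) (u 2) (w' 0) (w' 1) (w' 2) _ _ _ _ _ _ s t s0 st) => v v0;
    [ by apply: (is_derive_eq_val (dU 0 v v0).1); rewrite !dd /u /u' /w /w'; dest v
    | by apply: (is_derive_eq_val (dU 1 v v0).1); rewrite !dd /u /u' /w /w'; dest v
    | by apply: (is_derive_eq_val (dU 2 v v0).1); rewrite !dd /u /u' /w /w'; dest v
    | by apply: (is_derive_eq_val (dW 0 v v0).2); rewrite !dd /u /u' /w /w'; dest v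
    | by apply: (is_derive_eq_val (dW 1 v v0).2); rewrite !dd /u /u' /w /w'; dest v
    | by apply: (is_derive_eq_val (dW 2 v v0).2); rewrite !dd /u /u' /w /w'; dest v ].
have [h3 h4] : energy (u' 0) (u' 1) (u' 2) (w 0) (w 1) (w 2) t <=
    energy (u' 0) (u' 1) (u' 2) (w 0) (w 1) (w 2) s /\
    2 * (t - s) * (coercivity mu chi *
      ((xi.1.1 ^+ 2 + xi.1.2 ^+ 2 + xi.2 ^+ 2) *
        (u' 0 t ^+ 2 + u' 1 t ^+ 2 + u' 2 t ^+ 2)
       + (w 0 t ^+ 2 + w 1 t ^+ 2 + w 2 t ^+ 2)))
    <= energy (u' 0) (u' 1) (u' 2) (w 0) (w 1) (w 2) s.
  refine (@energy_decay R mu chi gamma kappa mu0 chi0 gamma0 kappa0 xi.1.1 xi.1.2 xi.2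
      (u' 0) (u' 1) (u' 2) (w 0) (w 1) (w 2) _ _ _ _ _ _ s t s0 st) => v v0;
    [ by apply: (is_derive_eq_val (dU 0 v v0).2); rewrite !dd /u /u' /w /w'; dest v
    | by apply: (is_derive_eq_val (dU 1 v v0).2); rewrite !dd /u /u' /w /w'; dest v
    | by apply: (is_derive_eq_val (dU 2 v v0).2); rewrite !dd /u /u' /w /w'; dest v
    | by apply: (is_derive_eq_val (dW 0 v v0).1); rewrite !dd /u /u' /w /w'; dest v
    | by apply: (is_derive_eq_val (dW 1 v v0).1); rewrite !dd /u /u' /w /w'; dest v
    | by apply: (is_derive_eq_val (dW 2 v v0).1); rewrite !dd /u /u' /w /w'; dest v ].
have e v : vnormsq (U v) + vnormsq (W v) =
    energy (u 0) (u 1) (u 2) (w' 0) (w' 1) (w' 2) v +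
    energy (u' 0) (u' 1) (u' 2) (w 0) (w 1) (w 2) v.
  by rewrite !vnormsqE /energy /u /u' /w /w'; ring.
rewrite !e; split; first exact: lerD.
apply: le_trans (lerD h2 h4); rewrite -!mulrDr.
rewrite !vnormsqE dot3 le_eqVlt; apply/orP; left; apply/eqP.
by rewrite /u /u' /w /w'; ring.
Qed.

End Frequency.

(** * Decay of the energy *)

Section AlmostEverywhere.
Context d (T : measurableType d) (R : realType) (mu : {measure set T -> \bar R}).

Lemma ae_imply (P Q : T -> Prop) : (forall x, P x -> Q x) ->
  {ae mu, forall x, P x} -> {ae mu, forall x, Q x}.
Proof. by move=> PQ; apply: filterS. Qed.

Lemma has_int_ae_le f g r s : {ae mu, forall x, f x <= g x} ->
  has_int mu f r -> has_int mu g s -> r <= s.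
Proof.
move=> fg fr gs; have gf := has_intB gs fr.
rewrite -subr_ge0; apply: (has_int_le (f := fun=> 0) (g := fun x => Num.max (g x - f x) 0)).
- by move=> x; rewrite le_max lexx orbT.
- exact: has_int0.
- apply: (has_int_ae _ _ gf).
    by apply: measurable_maxr => //; exact: has_int_meas gf.
  by apply: filterS fg => x /= h; rewrite max_l// subr_ge0.
Qed.

(** The minimum of [f] and [g] is dominated everywhere and equals [f] almost everywhere. *)
Lemma has_int_ae_dom (f g : T -> R) s : measurable_fun setT f -> (forall x, 0 <= f x) ->
  (forall x, 0 <= g x) -> {ae mu, forall x, f x <= g x} -> has_int mu g s ->
  exists r, has_int mu f r.
Proof.
move=> mf f0 g0 fg gs; exists (\int[mu]_x (Num.min (f x) (g x))).
apply: (@has_int_ae _ _ _ _ (fun x => Num.min (f x) (g x))) => //.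
  by apply: filterS fg => x /= h; rewrite min_l.
apply: has_int_Rintegral; apply: (@integrable_dom _ _ _ _ _ g).
- by apply: measurable_minr => //; exact: has_int_meas gs.
- by move=> x; rewrite ger0_norm ?le_min ?f0 ?g0// ge_min lexx orbT.
- by case: gs.
Qed.

End AlmostEverywhere.

(** * Decay rates from the smoothing inequality; A, B, D are the square norms of u, w and grad u *)

Section PolynomialDecay.
Variables (R : realType) (A B D : R -> R) (c Gamma : R).
Hypotheses (c0 : 0 < c) (Gamma0 : 0 <= Gamma).
Hypotheses (A0 : forall t, 0 <= A t) (B0 : forall t, 0 <= B t) (D0 : forall t, 0 <= D t).
Hypothesis nincr : forall s t, 0 < s -> s <= t -> A t + B t <= A s + B s.
Hypothesis smoothing : forall t, 0 < t -> t * (c * (B t + D t)) <= A (t / 2) + B (t / 2).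

(** Normalized so that K is nonnegative and t is at least 1 on the range considered, where t^(-q)
    decreases in q. *)
Definition decays (f : R -> R) (q : R) :=
  exists K T, [/\ 0 <= K, 1 <= T & forall t, T <= t -> f t <= K * t `^ (- q)].

Lemma decays_le f p q : p <= q -> decays f q -> decays f p.
Proof.
move=> pq [K [T [K0 T1 KT]]]; exists K, T; split => // t Tt.
apply: le_trans (KT _ Tt) _; apply: ler_wpM2l => //.
by apply: ler_powR; [exact: le_trans Tt|rewrite lerN2].
Qed.

Lemma decays_step q : decays A q -> decays B q -> decays (fun t => B t + D t) (q + 1).
Proof.
move=> [K [T [K0 T1 KT]]] [L [S [L0 S1 LS]]].
(* The rates are used at time t / 2: this costs the factor 2^q and requires t / 2 to exceed both
   thresholds. *)
exists (c^-1 * ((K + L) * 2 `^ q)), (2 * (T + S)); split.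
- by rewrite mulr_ge0 ?invr_ge0 ?(ltW c0)// mulr_ge0 ?powR_ge0// addr_ge0.
- lra.
- move=> t Tt; have t0 : 0 < t by lra.
  have h1 := smoothing t0.
  have h2 : A (t / 2) <= K * (t / 2) `^ (- q) by apply: KT; lra.
  have h3 : B (t / 2) <= L * (t / 2) `^ (- q) by apply: LS; lra.
  have e : (t / 2) `^ (- q) = 2 `^ q * t `^ (- q).
    rewrite powRM ?invr_ge0// 1?ltW// mulrC; congr (_ * _).
    by rewrite -powR_inv1// -powRrM mulN1r opprK.
  have -> : t `^ (- (q + 1)) = t^-1 * t `^ (- q).
    rewrite opprD powRD; last by rewrite (gt_eqF t0) implybT.
    by rewrite mulrC powR_inv1// ltW.
  have h4 : t * (c * (B t + D t)) <= (K + L) * (2 `^ q * t `^ (- q)).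
    by rewrite -e; apply: (le_trans h1); rewrite mulrDl lerD.
  rewrite -(ler_pM2l c0) -(ler_pM2l t0); apply: (le_trans h4).
  rewrite le_eqVlt; apply/orP; left; apply/eqP; field.
  by rewrite !gt_eqF.
Qed.

(** B decays at the rate min(n, Gamma) for every n: the case n = 0 is the monotonicity of the energy
    after time 1, and each step gains one power until A, which decays only at the rate Gamma, takes
    over. Some n exceeds Gamma, and one more step gains the final power. *)
Lemma smoothing_decay : decays A Gamma -> decays (fun t => B t + D t) (Gamma + 1).
Proof.
move=> dA; apply: decays_step => //.
have geG n : Num.min n%:R Gamma <= Gamma by rewrite ge_min lexx orbT.
have dB n : decays B (Num.min n%:R Gamma).
  elim: n => [|n ih].
    exists (A 1 + B 1), 1; split => //; first exact: addr_ge0.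
    move=> t t1; rewrite min_l// oppr0 powRr0 mulr1.
    by apply: le_trans (nincr _ t1) => //; rewrite lerDr.
  have [K [T [K0 T1 KT]]] := decays_step (decays_le (geG n) dA) ih.
  apply: (@decays_le _ _ (Num.min n%:R Gamma + 1)).
    by rewrite -natr1 addr_minl le_min !ge_min lexx lerDl ler01 orbT.
  exists K, T; split => // t Tt; apply: le_trans (KT _ Tt); by rewrite lerDl.
have := dB (Num.bound Gamma); rewrite min_r// ltW//.
by have := archi_boundP Gamma0.
Qed.

Lemma bigO_decays f q : (forall t, 0 <= f t) ->
  bigO_pinfty f (fun t => t `^ (- q)) <-> decays f q.
Proof.
move=> f0; split=> [[C [M [_ CM]]]|[K [T [K0 T1 KT]]]].
  (* Neighborhoods of infinity are given by a strict inequality, hence M + 1. *)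
  exists (Num.max C 0), (Num.max (M + 1) 1); split.
  - by rewrite le_max lexx orbT.
  - by rewrite le_max lexx orbT.
  - move=> t; rewrite ge_max => /andP[Mt t1].
    have := CM t; rewrite /= ger0_norm// ger0_norm ?powR_ge0// => /(_ _)/le_trans.
    apply; first lra.
    by rewrite ler_wpM2r ?powR_ge0// le_max lexx.
exists K, T; split; first exact: num_real.
by move=> t /ltW Tt /=; rewrite !ger0_norm ?powR_ge0//; exact: KT.
Qed.

End PolynomialDecay.

Section Energy.
Context (R : realType).
Local Notation R3 := (R3 R).
Local Notation mR := (measurableTypeR R).
Local Notation mR3 := (mR * mR * mR)%type.
Local Notation leb3 := (@leb3 R).
Local Notation L2 := (Lfun leb3 2%:E).

Lemma has_int_L2normsq m n (f : R3 -> 'M[R]_(m, n)) : L2field f ->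
  has_int leb3 (fun x => \sum_i \sum_j f x i j ^+ 2)
    (\sum_i \sum_j sqn leb3 (fun x => f x i j)).
Proof.
move=> fL; apply: has_int_sum => i; apply: has_int_sum => j.
exact: Lfun2_sqr3 (fL i j).
Qed.

Lemma L2normsqE m n (f : R3 -> 'M[R]_(m, n)) : L2field f ->
  L2normsq f = \sum_i \sum_j sqn leb3 (fun x => f x i j).
Proof. by move=> /has_int_L2normsq[]. Qed.

Lemma L2normsq_ge0 m n (f : R3 -> 'M[R]_(m, n)) : 0 <= L2normsq f.
Proof.
apply: Rintegral_ge0 => x _; apply: sumr_ge0 => i _; apply: sumr_ge0 => j _.
exact: sqr_ge0.
Qed.

Lemma plancherel_field (f : R3 -> 'rV[R]_3) F : fourierL2_field f F ->
  L2field f /\ has_int leb3 (fun xi => vnormsq (F xi)) (planch R * L2normsq f).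
Proof.
move=> fF; have sF i := fourierL2_step_fourier (fF i).
have fL : L2field f by move=> i j; rewrite ord1; have [] := sF j.
split => //; rewrite L2normsqE// big_ord1 mulr_sumr.
rewrite (eq_bigr (fun i => sqnc (fun xi => F xi 0 i))); last first.
  by move=> i _; rewrite (plancherel (sF i)).
by apply: has_int_sum => i; apply: L2complex_normsqc; have [] := sF i.
Qed.

Variables mu chi gamma kappa : R.
Hypotheses (mu0 : 0 < mu) (chi0 : 0 < chi) (gamma0 : 0 <= gamma) (kappa0 : 0 <= kappa).
Variables u w : R -> R3 -> 'rV[R]_3.
Variables U W : R -> R3 -> 'rV[R[i]]_3.
Hypothesis uU : forall t, 0 <= t ->
  fourierL2_field (u t) (U t) /\ fourierL2_field (w t) (W t).
Hypothesis ode : {ae leb3, forall xi, micropolar_ode mu chi gamma kappa xi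
  (fun t => U t xi) (fun t => W t xi)}.

Let energy_has_int t : 0 < t ->
  has_int leb3 (fun xi => vnormsq (U t xi) + vnormsq (W t xi))
    (planch R * (L2normsq (u t) + L2normsq (w t))).
Proof.
move=> /ltW /uU[/plancherel_field[_ ui] /plancherel_field[_ wi]].
by rewrite mulrDr; exact: has_intD ui wi.
Qed.

Lemma L2_energy_nonincreasing s t : 0 < s -> s <= t ->
  L2normsq (u t) + L2normsq (w t) <= L2normsq (u s) + L2normsq (w s).
Proof.
move=> s0 st; have t0 := lt_le_trans s0 st.
rewrite -(ler_pM2l (planch_gt0 R)).
apply: has_int_ae_le (energy_has_int t0) (energy_has_int s0).
apply: (@ae_imply _ _ _ leb3 _ _ _ ode) => xi h.
by have [] := frequency_energy mu0 chi0 gamma0 kappa0 h s0 st.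
Qed.

(** The inequality between the times t / 2 and t at almost every frequency first makes each xi_j^2
    |U_i(t)|^2 integrable, so that the weak derivatives exist in L^2, and then bounds their sum once
    integrated. Starting at t / 2 makes the factor 2 (t - s) equal to t. *)
Lemma weak_gradient_smoothing t : 0 < t ->
  exists g : R3 -> 'M[R]_3, [/\ L2field g, weak_gradient (u t) g &
    t * (coercivity mu chi * (L2normsq (w t) + L2normsq g))
    <= L2normsq (u (t / 2)) + L2normsq (w (t / 2))].
Proof.
move=> t0; have t2 : 0 < t / 2 by rewrite divr_gt0.
have c0 : 0 < t * coercivity mu chi by rewrite mulr_gt0 ?coercivity_gt0.
have [uF wF] := uU (ltW t0).
have sF i := fourierL2_step_fourier (uF i).
have [_ wi] := plancherel_field wF.
pose G i j xi := coords xi 0 j ^+ 2 * normsqc (U t xi 0 i).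
have vn0 (v : 'rV[R[i]]_3) : 0 <= vnormsq v by apply: sumr_ge0 => i _; rewrite addr_ge0 ?sqr_ge0.
have G0 i j xi : 0 <= G i j xi by rewrite mulr_ge0 ?addr_ge0 ?sqr_ge0.
have Gsum xi : \sum_i \sum_j G i j xi = dot (coords xi) (coords xi) * vnormsq (U t xi).
  rewrite /vnormsq mulr_sumr; apply: eq_bigr => i _; rewrite -mulr_suml.
  by congr (_ * _); apply: eq_bigr => j _; rewrite expr2.
have pointwise : {ae leb3, forall xi, t * coercivity mu chi *
    (\sum_i \sum_j G i j xi + vnormsq (W t xi)) <=
    vnormsq (U (t / 2) xi) + vnormsq (W (t / 2) xi)}.
  apply: (@ae_imply _ _ _ leb3 _ _ _ ode) => xi h; rewrite Gsum -mulrA.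
  have th : t / 2 <= t by lra.
  have [_] := frequency_energy mu0 chi0 gamma0 kappa0 h t2 th.
  by rewrite (_ : 2 * (t - t / 2) = t)//; field.
have E2 := energy_has_int t2.
have /choice[r rP] : forall p : 'I_3 * 'I_3, exists r, has_int leb3 (G p.1 p.2) r.
  move=> [i j] /=; apply: (has_int_ae_dom _ _ _ _ (has_intZ (t * coercivity mu chi)^-1 E2)).
  - apply: measurable_funM.
      by apply: measurable_funX; exact: measurable_coord.
    by apply: has_int_meas; apply: L2complex_normsqc; have [] := sF i.
  - exact: G0.
  - by move=> xi; rewrite mulr_ge0 ?invr_ge0 ?(ltW c0)// addr_ge0.
  - apply: (@ae_imply _ _ _ leb3 _ _ _ pointwise) => xi h; rewrite ler_pdivlMl//; apply: le_trans h.
    rewrite ler_pM2l// -[leLHS]addr0 lerD// (bigD1 i)//= (bigD1 j)//= -addrA lerDl.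
    by rewrite addr_ge0// sumr_ge0// => k _; rewrite sumr_ge0.
have /choice[g gP] : forall p : 'I_3 * 'I_3, exists g : R3 -> R,
    [/\ g \in L2, forall phi, test_function phi ->
      \int[leb3]_x (u t x 0 p.1 * partial p.2 phi x) = - \int[leb3]_x (g x * phi x)
    & planch R * sqn leb3 g <= r p].
  by move=> [i j]; exact: weak_derivative_exists (sF i) (rP (i, j)).
exists (fun x => \matrix_(i, j) g (i, j) x).
have mxE' i j : (fun x => (\matrix_(i, j) g (i, j) x) i j) = g (i, j).
  by apply/funext => x; rewrite mxE.
have gL : L2field (fun x => \matrix_(i, j) g (i, j) x : 'M[R]_3).
  by move=> i j; rewrite mxE'; have [] := gP (i, j).
split => //.
  move=> i j phi tphi; have [_ /(_ _ tphi) -> _] := gP (i, j).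
  by congr (- _); apply: eq_Rintegral => x _; rewrite mxE.
rewrite mulrA -(ler_pM2l (planch_gt0 R)) mulrCA.
(* The constant [planch] multiplies the norms of w and of the energy, and the bounds on the entries
   of [g] carry it too; all is compared after multiplying by it. *)
apply: le_trans (has_int_ae_le pointwise (has_intZ _ (has_intD
  (has_int_sum _ (fun i => has_int_sum _ (fun j => rP (i, j)))) wi)) E2).
rewrite ler_pM2l// addrC mulrDr lerD2r L2normsqE// mulr_sumr.
apply: ler_sum => i _; rewrite mulr_sumr; apply: ler_sum => j _.
by rewrite mxE'; have [] := gP (i, j).
Qed.

End Energy.

Theorem propositionA2 (R : realType) (mu chi gamma kappa Gamma : R)
    (u0 w0 : R3 R -> 'rV[R]_3) (u w : R -> R3 R -> 'rV[R]_3)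
    (mu_gt0 : 0 < mu) (chi_gt0 : 0 < chi)
    (gamma_ge0 : 0 <= gamma) (kappa_ge0 : 0 <= kappa) (Gamma_ge0 : 0 <= Gamma)
    (u0_L2sigma : L2sigma u0) (w0_L2 : L2field w0)
    (sol : micropolar_solution mu chi gamma kappa u0 w0 u w)
    (u_decay :
       bigO_pinfty (fun t => L2normsq (u t)) (fun t => t `^ (- Gamma))) :
  exists g : R -> R3 R -> 'M[R]_3,
    (forall t : R, 0 < t -> L2field (g t) /\ weak_gradient (u t) (g t)) /\
    bigO_pinfty (fun t => L2normsq (w t) + L2normsq (g t))
                (fun t => t `^ (- Gamma - 1)).
Proof.
have [U [W [_ uU ode]]] := sol.
(* A gradient is chosen at each time separately; at nonpositive times the zero field is a
   placeholder. *)
have /choice[g gP] : forall t, exists g : R3 R -> 'M[R]_3, 0 < t ->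
    [/\ L2field g, weak_gradient (u t) g &
      t * (coercivity mu chi * (L2normsq (w t) + L2normsq g))
      <= L2normsq (u (t / 2)) + L2normsq (w (t / 2))].
  move=> t; have [t0|t0] := ltP 0 t; last by exists (fun=> 0).
  have [g gP] := weak_gradient_smoothing mu_gt0 chi_gt0 gamma_ge0 kappa_ge0 uU ode t0.
  by exists g.
exists g; split; first by move=> t /gP[].
rewrite -opprD; apply/bigO_decays.
  by move=> t; rewrite addr_ge0 ?L2normsq_ge0.
apply: (@smoothing_decay _ (fun t => L2normsq (u t)) _ _ (coercivity mu chi)) => //.
- exact: coercivity_gt0.
- by move=> t; exact: L2normsq_ge0.
- by move=> t; exact: L2normsq_ge0.
- by move=> t; exact: L2normsq_ge0.
- by move=> s t; exact: (L2_energy_nonincreasing mu_gt0 chi_gt0 gamma_ge0 kappa_ge0 uU ode).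
- by move=> t /gP[].
- by apply/bigO_decays => // t; exact: L2normsq_ge0.
Qed.
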